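(* There is an $\varepsilon > 0$ such that every rectangular torus $\hat\tau = iY$ with $1 \le Y < 1 + \varepsilon$ and every rhombic torus $\hat\tau = \tfrac12 + iH$ with $\tfrac{\sqrt3}{2} \le H < \tfrac{\sqrt3}{2} + \varepsilon$ is realized by an $8$-vertex paper torus.
   Context: A flat torus is a torus with a locally Euclidean metric, i.e. isometric to $\mathbb{C}/\Lambda$ for a lattice $\Lambda$. A positively oriented basis $\Lambda = \mathbb{Z}v_1 \oplus \mathbb{Z}v_2$ gives $\tau = v_2/v_1 \in \mathbb{H}$; changing basis acts by $\mathrm{PSL}(2,\mathbb{Z})$. The reduced modulus $\hat\tau$ is the representative of the orbit of $\tau$ in $\mathcal{D} = \{z \in \mathbb{H} : |z| \ge 1,\ |\operatorname{Re} z| \le \tfrac12\}$, taking $\operatorname{Re}\hat\tau \ge 0$ when the representative is not unique. Flat tori are considered up to scaling, and ''the torus $\hat\tau = \tau_1$'' means the flat torus with reduced modulus $\tau_1$. A triangulation of the torus is a simplicial complex $T$ homeomorphic to the torus, with vertex set $V$. A map $q : V \to \mathbb{R}^3$ extends uniquely to a piecewise linear map $T \to \mathbb{R}^3$, affine on each face. An $8$-vertex paper torus is the image of such a map for a triangulation with $|V| = 8$, where all faces are nondegenerate triangles, the map is injective, and at every vertex the cone angle (the sum of the angles of the incident triangles, measured in $\mathbb{R}^3$) equals $2\pi$. Its intrinsic metric is then a flat torus, and that flat torus is said to be realized by it. *)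

(* Defs.v *)
From HB Require Import structures.
From mathcomp Require Import all_boot all_order all_algebra.
From mathcomp Require Import all_classical all_reals all_analysis.
From mathcomp Require Import complex.

Set Implicit Arguments.
Unset Strict Implicit.
Unset Printing Implicit Defensive.

Import Order.TTheory GRing.Theory Num.Theory.
Import numFieldNormedType.Exports.

Local Open Scope classical_set_scope.
Local Open Scope ring_scope.

(* The library norm on 'rV[R]_n is the sup norm; it gives the right topology but
   lengths and angles need the Euclidean one. *)
Definition dot (R : realType) (n : nat) (u v : 'rV[R]_n) : R :=
  \sum_(i < n) u 0 i * v 0 i.

Definition enorm (R : realType) (n : nat) (u : 'rV[R]_n) : R :=
  Num.sqrt (dot u u).

Definition angle (R : realType) (n : nat) (p a b : 'rV[R]_n) : R :=
  acos (dot (a - p) (b - p) / (enorm (a - p) * enorm (b - p))).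

Definition homeomorphic (S T : topologicalType) (A : set S) (B : set T) : Prop :=
  exists (f : S -> T) (g : T -> S),
    [/\ {within A, continuous f} /\ {within B, continuous g},
        (forall x, A x -> B (f x)), (forall y, B y -> A (g y)),
        (forall x, A x -> g (f x) = x) & (forall y, B y -> f (g y) = y)].

Definition circle (R : realType) : set (R * R) :=
  [set p : R * R | p.1 ^+ 2 + p.2 ^+ 2 = 1].

Definition torus (R : realType) : set ((R * R) * (R * R)) :=
  @circle R `*` @circle R.

(* Simplices are the nonempty vertex sets in K; every element of 'I_n is
   required to be a vertex, so the vertex set has exactly n elements. *)
Definition simplicial_complex (n : nat) (K : {set {set 'I_n}}) : Prop :=
  [/\ finset.set0 \notin K,
      (forall v : 'I_n, [set v]%SET \in K) &
      (forall A B : {set 'I_n},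
          A \in K -> B \subset A -> B != finset.set0 -> B \in K)].

(* Points are given by their barycentric coordinates. *)
Definition geometric_realization (R : realType) (n : nat)
    (K : {set {set 'I_n}}) : set 'rV[R]_n :=
  [set x : 'rV[R]_n |
     [/\ (forall v, 0 <= x 0 v), \sum_v x 0 v = 1 &
         [set v | x 0 v != 0]%SET \in K]].
Arguments geometric_realization R {n} K.

Definition torus_triangulation (R : realType) (n : nat)
    (K : {set {set 'I_n}}) : Prop :=
  simplicial_complex K /\
  homeomorphic (geometric_realization R K) (@torus R).

Definition faces (n : nat) (K : {set {set 'I_n}}) : {set {set 'I_n}} :=
  [set A in K | #|A| == 3%N]%SET.

Definition pl_map (R : realType) (n : nat) (q : 'I_n -> 'rV[R]_3)
    (x : 'rV[R]_n) : 'rV[R]_3 :=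
  \sum_v x 0 v *: q v.

Definition nondegenerate_triangle (R : realType) (p a b : 'rV[R]_3) : Prop :=
  free [:: a - p; b - p].

(* The condition p.1 < p.2 makes each face at v contribute once. *)
Definition cone_angle (R : realType) (n : nat) (K : {set {set 'I_n}})
    (q : 'I_n -> 'rV[R]_3) (v : 'I_n) : R :=
  \sum_(p : 'I_n * 'I_n |
          (p.1 < p.2)%N && ([set v; p.1; p.2]%SET \in faces K))
     angle (q v) (q p.1) (q p.2).

Definition paper_torus (R : realType) (n : nat) (X : set 'rV[R]_3) : Prop :=
  exists (K : {set {set 'I_n}}) (q : 'I_n -> 'rV[R]_3),
    [/\ torus_triangulation R K,
        (forall u v w : 'I_n, [set u; v; w]%SET \in faces K ->
           nondegenerate_triangle (q u) (q v) (q w)),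
        {in geometric_realization R K &, injective (pl_map q)},
        (forall v : 'I_n, cone_angle K q v = 2 * pi) &
        X = pl_map q @` geometric_realization R K].

Definition polygon_length (R : realType) (n : nat) (a b : R)
    (f : R -> 'rV[R]_n) (s : seq R) : R :=
  \sum_(0 <= k < size s)
     enorm (f (nth b (a :: s) k.+1) - f (nth b (a :: s) k)).

Definition path_length (R : realType) (n : nat) (a b : R)
    (f : R -> 'rV[R]_n) : \bar R :=
  ereal_sup [set (polygon_length a b f s)%:E | s in itv_partition a b].

Definition path_in (R : realType) (n : nat) (X : set 'rV[R]_n)
    (x y : 'rV[R]_n) (f : R -> 'rV[R]_n) : Prop :=
  [/\ {within `[0, 1], continuous f}, f 0 = x, f 1 = y &
      forall t, 0 <= t <= 1 -> X (f t)].

Definition intrinsic_dist (R : realType) (n : nat) (X : set 'rV[R]_n)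
    (x y : 'rV[R]_n) : \bar R :=
  ereal_inf [set path_length 0 1 f | f in path_in X x y].

Definition lattice (R : realType) (v1 v2 : R[i]) : set R[i] :=
  [set z : R[i] | exists m n : int, z = m%:~R * v1 + n%:~R * v2].

Definition coset (R : realType) (L : set R[i]) (z : R[i]) : set R[i] :=
  [set z + l | l in L].

(* C/L, as a set of cosets. *)
Definition flat_torus (R : realType) (L : set R[i]) : set (set R[i]) :=
  range (coset L).

(* On cosets of L this is the quotient metric of C/L. *)
Definition flat_dist (R : realType) (A B : set R[i]) : \bar R :=
  ereal_inf [set d | exists a b : R[i],
                       [/\ A a, B b & d = (Normc.normc (a - b))%:E]].

Definition intrinsically_isometric (R : realType) (n : nat)
    (X : set 'rV[R]_n) (L : set R[i]) : Prop :=
  exists f : set R[i] -> 'rV[R]_n,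
    set_bij (flat_torus L) X f /\
    (forall A B, flat_torus L A -> flat_torus L B ->
       intrinsic_dist X (f A) (f B) = flat_dist A B).

Definition same_modular_orbit (R : realType) (t t' : R[i]) : Prop :=
  exists a b c d : int, a * d - b * c = 1 /\
    t' = (a%:~R * t + b%:~R) / (c%:~R * t + d%:~R).

Definition modular_domain (R : realType) : set R[i] :=
  [set z : R[i] |
     [/\ 0 < complex.Im z, 1 <= Normc.normc z & `|complex.Re z| <= 2^-1]].

Definition reduced_modulus (R : realType) (t t' : R[i]) : Prop :=
  [/\ same_modular_orbit t t', modular_domain t' &
      (forall t'', same_modular_orbit t t'' -> modular_domain t'' ->
         t'' <> t' -> 0 <= complex.Re t')].

(* Letting the lattice vary among all those with reduced modulus tau accounts
   for flat tori being taken up to scaling. *)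
Definition realizes (R : realType) (X : set 'rV[R]_3) (tau : R[i]) : Prop :=
  exists v1 v2 : R[i],
    [/\ v1 != 0, 0 < complex.Im (v2 / v1), reduced_modulus (v2 / v1) tau &
        intrinsically_isometric X (lattice v1 v2)].

(* Main.v *)
From HB Require Import structures.
From Stdlib Require Import ZArith.
Require Import Defs.
From mathcomp Require Import all_boot all_order all_algebra.
From mathcomp Require Import all_classical all_reals all_analysis.
From mathcomp Require Import complex ssrZ zify ring lra.

Set Implicit Arguments.
Unset Strict Implicit.
Unset Printing Implicit Defensive.

Import Order.TTheory GRing.Theory Num.Theory.
Import numFieldNormedType.Exports.

Local Open Scope classical_set_scope.
Local Open Scope ring_scope.
Local Open Scope complex_scope.

(* A numerical search gave two 8-vertex triangulations of the torus, with vertices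
   in space and developed in the plane modulo a lattice, whose 24 edges have almost
   the same length in space and in the plane, for the moduli i and (1 + i sqrt 3)/2.
   Fixing 16 of the 40 coordinates, the 24 equations "length in space = length in
   the plane" are solved exactly near this data, for every height of the lattice
   in a small interval, by the contraction x |-> x - A f(x) / D, with A / D an
   approximate inverse Jacobian.  At the exact solution the faces are congruent to
   those of an embedded geodesic triangulation of the flat torus, so the polyhedral
   surface is flat, with that modulus.  Injectivity in space and in the plane
   modulo the lattice follows from lines and planes strictly separating the faces;
   these signs, like the contraction estimates, are robust, and are decided by
   integer interval arithmetic. *)

(** * Partitions adapted to a closed cover *)

(** Taking the planar coordinates as unknowns beside the spatial ones turns flatness into equality
    of lengths: no angle enters the equations, which are quadratic, and the cone angles come out as
    the full turns made by the links in the plane. A triangulated torus with 8 vertices has 24 edges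
    and 16 faces, so 40 unknowns leave 16 parameters; motions of space and translations of the plane
    account for 8 of them. Freezing 16 well-chosen coordinates leaves a square system with
    invertible Jacobian. The height of the lattice enters as an interval, so one computation per
    family treats all the moduli concerned. Congruent faces alone do not determine the global
    metric: the developed faces must tile the plane. That no point is missed is shown by looking at
    the point of the tiling nearest to a given one: the faces around it extend in all directions, so
    it can only be the given point itself. Distances on the surface and in the quotient are then
    compared by cutting segments and paths into pieces that each join two points of one face. *)

Lemma closed_cover_chain (R : realType) (I : eqType) (C : I -> set R) (l : seq I) (a b : R) :
  a <= b -> (forall i, i \in l -> closed (C i)) ->
  (forall t, a <= t <= b -> exists2 i, i \in l & C i t) ->
  exists2 s, itv_partition a b s &
    path (fun x y => `[< exists2 i, i \in l & C i x /\ C i y >]) a s.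
Proof.
move=> leab; have [n] := ubnP (size l); elim: n l a leab => // n IH l a leab lsz clC cov.
move: (leab); rewrite le_eqVlt => /predU1P[->|ltab]; first by exists [::].
have [i il Cia] : exists2 i, i \in l & C i a by apply: cov; rewrite lexx leab.
(* Greedy step: jump from [a] to the last point [s] of the set containing [a]. Beyond [s] this set
   is not met again, so it leaves the list and the induction runs on the length of the list. *)
pose E := C i `&` `[a, b]%classic.
have clE : closed E.
  by apply: closedI; [exact: clC | exact: interval_closed].
have Ea : E a by split=> //=; rewrite in_itv /= lexx leab.
have ubE : has_ubound E by exists b => x [_] /=; rewrite in_itv /= => /andP[].
have Es : E (sup E).
  by move: (closure_sup (ex_intro _ a Ea) ubE); rewrite -(closure_id E).1.
set s := sup E in Es *; have [Cis] := Es; rewrite /= in_itv /= => /andP[les lesb].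
have lub x : E x -> x <= s by move=> Ex; exact: sup_ubound.
move: lesb; rewrite le_eqVlt => /predU1P[sb|ltsb].
  exists [:: b]; first by rewrite /itv_partition /= ltab eqxx.
  by rewrite /= andbT; apply/asboolP; exists i => //; move: Cis; rewrite sb.
pose l' := rem i l.
have cov1 t : s < t <= b -> exists2 j, j \in l' & C j t.
  case/andP=> st tb; have [j jl Cjt] := cov t ltac:(by rewrite tb andbT; exact/ltW/(le_lt_trans les)).
  exists j => //; case: (j =P i) => [ji|/eqP ji].
    suff /lub : E t by rewrite leNgt st.
    by split; [rewrite -ji | rewrite /= in_itv /= tb andbT (le_trans les) // ltW].
  by have /perm_mem/(_ j) := perm_to_rem il; rewrite jl inE (negPf ji) /= => <-.
have cov' t : s <= t <= b -> exists2 j, j \in l' & C j t.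
  case/andP; rewrite le_eqVlt => /predU1P[<- _|st tb]; last by apply: cov1; rewrite st.
  (* The point [s] itself is a limit of points to its right, which lie in the finite, hence closed,
     union of the remaining sets. *)
  pose U := \big[setU/set0]_(j <- l') C j.
  have clU : closed U.
    rewrite /U big_seq; apply: (big_ind (fun A => closed A)).
    - exact: closed0.
    - by move=> A B; exact: closedU.
    - by move=> j /mem_rem /clC.
  have memU x : U x <-> exists2 j, j \in l' & C j x.
    rewrite /U; elim: (l') => [|k r IHr]; first by rewrite big_nil; split=> [//|[]].
    rewrite big_cons; split.
      case=> [Ckx|/IHr[j jr Cj]]; first by exists k => //; rewrite inE eqxx.
      by exists j => //; rewrite inE jr orbT.
    case=> j; rewrite inE => /predU1P[->|jr] Cj; first by left.
    by right; apply/IHr; exists j.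
  apply/memU; rewrite (closure_id U).1 //.
  move=> B /nbhs_ballP[e /= e0 seB].
  pose t' := Num.min (s + e / 2) b.
  have st' : s < t' by rewrite /t' lt_min ltsb andbT ltrDl divr_gt0.
  exists t'; split; first by apply/memU; apply: cov1; rewrite st' /t' ge_min lexx orbT.
  apply: seB; rewrite /ball /= distrC gtr0_norm ?subr_gt0 //.
  rewrite ltrBlDl /t' gt_min; apply/orP; left.
  by rewrite ltrD2l ltr_pdivrMr // ltr_pMr // ltr1n.
have il' : {subset l' <= l} by move=> j /mem_rem.
have szl' : (size l' < n)%N.
  by move: lsz; rewrite /l' size_rem // ltnS; case: (l) il => //= ? ? _; exact.
have clC' j : j \in l' -> closed (C j) by move=> /il'; exact: clC.
have [r rP rC] := IH l' s (ltW ltsb) szl' clC' cov'.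
have rC' : path (fun x y => `[< exists2 i, i \in l & C i x /\ C i y >]) s r.
  apply: sub_path rC => x y /asboolP[j /il' jl ?]; apply/asboolP; by exists j.
(* A partition increases strictly, so no point is added when [s = a]. *)
move: (les); rewrite le_eqVlt => /predU1P[as_|ltas].
  by rewrite as_; exists r.
case: rP => rP rl; exists (s :: r); first by split => //=; rewrite ltas.
by rewrite /= rC' andbT; apply/asboolP; exists i.
Qed.

(** * Oriented angles in the plane *)

Section PlaneVectors.
Variable R : realType.
Implicit Types z w u d : R[i].

(** Real and imaginary part of [w] times the conjugate of [z]. Positivity of [ccross] says that [w]
    lies counterclockwise of [z] by less than a half turn. *)
Definition cdot z w : R := complex.Re z * complex.Re w + complex.Im z * complex.Im w.
Definition ccross z w : R := complex.Re z * complex.Im w - complex.Im z * complex.Re w.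

Lemma normcE z : Normc.normc z = Num.sqrt (cdot z z).
Proof. by case: z => a b; rewrite /cdot /= !expr2. Qed.

Lemma cdot_ge0 z : 0 <= cdot z z.
Proof. by rewrite /cdot -!expr2 addr_ge0 // sqr_ge0. Qed.

Lemma normc_sqr z : Normc.normc z ^+ 2 = cdot z z.
Proof. by rewrite normcE sqr_sqrtr // cdot_ge0. Qed.

Lemma normc_ge0 z : 0 <= Normc.normc z.
Proof. by rewrite normcE sqrtr_ge0. Qed.

(** Same formula as [angle] in space, so that equal lengths give equal values; orientation is
    supplied separately by the sign of [ccross]. *)
Definition carg z w : R := acos (cdot z w / (Normc.normc z * Normc.normc w)).

Lemma ccross_gt0_norm z w : 0 < ccross z w -> 0 < Normc.normc z /\ 0 < Normc.normc w.
Proof.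
case: z w => a b [c d]; rewrite /ccross /= => h.
have pos (x y : R) : (x != 0) || (y != 0) -> 0 < Num.sqrt (x ^+ 2 + y ^+ 2).
  move=> xy; rewrite sqrtr_gt0 lt0r addr_ge0 ?sqr_ge0 // andbT.
  by rewrite paddr_eq0 ?sqr_ge0 // !sqrf_eq0 negb_and.
split; apply: pos; rewrite -negb_and; apply: contraTN h => /andP[/eqP-> /eqP->];
  by rewrite ?(mul0r, mulr0) subrr ltxx.
Qed.

(** Lagrange's identity makes the squares of the two quotients add up to 1, and positivity of
    [ccross] selects the branch of the sine. *)
Lemma carg_cos_sin z w : 0 < ccross z w ->
  [/\ cos (carg z w) = cdot z w / (Normc.normc z * Normc.normc w),
      sin (carg z w) = ccross z w / (Normc.normc z * Normc.normc w) &
      0 < carg z w < pi].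
Proof.
move=> h; have [nz nw] := ccross_gt0_norm h.
set n := Normc.normc z * Normc.normc w.
have n0 : 0 < n by rewrite mulr_gt0.
have lagr : cdot z w ^+ 2 + ccross z w ^+ 2 = n ^+ 2.
  rewrite /n exprMn !normc_sqr /cdot /ccross; ring.
set c := cdot z w / n; set s := ccross z w / n.
have cs : c ^+ 2 + s ^+ 2 = 1.
  by rewrite !expr_div_n -mulrDl lagr divff // expf_neq0 // gt_eqF.
have s0 : 0 < s by rewrite divr_gt0.
have c1 : -1 < c < 1.
  rewrite -ltr_norml -sqrtr_sqr -sqrtr1 ltr_sqrt //.
  by rewrite -cs ltrDl exprn_gt0.
case/andP: (c1) => c_m1 c_1.
have cle : -1 <= c <= 1 by rewrite !ltW.
split.
- by rewrite /carg acosK // in_itv.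
- rewrite /carg sin_acos // -/n -/c -cs addrAC subrr add0r sqrtr_sqr gtr0_norm //.
- by rewrite /carg acos_gt0 ?acos_ltpi // ?(ltW c_m1) ?c_1 ?c_m1 // ltW.
Qed.

(** Multiplicativity of complex numbers: the conjugate of [z] times [w], multiplied by the conjugate
    of [w] times [u], is the squared norm of [w] times the corresponding product for [z] and [u].
    [key1] and [key2] are the real and imaginary part of this. *)
Lemma carg_sum z w u : 0 < ccross z w -> 0 < ccross w u ->
  cos (carg z w + carg w u) = cdot z u / (Normc.normc z * Normc.normc u) /\
  sin (carg z w + carg w u) = ccross z u / (Normc.normc z * Normc.normc u).
Proof.
move=> h1 h2; have [c1 s1 _] := carg_cos_sin h1; have [c2 s2 _] := carg_cos_sin h2.
have [nz nw] := ccross_gt0_norm h1; have [_ nu] := ccross_gt0_norm h2.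
rewrite cosD sinD c1 s1 c2 s2.
have nz0 := gt_eqF nz; have nw0 := gt_eqF nw; have nu0 := gt_eqF nu.
have key1 : cdot z w * cdot w u - ccross z w * ccross w u = Normc.normc w ^+ 2 * cdot z u.
  rewrite normc_sqr /cdot /ccross; ring.
have key2 : ccross z w * cdot w u + cdot z w * ccross w u = Normc.normc w ^+ 2 * ccross z u.
  rewrite normc_sqr /cdot /ccross; ring.
split.
- transitivity ((cdot z w * cdot w u - ccross z w * ccross w u) /
    (Normc.normc z * Normc.normc w ^+ 2 * Normc.normc u)); last rewrite key1;
  by field; rewrite nz0 nw0 nu0.
- transitivity ((ccross z w * cdot w u + cdot z w * ccross w u) /
    (Normc.normc z * Normc.normc w ^+ 2 * Normc.normc u)); last rewrite key2;
  by field; rewrite nz0 nw0 nu0.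
Qed.

Lemma sin_pos_range (a b : R) : 0 < a < pi -> 0 < b < pi -> 0 < sin (a + b) -> a + b < pi.
Proof.
move=> /andP[a0 ap] /andP[b0 bp]; apply: contraTT; rewrite -!leNgt => h.
rewrite -(subrK pi (a + b)) sinDpi oppr_le0 sin_ge0_pi // subr_ge0 h /=; lra.
Qed.

Lemma carg_add z w u : 0 < ccross z w -> 0 < ccross w u -> 0 < ccross z u ->
  carg z w + carg w u = carg z u.
Proof.
move=> h1 h2 h3; have [cE sE] := carg_sum h1 h2.
have [_ _ r1] := carg_cos_sin h1; have [_ _ r2] := carg_cos_sin h2.
have [nz nu] := ccross_gt0_norm h3.
rewrite /carg -cE -/(carg z w) -/(carg w u) cosK //.
have : carg z w + carg w u < pi.
  by apply: sin_pos_range => //; rewrite sE divr_gt0 // mulr_gt0.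
rewrite in_itv /= => h; case/andP: r1 => r1 _; case/andP: r2 => r2 _.
by rewrite (ltW h) ltW // addr_gt0.
Qed.

(** Three directions winding once around the origin: the first two angles add up to at least a half
    turn, because the sine of the sum is negative, and [acos] then returns what is missing to a full
    turn. *)
Lemma carg_triangle z w u : 0 < ccross z w -> 0 < ccross w u -> 0 < ccross u z ->
  carg z w + carg w u + carg u z = 2 * pi.
Proof.
move=> h1 h2 h3; have [cE sE] := carg_sum h1 h2.
have [_ _ /andP[a0 ap]] := carg_cos_sin h1.
have [_ _ /andP[b0 bp]] := carg_cos_sin h2.
have [nu nz] := ccross_gt0_norm h3.
set t := carg z w + carg w u in cE sE *.
have tpi : pi <= t.
  rewrite leNgt; apply/negP => lt.
  have : 0 < sin t by apply: sin_gt0_pi; rewrite lt /t addr_gt0.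
  have -> : sin t = - (ccross u z / (Normc.normc z * Normc.normc u)).
    by rewrite sE -mulNr; congr (_ / _); rewrite /ccross; ring.
  by rewrite oppr_gt0 ltNge ltW // divr_gt0 // mulr_gt0.
have -> : carg u z = 2 * pi - t; last by rewrite addrC subrK.
have -> : carg u z = acos (cos (2 * pi - t)).
  have -> : 2 * pi - t = - (t - (pi *+ 2)) by rewrite opprB mulr_natl.
  rewrite cosN -(cosD2pi (t - _)) subrK cE.
  by rewrite /carg [cdot u z]/cdot [cdot z u]/cdot; congr (acos (_ / _)); ring.
rewrite cosK // in_itv /=; move: ap bp tpi; rewrite /t => *; apply/andP; split; lra.
Qed.

End PlaneVectors.

(** * Coordinates of complex numbers *)

Section ComplexCoordinates.
Variable R : realType.
Implicit Types z w : R[i].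

Lemma ReD z w : complex.Re (z + w) = complex.Re z + complex.Re w.
Proof. by case: z w => [? ?] [? ?]. Qed.
Lemma ImD z w : complex.Im (z + w) = complex.Im z + complex.Im w.
Proof. by case: z w => [? ?] [? ?]. Qed.
Lemma ReN z : complex.Re (- z) = - complex.Re z. Proof. by case: z. Qed.
Lemma ImN z : complex.Im (- z) = - complex.Im z. Proof. by case: z. Qed.
Lemma Re_realM (c : R) z : complex.Re (c%:C * z) = c * complex.Re z.
Proof. by case: z => x y /=; rewrite mul0r subr0. Qed.
Lemma Im_realM (c : R) z : complex.Im (c%:C * z) = c * complex.Im z.
Proof. by case: z => x y /=; rewrite mul0r addr0. Qed.
Definition reimE := (ReD, ImD, ReN, ImN, Re_realM, Im_realM).

Lemma complex_ext z w : complex.Re z = complex.Re w -> complex.Im z = complex.Im w -> z = w.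
Proof. by case: z w => [? ?] [? ?] /= -> ->. Qed.
End ComplexCoordinates.

(* A lifted vertex [(v, m, n)] stands for the lift of the vertex [v] of the
   triangulation to the plane translated by [m] and [n] periods. *)
Definition lvertex := (nat * int * int)%type.
Definition label (w : lvertex) : nat := w.1.1.
Definition shift (m n : int) (w : lvertex) : lvertex := (w.1.1, w.1.2 + m, w.2 + n).

(** Only labels matter for the abstract complex; the translations stored in [F] record how each face
    is lifted to the plane. *)
Definition face_complex (F : seq (seq lvertex)) : {set {set 'I_8}} :=
  [set A : {set 'I_8} | (A != finset.set0) &&
     has (fun f => [forall v in A, (v : nat) \in map label f]) F]%SET.

(** * Simplices in barycentric coordinates *)

Section Simplices.
Variable R : realType.
Implicit Types (x y : 'rV[R]_8) (f : seq lvertex).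

(** [inord] sends labels from 8 on to the vertex 0, which is why [good_face] bounds the labels. *)
Definition bary x (w : lvertex) : R := x 0 (inord (label w)).

Definition simplex f : set 'rV[R]_8 :=
  [set x | [/\ forall v, 0 <= x 0 v, \sum_v x 0 v = 1 &
               forall v : 'I_8, x 0 v != 0 -> (v : nat) \in map label f]].

Definition good_face f :=
  [&& size f == 3%N, uniq (map label f) & all (fun w => (label w < 8)%N) f].

Lemma good_faceP f : good_face f -> exists u v w,
  [/\ f = [:: u; v; w], [/\ label u < 8, label v < 8 & label w < 8]%N &
      [/\ label u != label v, label u != label w & label v != label w]].
Proof.
case/and3P => /eqP; case: f => [|u [|v [|w [|? ?]]]] //= _.
rewrite !inE negb_or andbT => /andP[/andP[uv uw] vw] /and4P[u8 v8 w8 _].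
by exists u, v, w.
Qed.

(** Passes from sums over all eight vertices, as in [pl_map], to sums over the three corners of a
    face. *)
Lemma sum_simplex (V : zmodType) f (G : 'I_8 -> V) : good_face f ->
  (forall v : 'I_8, (v : nat) \notin map label f -> G v = 0) ->
  \sum_v G v = \sum_(w <- f) G (inord (label w)).
Proof.
move=> gf G0; have [_ uf lf] := and3P gf.
transitivity (\sum_(v <- map (fun w => inord (label w) : 'I_8) f) G v); last by rewrite big_map.
have uniqr : uniq (map (fun w => inord (label w) : 'I_8) f).
  rewrite (map_comp (fun k => inord k : 'I_8) label) map_inj_in_uniq //.
  by move=> _ _ /mapP[u fu ->] /mapP[v fv ->] /(congr1 (@nat_of_ord 8)); rewrite !inordK ?(allP lf).
transitivity (\sum_(v <- map (fun w => inord (label w) : 'I_8) f) G v); last by rewrite big_map.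
rewrite [RHS]big_uniq //= [RHS]big_mkcond /=; apply: eq_bigr => v _.
case: ifPn => // nv; apply: G0; apply: contra nv => /mapP[w fw vw].
by apply/mapP; exists w => //; apply: val_inj; rewrite /= inordK ?(allP lf).
Qed.

Lemma bary_ge0 f x w : simplex f x -> 0 <= bary x w.
Proof. by case=> h _ _; exact: h. Qed.

Lemma bary_sum1 f x : good_face f -> simplex f x -> \sum_(w <- f) bary x w = 1.
Proof.
move=> gf [_ <- sx]; rewrite (sum_simplex gf) // => v.
by apply: contraNeq; exact: sx.
Qed.

Lemma pl_mapE f x (q : nat -> 'rV[R]_3) : good_face f -> simplex f x ->
  pl_map (fun v : 'I_8 => q v) x = \sum_(w <- f) bary x w *: q (label w).
Proof.
move=> gf [_ _ sx]; rewrite /pl_map (sum_simplex gf).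
  rewrite big_seq [RHS]big_seq; apply: eq_bigr => w fw.
  by rewrite inordK //; have [_ _ /allP] := and3P gf; exact.
move=> v nv; case: (x 0 v =P 0) => [->|/eqP/sx]; first by rewrite scale0r.
by rewrite (negPf nv).
Qed.

Lemma bary_inj f x y : good_face f -> simplex f x -> simplex f y ->
  (forall w, w \in f -> bary x w = bary y w) -> x = y.
Proof.
move=> gf [_ _ sx] [_ _ sy] xy; apply/rowP => v.
case: (boolP ((v : nat) \in map label f)) => [/mapP[w fw vw]|nv].
  by have := xy _ fw; rewrite /bary -vw inord_val.
have -> : x 0 v = 0 by apply/eqP; apply: contraNT nv; exact: sx.
by apply/esym/eqP; apply: contraNT nv; exact: sy.
Qed.

Lemma face_complex_realization F x : all good_face F ->
  geometric_realization R (face_complex F) x <-> exists2 f, f \in F & simplex f x.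
Proof.
move=> gF; split.
  case=> x0 x1; rewrite inE => /andP[_ /hasP[f fF /'forall_implyP sx]].
  by exists f => //; split=> // v xv; apply: sx; rewrite inE.
case=> f fF [x0 x1 sx]; split=> //; rewrite inE; apply/andP; split; last first.
  by apply/hasP; exists f => //; apply/'forall_implyP => v; rewrite inE; exact: sx.
apply/finset.set0Pn; apply: contrapT => nx.
have : \sum_v x 0 v = 0.
  apply: big1 => v _; apply/eqP/negPn/negP => xv; apply: nx; exists v.
  by rewrite inE.
by rewrite x1 => /eqP; rewrite oner_eq0.
Qed.

Lemma face_complex_simplicial F : all good_face F ->
  (forall v : 'I_8, has (fun f => (v : nat) \in map label f) F) ->
  simplicial_complex (face_complex F).
Proof.
move=> gF cov; split.
- by rewrite inE eqxx.
- move=> v; rewrite inE; apply/andP; split.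
    by apply/finset.set0Pn; exists v; rewrite inE.
  have /hasP[f fF vf] := cov v; apply/hasP; exists f => //.
  by apply/'forall_implyP => w; rewrite inE => /eqP ->.
- move=> A B; rewrite !inE => /andP[_ /hasP[f fF /'forall_implyP sA]] /fintype.subsetP BA ->.
  by apply/hasP; exists f => //; apply/'forall_implyP => v /BA; exact: sA.
Qed.

Lemma mem_faces F (u v w : 'I_8) :
  ([set u; v; w]%SET \in faces (face_complex F)) =
  uniq [:: u; v; w] && has (fun f => all (fun k => k \in map label f) [:: u : nat; v : nat; w : nat]) F.
Proof.
rewrite inE inE [LHS]andbC.
have c3 : (#|[set u; v; w]%SET| == 3%N) = uniq [:: u; v; w].
  have -> : [set u; v; w]%SET = [set x in [:: u; v; w]]%SET.
    by apply/setP => z; rewrite !inE orbA.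
  rewrite cardsE; apply/eqP/idP => [h|/card_uniqP -> //].
  by apply/card_uniqP; rewrite h.
rewrite c3; move: (uniq _) => U; congr (_ && _).
rewrite andb_idl; last by move=> _; apply/finset.set0Pn; exists u; rewrite !inE eqxx.
apply: eq_has => f; rewrite [RHS]/= andbT; apply/'forall_implyP/and3P => [h|[hu hv hw] z].
  by split; apply: h; rewrite !inE eqxx ?orbT.
by rewrite !inE -orbA => /or3P[] /eqP ->.
Qed.

Lemma simplex_compact f : compact (simplex f).
Proof.
apply: bounded_closed_compact.
  exists 1; split => // M M1 x [x0 x1 _] /=.
  rewrite /Num.norm /= mx_normrE; apply/bigmax_leP; split; first by rewrite (le_trans _ (ltW M1)).
  move=> [i j] _ /=; rewrite ord1 ger0_norm // (le_trans _ (ltW M1)) //.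
  by rewrite -x1 (bigD1 j) //= lerDl sumr_ge0.
have -> : simplex f = \bigcap_(v in [set: 'I_8]) [set x : 'rV[R]_8 | 0 <= x 0 v] `&`
    ([set x : 'rV[R]_8 | \sum_v x 0 v = 1] `&`
     \bigcap_(v in [set v : 'I_8 | (v : nat) \notin map label f]) [set x : 'rV[R]_8 | x 0 v = 0]).
  apply/seteqP; split => x.
    case=> x0 x1 sx; do !split => //; first by move=> v _; exact: x0.
    by move=> v /= nv; apply/eqP; apply: contraNT nv; exact: sx.
  case=> x0 [x1 sx]; split=> // [v|v]; first exact: x0.
  by apply: contraNT => nv; apply/eqP; exact: sx.
have ctc v : continuous (fun x : 'rV[R]_8 => x 0 v) by exact: coord_continuous.
apply: closedI; last apply: closedI.
- apply: closed_bigI => v _.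
  by apply: (@preimage_closed _ _ (fun x : 'rV[R]_8 => x 0 v) [set t | 0 <= t]) => [x _|];
    [exact: ctc|exact: closed_ge].
- apply: (@preimage_closed _ _ (fun x : 'rV[R]_8 => \sum_v x 0 v) [set t | t = 1]) => [x _|].
    by apply: continuous_big => [|v _]; [exact: add_continuous|exact: ctc].
  exact: closed_eq.
- apply: closed_bigI => v _.
  by apply: (@preimage_closed _ _ (fun x : 'rV[R]_8 => x 0 v) [set t | t = 0]) => [x _|];
    [exact: ctc|exact: closed_eq].
Qed.

End Simplices.

(** * Euclidean norm; inner products from lengths *)

Section EuclideanNorm.
Variables (R : realType) (n : nat).
Implicit Types u v w : 'rV[R]_n.

Lemma dot_ge0 u : 0 <= dot u u.
Proof. by apply: sumr_ge0 => i _; rewrite -expr2 sqr_ge0. Qed.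

Lemma enorm_sqr u : enorm u ^+ 2 = dot u u.
Proof. by rewrite sqr_sqrtr // dot_ge0. Qed.

Lemma enorm_ge0 u : 0 <= enorm u. Proof. exact: sqrtr_ge0. Qed.

(** Compares the Euclidean norm with the sup norm that defines the topology; the continuity of paths
    on the surface rests on this. *)
Lemma coord_le_enorm u i : `|u 0 i| <= enorm u.
Proof.
rewrite -(ger0_norm (enorm_ge0 u)) -ler_sqr ?nnegrE // real_normK ?num_real //.
rewrite real_normK ?num_real // enorm_sqr /dot (bigD1 i) //= -expr2 lerDl.
by apply: sumr_ge0 => j _; rewrite -expr2 sqr_ge0.
Qed.

Lemma dotD_sqr u v (t : R) :
  dot (t *: u + v) (t *: u + v) = t ^+ 2 * dot u u + 2 * t * dot u v + dot v v.
Proof.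
rewrite /dot !mulr_sumr -!big_split /=; apply: eq_bigr => i _; rewrite !mxE; ring.
Qed.

Lemma cauchy_schwarz u v : dot u v <= enorm u * enorm v.
Proof.
have [u0|un0] := eqVneq (dot u u) 0.
  have {u0} u0 i : u 0 i = 0.
    move: u0 => /eqP; rewrite psumr_eq0 => [/allP/(_ i)|j _]; last by rewrite -expr2 sqr_ge0.
    by rewrite mem_index_enum mulf_eq0 orbb => /(_ isT) /eqP.
  by rewrite /dot big1 ?mulr_ge0 ?enorm_ge0 // => i _; rewrite u0 mul0r.
have [->|ne] := eqVneq (dot u v) 0; first by rewrite mulr_ge0 ?enorm_ge0.
have upos : 0 < dot u u by rewrite lt0r un0 dot_ge0.
apply: le_trans (ler_norm _) _.
rewrite -ler_sqr ?nnegrE ?mulr_ge0 ?enorm_ge0 // real_normK ?num_real //.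
rewrite exprMn !enorm_sqr.
(* The vector evaluated here is the component of [v] orthogonal to [u]. *)
have := dot_ge0 (- (dot u v / dot u u) *: u + v); rewrite dotD_sqr.
have -> : (- (dot u v / dot u u)) ^+ 2 * dot u u + 2 * - (dot u v / dot u u) * dot u v + dot v v
  = (dot u u * dot v v - dot u v ^+ 2) / dot u u by field.
by rewrite pmulr_lge0 ?invr_gt0 // subr_ge0.
Qed.

Lemma enormD u v : enorm (u + v) <= enorm u + enorm v.
Proof.
rewrite -ler_sqr ?nnegrE ?addr_ge0 ?enorm_ge0 // sqrrD !enorm_sqr.
have := dotD_sqr u v 1; rewrite scale1r expr1n mul1r mulr1 => ->.
have := cauchy_schwarz u v; lra.
Qed.

Lemma enorm0 : enorm (0 : 'rV[R]_n) = 0.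
Proof. by rewrite /enorm /dot big1 ?sqrtr0 // => i _; rewrite mxE mul0r. Qed.

(** The three side lengths determine the inner product at a corner; together with
    [cdot_polarization] this transfers angles between space and plane. *)
Lemma dot_polarization (p a b : 'rV[R]_n) :
  2 * dot (a - p) (b - p) = dot (a - p) (a - p) + dot (b - p) (b - p) - dot (a - b) (a - b).
Proof.
rewrite /dot !mulr_sumr -sumrN -!big_split /=; apply: eq_bigr => i _; rewrite !mxE; ring.
Qed.

(* Hence two affine maps giving the edges of a face the same lengths induce the
   same metric on it. *)
Lemma dot_combination (a b c : 'rV[R]_n) (x y z : R) : x + y + z = 0 ->
  dot (x *: a + y *: b + z *: c) (x *: a + y *: b + z *: c) =
  - (x * y * dot (a - b) (a - b) + y * z * dot (b - c) (b - c) + x * z * dot (a - c) (a - c)).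
Proof.
move=> h; have -> : z = - x - y by rewrite -(addr0 (- x - y)) -h; ring.
rewrite /dot !mulr_sumr -!big_split -sumrN /=; apply: eq_bigr => i _; rewrite !mxE; ring.
Qed.

End EuclideanNorm.

Section ComplexCombination.
Variable R : realType.

Lemma cdot_polarization (p a b : R[i]) :
  2 * cdot (a - p) (b - p) = cdot (a - p) (a - p) + cdot (b - p) (b - p) - cdot (a - b) (a - b).
Proof. rewrite /cdot !reimE; ring. Qed.

Lemma cdot_combination (a b c : R[i]) (x y z : R) : x + y + z = 0 ->
  cdot (x%:C * a + y%:C * b + z%:C * c) (x%:C * a + y%:C * b + z%:C * c) =
  - (x * y * cdot (a - b) (a - b) + y * z * cdot (b - c) (b - c) + x * z * cdot (a - c) (a - c)).
Proof.
move=> h; have -> : z = - x - y by rewrite -(addr0 (- x - y)) -h; ring.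
rewrite /cdot !reimE; ring.
Qed.

Lemma normcD (z w : R[i]) : Normc.normc (z + w) <= Normc.normc z + Normc.normc w.
Proof. exact: le_normcD. Qed.

End ComplexCombination.

(** * Developing the triangulation *)

Section Development.
Variables (R : realType) (F : seq (seq lvertex)) (S a b : R).
Variables (p : nat -> R[i]) (q : nat -> 'rV[R]_3).

Definition period (m n : int) : R[i] := (m%:~R * S + n%:~R * a) +i* (n%:~R * b).

Definition pos (w : lvertex) : R[i] := p (label w) + period w.1.2 w.2.

Definition dev (f : seq lvertex) (x : 'rV[R]_8) : R[i] :=
  \sum_(w <- f) (bary x w)%:C * pos w.

Lemma periodD m n m' n' : period (m + m') (n + n') = period m n + period m' n'.
Proof. by apply: complex_ext; rewrite /= !rmorphD /=; ring. Qed.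

Lemma periodN m n : period (- m) (- n) = - period m n.
Proof. by apply: complex_ext; rewrite /= !rmorphN /=; ring. Qed.

Lemma period0 : period 0 0 = 0.
Proof. by apply: complex_ext; rewrite /= !mul0r ?addr0. Qed.

Lemma pos_shift m n w : pos (shift m n w) = pos w + period m n.
Proof. by rewrite /pos /= periodD addrA. Qed.

Lemma latticeP z : lattice S%:C (a +i* b) z <-> exists m n, z = period m n.
Proof.
have intC (m : int) : (m%:~R : R[i]) = (m%:~R)%:C by rewrite rmorph_int.
by split=> -[m [n ->]]; exists m, n; rewrite !intC; apply: complex_ext; rewrite /= ?(mul0r, mulr0, subr0, addr0, add0r).
Qed.

(** The lift of the label [v] used by [f]. The default value is never read when [v] is a label of
    [f]. *)
Definition lookup (f : seq lvertex) (v : nat) : lvertex :=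
  nth (0%N, 0, 0) f (index v (map label f)).

Lemma lookup_mem f v : v \in map label f -> lookup f v \in f /\ label (lookup f v) = v.
Proof.
move=> vf; have ltv : (index v (map label f) < size f)%N.
  by rewrite -(size_map label) index_mem.
by rewrite mem_nth // -(nth_map _ 0%N) ?nth_index.
Qed.

Lemma lookup_label f w : uniq (map label f) -> w \in f -> lookup f (label w) = w.
Proof.
move=> uf wf; have ltw : (index w f < size f)%N by rewrite index_mem.
rewrite /lookup -{1}(nth_index (0%N, 0, 0) wf) -(nth_map _ 0%N) // index_uniq ?size_map //.
exact: nth_index.
Qed.

(** A sum over all labels lets the developments of one point in two faces be compared term by
    term. *)
Lemma dev_lookup f x : good_face f -> simplex f x ->
  dev f x = \sum_(v < 8) (x 0 v)%:C * pos (lookup f v).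
Proof.
move=> gf [_ _ sx]; rewrite (sum_simplex gf).
  rewrite /dev big_seq [RHS]big_seq; apply: eq_bigr => w wf.
  have [_ uf /allP/(_ _ wf) lw] := and3P gf.
  by rewrite inordK // lookup_label.
move=> v; case: (x 0 v =P 0) => [->|/eqP/sx ->//]; first by rewrite mul0r.
Qed.

Hypothesis gF : all good_face F.

(** One translation matches all common vertices of two faces, so that the lifts agree along a whole
    shared side and not merely at its ends. *)
Hypothesis compat : forall f g, f \in F -> g \in F -> exists m n : int,
  forall u v, u \in f -> v \in g -> label u = label v -> v = shift m n u.

(** Vertices of nonzero weight belong to both faces, hence are shifted by the same period; the
    weights add up to 1, so this period comes out of the sum. *)
Lemma dev_compat f g x : f \in F -> g \in F -> simplex f x -> simplex g x ->
  exists m n, dev g x = dev f x + period m n.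
Proof.
move=> fF gF' sf sg; have [m [n mn]] := compat fF gF'; exists m, n.
rewrite !dev_lookup ?(allP gF) //.
have -> : period m n = \sum_(v < 8) (x 0 v)%:C * period m n.
  by case: sf => _ x1 _; rewrite -mulr_suml -rmorph_sum x1 mul1r.
rewrite -big_split /=; apply: eq_bigr => v _; rewrite -mulrDr.
case: (x 0 v =P 0) => [->|/eqP xv]; first by rewrite !mul0r.
case: sf sg => _ _ /(_ _ xv) /lookup_mem[lf lfv] [_ _ /(_ _ xv) /lookup_mem[lg lgv]].
by rewrite (mn _ _ lf lg) ?pos_shift // lfv lgv.
Qed.

(** Graph of the covering of the complex by the plane. [dev_inj] and [cover] make it the graph of a
    function of [z], and [compat] identifies its fibres with cosets of the lattice. *)
Definition over x z := exists f m n, [/\ f \in F, simplex f x & z = dev f x + period m n].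

Hypothesis dev_inj : forall f g x y m n, f \in F -> g \in F -> simplex f x -> simplex g y ->
  dev f x = dev g y + period m n -> x = y.

Hypothesis cover : forall z, exists x, over x z.

Lemma over_simplex f x : f \in F -> simplex f x -> over x (dev f x).
Proof. by move=> fF sx; exists f, 0, 0; rewrite period0 addr0. Qed.

Lemma over_shift x z m n : over x z -> over x (z + period m n).
Proof.
move=> [f [m' [n' [fF sx ->]]]]; exists f, (m' + m), (n' + n); split=> //.
by rewrite periodD addrA.
Qed.

Lemma over_uniq x y z : over x z -> over y z -> x = y.
Proof.
move=> [f [m [n [fF sx ->]]]] [g [m' [n' [gF' sy e]]]].
apply: (@dev_inj f g _ _ (m' - m) (n' - n)) => //.
by rewrite periodD periodN; move: e => /(congr1 (fun t => t - period m n)); rewrite addrK addrA => ->.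
Qed.

Lemma over_period x z z' : over x z -> over x z' -> exists m n, z' = z + period m n.
Proof.
move=> [f [m [n [fF sx ->]]]] [g [m' [n' [gF' sy ->]]]].
have [k [l ->]] := dev_compat fF gF' sx sy.
exists (k + m' - m), (l + n' - n); rewrite !periodD periodN; ring.
Qed.

Definition point (z : R[i]) : 'rV[R]_8 := sval (cid (cover z)).

Lemma pointP z : over (point z) z. Proof. by rewrite /point; case: cid. Qed.

Lemma over_point x z : over x z -> point z = x.
Proof. by move=> h; apply: over_uniq h; exact: pointP. Qed.

Lemma realizationP x : geometric_realization R (face_complex F) x <-> exists2 f, f \in F & simplex f x.
Proof. exact: face_complex_realization. Qed.

Lemma point_realization z : geometric_realization R (face_complex F) (point z).
Proof. by apply/realizationP; have [f [m [n [fF sx _]]]] := pointP z; exists f. Qed.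

Definition pl x := pl_map (fun v : 'I_8 => q v) x.

Hypothesis edge : forall f u v, f \in F -> u \in f -> v \in f ->
  dot (q (label u) - q (label v)) (q (label u) - q (label v)) = cdot (pos u - pos v) (pos u - pos v).

(** The differences of barycentric coordinates add up to 0, so both squared lengths are the same
    expression in the squared lengths of the three sides. *)
Lemma dev_isometry f x y : f \in F -> simplex f x -> simplex f y ->
  enorm (pl x - pl y) = Normc.normc (dev f x - dev f y).
Proof.
move=> fF sx sy; have gf := allP gF _ fF.
rewrite normcE /enorm /pl !(pl_mapE q gf) // /dev.
move: (bary_sum1 gf sx) (bary_sum1 gf sy) => x1 y1.
have [u [v [w [fE _ _]]]] := good_faceP gf.
move: x1 y1 (@edge f u v fF) (@edge f v w fF) (@edge f u w fF).
rewrite !fE !big_cons !big_nil !inE !eqxx !orbT => x1 y1 /(_ isT isT) uv /(_ isT isT) vw /(_ isT isT) uw.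
have h : (bary x u - bary y u) + (bary x v - bary y v) + (bary x w - bary y w) = 0.
  by move: x1 y1; rewrite !addr0 => x1 y1; rewrite -(subrr 1) -{1}x1 -y1; ring.
have -> : bary x u *: q (label u) + (bary x v *: q (label v) + (bary x w *: q (label w) + 0)) -
   (bary y u *: q (label u) + (bary y v *: q (label v) + (bary y w *: q (label w) + 0))) =
   (bary x u - bary y u) *: q (label u) + (bary x v - bary y v) *: q (label v) +
   (bary x w - bary y w) *: q (label w).
  by apply/rowP => i; rewrite !mxE; ring.
have -> : (bary x u)%:C * pos u + ((bary x v)%:C * pos v + ((bary x w)%:C * pos w + 0)) -
   ((bary y u)%:C * pos u + ((bary y v)%:C * pos v + ((bary y w)%:C * pos w + 0))) =
   (bary x u - bary y u)%:C * pos u + (bary x v - bary y v)%:C * pos v +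
   (bary x w - bary y w)%:C * pos w.
  by rewrite !rmorphB /=; ring.
by rewrite dot_combination // cdot_combination // uv vw uw.
Qed.

End Development.

(** * Periods and parametrization of the circle *)

Section Trigonometry.
Variable R : realType.

Lemma cosD2pi_int (x : R) (m : int) : cos (x + 2 * pi * m%:~R) = cos x /\ sin (x + 2 * pi * m%:~R) = sin x.
Proof.
have nat_case (k : nat) (y : R) : cos (y + 2 * pi * k%:R) = cos y /\ sin (y + 2 * pi * k%:R) = sin y.
  elim: k y => [|k IH] y; first by rewrite mulr0 addr0.
  have -> : y + 2 * pi * k.+1%:R = (y + pi *+ 2) + 2 * pi * k%:R.
    by rewrite -natr1 -(mulr_natl pi 2); ring.
  by have [-> ->] := IH (y + pi *+ 2); rewrite cosD2pi sinD2pi.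
case: m => k; first exact: nat_case.
have [] := nat_case k.+1 (x + 2 * pi * (Negz k)%:~R).
by rewrite NegzE rmorphN /= mulrN subrK => -> ->.
Qed.

Lemma cos_eq1 (x : R) : cos x = 1 -> exists m : int, x = 2 * pi * m%:~R.
Proof.
move=> cx; have p0 : 0 < 2 * pi :> R by rewrite mulr_gt0 ?pi_gt0.
pose m := Num.floor (x / (2 * pi)); exists m.
pose d := x - 2 * pi * m%:~R.
suff d0 : d = 0 by move: d0 => /eqP; rewrite subr_eq0 => /eqP.
have cd : cos d = 1.
  by have [<- _] := cosD2pi_int d m; rewrite subrK.
have /andP[fl fu] := Num.Theory.real_floor_itv (num_real (x / (2 * pi))).
have d_ge0 : 0 <= d.
  by rewrite subr_ge0 mulrC -ler_pdivlMr.
have d_lt : d < 2 * pi.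
  move: fu; rewrite -/m intrD ltr_pdivrMr // mulrDl mul1r => fu.
  by rewrite /d ltrBlDr addrC (mulrC _ m%:~R).
(* The half angle lies in [[0, pi)], where the sine vanishes only at 0; this rules out a positive
   [d]. *)
have : cos (d / 2 + d / 2) = 1 by rewrite -splitr.
rewrite cosD -!expr2 => h.
have s0 : sin (d / 2) = 0.
  have := cos2Dsin2 (d / 2) => h2; apply/eqP; rewrite -sqrf_eq0; apply/eqP; lra.
case: (ltgtP d 0) d_ge0 => // dpos _.
have : 0 < sin (d / 2) by apply: sin_gt0_pi; lra.
by rewrite s0 ltxx.
Qed.

Lemma circle_cover (u : R * R) : circle u -> exists t, u = (cos (2 * pi * t), sin (2 * pi * t)).
Proof.
case: u => c s; rewrite /circle /= => h.
have c1 : -1 <= c <= 1.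
  rewrite -ler_norml -sqrtr_sqr -sqrtr1 ler_sqrt // -h lerDl sqr_ge0 //.
have p0 : 2 * pi != 0 :> R by rewrite mulf_neq0 // gt_eqF // pi_gt0.
have div (y : R) : 2 * pi * (y / (2 * pi)) = y by rewrite mulrCA divff // mulr1.
have sE : Num.sqrt (1 - c ^+ 2) = `|s| by rewrite -h addrAC subrr add0r sqrtr_sqr.
(* [acos] reaches only the upper half circle, so the sign of [s] decides the sign of the angle. *)
case: (ler0P s) => s0.
  exists (- acos c / (2 * pi)); rewrite div cosN sinN acosK ?in_itv //= sin_acos // sE.
  by rewrite ler0_norm // opprK.
exists (acos c / (2 * pi)); rewrite div acosK ?in_itv //= sin_acos // sE.
by rewrite gtr0_norm.
Qed.

Lemma angle_eq (s t : R) : cos (2 * pi * s) = cos (2 * pi * t) -> sin (2 * pi * s) = sin (2 * pi * t) ->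
  exists m : int, s = t + m%:~R.
Proof.
move=> c1 s1; have : cos (2 * pi * s - 2 * pi * t) = 1.
  by rewrite cosB c1 s1 -!expr2 cos2Dsin2.
move=> /cos_eq1[m h]; exists m.
have p0 : 2 * pi != 0 :> R by rewrite mulf_neq0 // gt_eqF // pi_gt0.
by apply: (mulfI p0) => /=; rewrite [RHS]mulrDr -h; ring.
Qed.

End Trigonometry.

(** * The realization is a torus *)

Section Homeomorphism.
Variables (R : realType) (F : seq (seq lvertex)) (S a b : R) (p : nat -> R[i]).
Hypothesis S0 : 0 < S.
Hypothesis b0 : 0 < b.
Hypothesis gF : all good_face F.

Hypothesis compat : forall f g, f \in F -> g \in F -> exists m n : int,
  forall u v, u \in f -> v \in g -> label u = label v -> v = shift m n u.
Notation dev := (dev S a b p).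
Notation over := (over F S a b p).
Hypothesis dev_inj : forall f g x y m n, f \in F -> g \in F -> simplex f x -> simplex g y ->
  dev f x = dev g y + period S a b m n -> x = y.
Hypothesis cover : forall z, exists x, over x z.

(** Coordinates in the basis of the two periods: [xcoord] along [S] and [ycoord] along [a +i* b]. *)
Definition ycoord (z : R[i]) : R := complex.Im z / b.
Definition xcoord (z : R[i]) : R := (complex.Re z - a * ycoord z) / S.

Definition wrap (z : R[i]) : (R * R) * (R * R) :=
  ((cos (2 * pi * xcoord z), sin (2 * pi * xcoord z)),
   (cos (2 * pi * ycoord z), sin (2 * pi * ycoord z))).

Lemma ycoord_period z m n : ycoord (z + period S a b m n) = ycoord z + n%:~R.
Proof. by rewrite /ycoord ImD /=; field; rewrite gt_eqF. Qed.

Lemma xcoord_period z m n : xcoord (z + period S a b m n) = xcoord z + m%:~R.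
Proof. by rewrite /xcoord ycoord_period ReD /=; field; rewrite gt_eqF. Qed.

Lemma wrap_torus z : torus (wrap z).
Proof. by split; rewrite /circle /= cos2Dsin2. Qed.

Lemma wrap_period z m n : wrap (z + period S a b m n) = wrap z.
Proof.
have turn (t : R) (k : int) :
    cos (2 * pi * (t + k%:~R)) = cos (2 * pi * t) /\ sin (2 * pi * (t + k%:~R)) = sin (2 * pi * t).
  by rewrite [2 * pi * (t + _)]mulrDr; exact: cosD2pi_int.
rewrite /wrap xcoord_period ycoord_period.
by have [-> ->] := turn (xcoord z) m; have [-> ->] := turn (ycoord z) n.
Qed.

Lemma wrap_inj z z' : wrap z = wrap z' -> exists m n, z = z' + period S a b m n.
Proof.
case=> /angle_eq h1 /h1[m xm] /angle_eq h2 /h2[n yn]; exists m, n.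
have yE w : complex.Im w = b * ycoord w by rewrite /ycoord; field; rewrite gt_eqF.
have xE w : complex.Re w = S * xcoord w + a * ycoord w by rewrite /xcoord; field; rewrite gt_eqF.
by apply: complex_ext; rewrite ?xE ?yE ?xcoord_period ?ycoord_period ?xm ?yn.
Qed.

Lemma wrap_surj t : torus t -> exists z, wrap z = t.
Proof.
case: t => t1 t2 [/= /circle_cover[x ->] /circle_cover[y ->]].
exists ((S * x + a * y) +i* (b * y)).
have -> // : wrap ((S * x + a * y) +i* (b * y)) = ((cos (2 * pi * x), sin (2 * pi * x)), (cos (2 * pi * y), sin (2 * pi * y))).
have yE : ycoord ((S * x + a * y) +i* (b * y)) = y by rewrite /ycoord /=; field; rewrite gt_eqF.
have xE : xcoord ((S * x + a * y) +i* (b * y)) = x.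
  by rewrite /xcoord yE /= addrK mulrAC divff ?gt_eqF // mul1r.
by rewrite /wrap xE yE.
Qed.

Lemma bary_continuous w : continuous (fun x : 'rV[R]_8 => bary x w).
Proof. exact: coord_continuous. Qed.

Lemma wrap_dev_continuous f : continuous (fun x : 'rV[R]_8 => wrap (dev f x)).
Proof.
have scaler (T : topologicalType) (c : R) (g : T -> R) : continuous g -> continuous (fun x => g x * c).
  by move=> gc x; apply: cvgMr_tmp; exact: gc.
have scalel (T : topologicalType) (c : R) (g : T -> R) : continuous g -> continuous (fun x => c * g x).
  by move=> gc x; apply: cvgMl_tmp; exact: gc.
have subc (T : topologicalType) (g1 g2 : T -> R) :
    continuous g1 -> continuous g2 -> continuous (fun x => g1 x - g2 x).
  by move=> c1 c2 x; apply: cvgB; [exact: c1 | exact: c2].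
have sumc (l : seq lvertex) (c : lvertex -> R) :
    continuous (fun x : 'rV[R]_8 => \sum_(w <- l) bary x w * c w).
  apply: continuous_big => [|w _]; first exact: add_continuous.
  exact/scaler/bary_continuous.
have imE x : complex.Im (dev f x) = \sum_(w <- f) bary x w * complex.Im (pos S a b p w).
  rewrite /dev; elim: f => [|w l IH]; first by rewrite !big_nil.
  by rewrite !big_cons ImD Im_realM IH.
have reE x : complex.Re (dev f x) = \sum_(w <- f) bary x w * complex.Re (pos S a b p w).
  rewrite /dev; elim: f {imE} => [|w l IH]; first by rewrite !big_nil.
  by rewrite !big_cons ReD Re_realM IH.
have yc : continuous (fun x : 'rV[R]_8 => ycoord (dev f x)).
  have -> : (fun x => ycoord (dev f x)) = (fun x => (\sum_(w <- f) bary x w * complex.Im (pos S a b p w)) * b^-1).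
    by apply/funext => x; rewrite /ycoord imE.
  exact/scaler/sumc.
have xc : continuous (fun x : 'rV[R]_8 => xcoord (dev f x)).
  have -> : (fun x => xcoord (dev f x)) =
      (fun x => (\sum_(w <- f) bary x w * complex.Re (pos S a b p w) - a * ycoord (dev f x)) * S^-1).
    by apply/funext => x; rewrite /xcoord reE.
  by apply/scaler/subc; [exact: sumc | exact/scalel/yc].
have tc (g : R -> R) (c : 'rV[R]_8 -> R) : continuous g -> continuous c ->
    continuous (fun x => g (2 * pi * c x)).
  by move=> gc cc x; apply: continuous_comp; [exact/scalel/cc | exact: gc].
have pairc (T U V : topologicalType) (g1 : T -> U) (g2 : T -> V) :
    continuous g1 -> continuous g2 -> continuous (fun x => (g1 x, g2 x)).
  by move=> c1 c2 x; apply: cvg_pair; [exact: c1 | exact: c2].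
have cc := @continuous_cos R; have sc := @continuous_sin R.
by apply: (pairc _ _ _ _ _ (pairc _ _ _ _ _ (tc _ _ cc xc) (tc _ _ sc xc))
                           (pairc _ _ _ _ _ (tc _ _ cc yc) (tc _ _ sc yc))).
Qed.

(** The first listed face containing [x]; another choice changes [dev] by a period, which [wrap]
    forgets. Off the realization the value is the empty face. *)
Definition face_of (x : 'rV[R]_8) := nth [::] F (find (fun f => `[< simplex f x >]) F).
Definition to_torus x := wrap (dev (face_of x) x).

Lemma to_torusE f x : f \in F -> simplex f x -> to_torus x = wrap (dev f x).
Proof.
move=> fF sx; have hx : has (fun f => `[< simplex f x >]) F.
  by apply/hasP; exists f => //; apply/asboolP.
have sx' : simplex (face_of x) x by apply/asboolP; exact: (nth_find [::] hx).
have gF' : face_of x \in F by rewrite mem_nth // -has_find.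
rewrite /to_torus; have [m [n ->]] := dev_compat S a b p gF compat fF gF' sx sx'.
by rewrite wrap_period.
Qed.

Lemma to_torus_over x z : over x z -> to_torus x = wrap z.
Proof.
by move=> [f [m [n [fF sx ->]]]]; rewrite (to_torusE fF sx) wrap_period.
Qed.

(** Pasting along finitely many closed simplices: on the simplex of [f] the map is [wrap] after
    [dev f], which is continuous on the whole space. *)
Lemma to_torus_continuous :
  {within geometric_realization R (face_complex F), continuous to_torus}.
Proof.
have -> : geometric_realization R (face_complex F) = \big[setU/set0]_(f <- F) simplex f.
  apply/seteqP; split=> x; rewrite -bigcup_seq.
    by move/(realizationP gF) => [f fF sx]; exists f.
  by case=> f fF sx; apply/(realizationP gF); exists f.
pose P (A : set 'rV[R]_8) := {within A, continuous to_torus}.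
have closed_simplex f : closed (@simplex R f).
  by apply: compact_closed; [exact: norm_hausdorff | exact: simplex_compact].
have closed_union (l : seq (seq lvertex)) : closed (\big[setU/set0]_(f <- l) @simplex R f).
  by elim: l => [|f l IH]; rewrite ?big_nil ?big_cons; [exact: closed0 | exact: closedU].
suff H (l : seq (seq lvertex)) : {subset l <= F} -> P (\big[setU/set0]_(f <- l) simplex f) by exact: H.
elim: l => [_|f l IH sl]; first by rewrite big_nil; exact: continuous_subspace0.
rewrite big_cons; apply: withinU_continuous => //; last first.
  by apply: IH => g gl; apply: sl; rewrite inE gl orbT.
apply: (@subspace_eq_continuous _ _ _ (fun x => wrap (dev f x))).
  by move=> x /set_mem sx; apply/esym/to_torusE => //; apply: sl; rewrite inE eqxx.
exact/continuous_subspaceT/wrap_dev_continuous.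
Qed.

Lemma to_torus_inj x y :
  geometric_realization R (face_complex F) x -> geometric_realization R (face_complex F) y ->
  to_torus x = to_torus y -> x = y.
Proof.
move=> /(realizationP gF)[f fF sx] /(realizationP gF)[g gF' sy].
rewrite (to_torusE fF sx) (to_torusE gF' sy) => /wrap_inj[m [n h]].
exact: dev_inj h.
Qed.

Lemma to_torus_surj t : torus t ->
  exists2 x, geometric_realization R (face_complex F) x & to_torus x = t.
Proof.
move=> /wrap_surj[z <-]; have [x xz] := cover z; exists x; last exact: to_torus_over.
by apply/(realizationP gF); case: xz => f [m [n [fF sx _]]]; exists f.
Qed.

Lemma realization_compact : compact (geometric_realization R (face_complex F)).
Proof.
have -> : geometric_realization R (face_complex F) = \big[setU/set0]_(f <- F) @simplex R f.
  apply/seteqP; split=> x; rewrite -bigcup_seq.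
    by move/(realizationP gF) => [f fF sx]; exists f.
  by case=> f fF sx; apply/(realizationP gF); exists f.
suff H (l : seq (seq lvertex)) : compact (\big[setU/set0]_(f <- l) @simplex R f) by exact: H.
elim: l => [|f l IH]; first by rewrite big_nil; exact: compact0.
by rewrite big_cons; apply: compactU; [exact: simplex_compact | exact: IH].
Qed.

Lemma realization_homeomorphic_torus :
  homeomorphic (geometric_realization R (face_complex F)) (@torus R).
Proof.
pose G := geometric_realization R (face_complex F).
pose inv t := xget 0 [set x | G x /\ to_torus x = t].
have invP t : torus t -> G (inv t) /\ to_torus (inv t) = t.
  by move=> /to_torus_surj[x Gx xt]; apply: (@xgetPex _ 0 [set x | G x /\ to_torus x = t]); exists x.
have torusP x : G x -> torus (to_torus x).
  by move=> /(realizationP gF)[f fF sx]; rewrite (to_torusE fF sx); exact: wrap_torus.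
exists to_torus, inv; split.
- split; first exact: to_torus_continuous.
  (* A continuous bijection from a compact set onto a Hausdorff one has a continuous inverse: closed
     sets pull back to images of compact sets. *)
  apply/continuous_closedP => A clA; apply/closed_subspaceP.
  exists (to_torus @` (G `&` A)).
    apply: compact_closed; first exact: norm_hausdorff.
    apply: continuous_compact.
      by apply: continuous_subspaceW to_torus_continuous => x [].
    by apply: compact_closedI => //; exact: realization_compact.
  apply/seteqP; split=> t /=.
    case=> -[x [Gx Ax] xt] tt; split=> //.
    have [Gi it] := invP _ tt.
    by move: Ax; have -> : x = inv t by apply: to_torus_inj => //; rewrite it.
  by case=> Ai tt; split=> //; have [Gi it] := invP _ tt; exists (inv t).
- exact: torusP.
- by move=> t /invP[].
- by move=> x Gx; have [Gi it] := invP _ (torusP _ Gx); apply: to_torus_inj.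
- by move=> t /invP[].
Qed.

End Homeomorphism.

(** * Local finiteness of the translated faces *)

Section LocallyFinite.
Variables (R : realType) (F : seq (seq lvertex)) (S a b : R) (p : nat -> R[i]).
Hypothesis S0 : 0 < S.
Hypothesis b0 : 0 < b.
Hypothesis gF : all good_face F.
Notation dev := (dev S a b p).
Notation period := (period S a b).
Notation pos := (pos S a b p).

Lemma dev_ReE f (x : 'rV[R]_8) : complex.Re (dev f x) = \sum_(w <- f) bary x w * complex.Re (pos w).
Proof.
rewrite /dev; elim: f => [|w l IH]; first by rewrite !big_nil.
by rewrite !big_cons ReD Re_realM IH.
Qed.

Lemma dev_ImE f (x : 'rV[R]_8) : complex.Im (dev f x) = \sum_(w <- f) bary x w * complex.Im (pos w).
Proof.
rewrite /dev; elim: f => [|w l IH]; first by rewrite !big_nil.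
by rewrite !big_cons ImD Im_realM IH.
Qed.

Lemma bary_sum_le f (x : 'rV[R]_8) (c : lvertex -> R) : good_face f -> simplex f x ->
  `|\sum_(w <- f) bary x w * c w| <= \sum_(w <- f) `|c w|.
Proof.
move=> gf sx; apply: le_trans (ler_norm_sum _ _ _) _.
have x1 := bary_sum1 gf sx.
rewrite big_seq [leRHS]big_seq; apply: ler_sum => w wf.
rewrite normrM (ger0_norm (bary_ge0 w sx)) ler_piMl //.
rewrite -x1 (perm_big _ (perm_to_rem wf)) big_cons lerDl sumr_ge0 // => u _.
exact: bary_ge0 sx.
Qed.

Definition dev_bound : R :=
  \sum_(f <- F) \sum_(w <- f) (`|complex.Re (pos w)| + `|complex.Im (pos w)|).

Lemma dev_boundP f (x : 'rV[R]_8) : f \in F -> simplex f x ->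
  `|complex.Re (dev f x)| <= dev_bound /\ `|complex.Im (dev f x)| <= dev_bound.
Proof.
move=> fF sx; have gf := allP gF _ fF.
have le_bound : \sum_(w <- f) (`|complex.Re (pos w)| + `|complex.Im (pos w)|) <= dev_bound.
  rewrite /dev_bound (perm_big _ (perm_to_rem fF)) big_cons lerDl.
  by apply: sumr_ge0 => g _; apply: sumr_ge0 => w _; rewrite addr_ge0.
rewrite dev_ReE dev_ImE; split; apply: le_trans (bary_sum_le _ gf sx) (le_trans _ le_bound).
  by apply: ler_sum => w _; rewrite lerDl.
by apply: ler_sum => w _; rewrite lerDr.
Qed.

Definition int_window (N : nat) : seq int :=
  [seq Posz k | k <- iota 0 N.+1] ++ [seq - Posz k | k <- iota 0 N.+1].

Lemma mem_int_window (N : nat) (m : int) : `|m%:~R : R| <= N%:R -> m \in int_window N.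
Proof.
rewrite -intr_norm -abszE -[leLHS]/((`|m|%N)%:R) ler_nat => mN; rewrite mem_cat.
case: m mN => k kN; apply/orP; [left|right]; apply/mapP.
  by exists k => //; rewrite mem_iota.
by exists k.+1; rewrite ?NegzE // mem_iota.
Qed.

Definition window (N : nat) : seq (seq lvertex * (int * int)) :=
  [seq (f, mn) | f <- F, mn <- [seq (m, n) | m <- int_window N, n <- int_window N]].

Lemma mem_window N f m n : f \in F -> m \in int_window N -> n \in int_window N ->
  (f, (m, n)) \in window N.
Proof.
move=> fF mN nN; apply/allpairsPdep; exists f, (m, n); split=> //.
by apply/allpairsPdep; exists m, n.
Qed.

Lemma window_face N i : i \in window N -> i.1 \in F.
Proof. by case/allpairsPdep => f [mn [fF _ ->]]. Qed.

(** The imaginary part bounds [n] because [b] is positive; the shear term is then bounded as well,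
    and the real part bounds [m]. The two summands of [M] are these bounds. *)
Lemma locally_finite (B : R) : exists N, forall f x m n, f \in F -> simplex f x ->
  `|complex.Re (dev f x + period m n)| <= B -> `|complex.Im (dev f x + period m n)| <= B ->
  (f, (m, n)) \in window N.
Proof.
pose D := B + dev_bound; pose M := D / b + (D + D / b * `|a|) / S.
exists (Num.Def.archi_bound M) => f x m n fF sx.
have [re im] := dev_boundP fF sx; rewrite ReD ImD /= => reB imB.
have nb : `|n%:~R : R| <= D / b.
  rewrite ler_pdivlMr // -[b in leLHS]gtr0_norm // -normrM.
  have -> : n%:~R * b = (complex.Im (dev f x) + n%:~R * b) - complex.Im (dev f x) by ring.
  by apply: le_trans (ler_normB _ _) _; apply: lerD.
have mS : `|m%:~R : R| <= (D + D / b * `|a|) / S.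
  rewrite ler_pdivlMr // -[S in leLHS]gtr0_norm // -normrM.
  have -> : m%:~R * S = (complex.Re (dev f x) + (m%:~R * S + n%:~R * a)) - complex.Re (dev f x)
     - n%:~R * a by ring.
  apply: le_trans (ler_normB _ _) _; apply: lerD; last by rewrite normrM ler_wpM2r.
  by apply: le_trans (ler_normB _ _) _; apply: lerD.
have D0 : 0 <= D / b by apply: le_trans nb.
have M0 : 0 <= (D + D / b * `|a|) / S by apply: le_trans mS.
have lt_bound : M < (Num.Def.archi_bound M)%:R.
  by apply: archi_boundP; rewrite addr_ge0.
apply: mem_window => //; apply: mem_int_window; apply: le_trans (ltW lt_bound).
  by apply: le_trans mS _; rewrite lerDr.
by apply: le_trans nb _; rewrite lerDl.
Qed.

(** Closedness is argued in [R * R], where continuity can be checked on coordinates. *)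
Definition plane_coords (z : R[i]) : R * R := (complex.Re z, complex.Im z).

Lemma dev_coords_closed f : closed [set plane_coords (dev f x) | x in @simplex R f].
Proof.
apply: compact_closed; first exact: norm_hausdorff.
apply: continuous_compact; last exact: simplex_compact.
apply: continuous_subspaceT.
have scale (T : topologicalType) (g : T -> R) (c : R) : continuous g -> continuous (fun x => g x * c).
  by move=> gc x; apply: cvgMr_tmp; exact: gc.
have sumc (c : lvertex -> R) : continuous (fun x : 'rV[R]_8 => \sum_(w <- f) bary x w * c w).
  apply: continuous_big => [|w _]; first exact: add_continuous.
  exact/scale/coord_continuous.
have -> : (fun x => plane_coords (dev f x)) = (fun x : 'rV[R]_8 =>
    (\sum_(w <- f) bary x w * complex.Re (pos w), \sum_(w <- f) bary x w * complex.Im (pos w))).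
  by apply/funext => x; rewrite /plane_coords dev_ReE dev_ImE.
have pairc (T U V : topologicalType) (g1 : T -> U) (g2 : T -> V) :
    continuous g1 -> continuous g2 -> continuous (fun x => (g1 x, g2 x)).
  by move=> c1 c2 x; apply: cvg_pair; [exact: c1 | exact: c2].
by apply: pairc; exact: sumc.
Qed.

End LocallyFinite.

(** * The intrinsic metric *)

Section IntrinsicMetric.
Variables (R : realType) (F : seq (seq lvertex)) (S a b : R).
Variables (p : nat -> R[i]) (q : nat -> 'rV[R]_3).
Hypothesis S0 : 0 < S.
Hypothesis b0 : 0 < b.
Hypothesis gF : all good_face F.
Hypothesis compat : forall f g, f \in F -> g \in F -> exists m n : int,
  forall u v, u \in f -> v \in g -> label u = label v -> v = shift m n u.
Notation dev := (dev S a b p).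
Notation over := (over F S a b p).
Notation period := (period S a b).
Notation pl := (pl q).
Hypothesis dev_inj : forall f g x y m n, f \in F -> g \in F -> simplex f x -> simplex g y ->
  dev f x = dev g y + period m n -> x = y.
Hypothesis cover : forall z, exists x, over x z.
Hypothesis edge : forall f u v, f \in F -> u \in f -> v \in f ->
  dot (q (label u) - q (label v)) (q (label u) - q (label v)) =
  cdot (pos S a b p u - pos S a b p v) (pos S a b p u - pos S a b p v).
Hypothesis pl_inj : forall f g x y, f \in F -> g \in F -> simplex f x -> simplex g y ->
  pl x = pl y -> x = y.

Notation point := (point cover).
Notation isometry := (dev_isometry gF edge).

Definition surface : set 'rV[R]_3 := pl @` geometric_realization R (face_complex F).
(** Folds the plane onto the surface; it preserves distances on each translated face. *)
Definition wrapping (z : R[i]) : 'rV[R]_3 := pl (point z).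

Lemma wrapping_over x z : over x z -> wrapping z = pl x.
Proof. by move=> /(over_point dev_inj cover) xz; rewrite /wrapping xz. Qed.

Lemma wrapping_surface z : surface (wrapping z).
Proof. by exists (point z) => //; exact: point_realization. Qed.

Lemma wrapping_eq z z' : wrapping z = wrapping z' <-> exists m n, z' = z + period m n.
Proof.
have ov := pointP cover; split=> [|[m [n ->]]]; last first.
  by apply/esym/wrapping_over/over_shift.
have [f [m [n [fF sx _]]]] := ov z; have [g [m' [n' [gF' sy _]]]] := ov z'.
move=> /(pl_inj fF gF' sx sy) e; apply: (over_period gF compat (ov z)).
by rewrite e.
Qed.

Lemma pl_continuous : continuous pl.
Proof.
have -> : pl = fun x => \sum_(v < 8) x 0 v *: q v by [].
have scale (T : topologicalType) (g : T -> R) (v : 'rV[R]_3) :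
    continuous g -> continuous (fun x => g x *: v).
  by move=> gc x; apply: cvgZr_tmp; exact: gc.
apply: continuous_big => [|v _]; first exact: add_continuous.
exact/scale/coord_continuous.
Qed.

(* The chain lemma splits a path in the surface into at most as many steps as
   there are faces, each with both ends in one face; such a step lifts
   isometrically to the plane. *)
Lemma path_length_ge (f : R -> 'rV[R]_3) z z' : path_in surface (wrapping z) (wrapping z') f ->
  exists2 w, wrapping w = wrapping z' & ((Normc.normc (z - w))%:E <= path_length 0 1 f)%E.
Proof.
case=> cf f0 f1 fX.
pose C (g : seq lvertex) := [set t : R | 0 <= t <= 1 /\ (pl @` simplex g) (f t)].
have clC g : closed (C g).
  have clpl : closed (pl @` @simplex R g).
    apply: compact_closed; first exact: norm_hausdorff.
    apply: continuous_compact; last exact: simplex_compact.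
    exact/continuous_subspaceT/pl_continuous.
  have /continuous_closedP/(_ _ clpl)/closed_subspaceP[V clV VE] := cf.
  have -> : C g = V `&` `[0, 1].
    rewrite VE; apply/seteqP; split=> t; rewrite /C /= in_itv /=; first by case.
    by case.
  by apply: closedI => //; exact: interval_closed.
have cov t : 0 <= t <= 1 -> exists2 g, g \in F & C g t.
  move=> t01; have [x /(realizationP gF)[g gF' sx] xt] := fX _ t01.
  by exists g => //; split=> //; exists x.
have [s sP sC] := closed_cover_chain ler01 (fun g _ => clC g) cov.
(* The induction carries a lift [w] of the current point: the next partition point is lifted through
   the same face with the same period. *)
suff H t w (l : seq R) : wrapping w = f t ->
    path (fun x y => `[< exists2 g, g \in F & C g x /\ C g y >]) t l ->
  exists2 w', wrapping w' = f (last t l) & Normc.normc (w - w') <= polygon_length t 1 f l.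
  have [w ww wle] := H 0 z s (esym f0) sC.
  exists w; first by rewrite ww; case: sP => _ /eqP ->.
  apply: (@le_trans _ _ (polygon_length 0 1 f s)%:E); first by rewrite lee_fin.
  by apply: ereal_sup_ubound; exists s.
elim: l t w => [|u l IH] t w wt.
  by move=> _; exists w => //; rewrite subrr normcE /cdot mul0r addr0 sqrtr0 /polygon_length big_nil.
move=> /= /andP[/asboolP[g gF' [[_ [x sx xt]] [_ [y sy yu]]]] pl_].
have [m [n wE]] : exists m n, w = dev g x + period m n.
  apply/wrapping_eq; rewrite wt -xt; apply: wrapping_over; exact: over_simplex.
pose w1 := dev g y + period m n.
have w1u : wrapping w1 = f u.
  by rewrite -yu; apply: wrapping_over; apply: over_shift; exact: over_simplex.
have [w' w'l w'le] := IH u w1 w1u pl_; exists w' => //.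
have -> : w - w' = (w - w1) + (w1 - w') by rewrite addrA subrK.
apply: le_trans (normcD _ _) _.
have -> : polygon_length t 1 f (u :: l) = enorm (f u - f t) + polygon_length u 1 f l.
  by rewrite /polygon_length /= big_nat_recl.
apply: lerD => //.
have -> : w - w1 = dev g x - dev g y by rewrite wE /w1; ring.
rewrite -(isometry gF' sx sy) xt yu.
rewrite /enorm /dot le_eqVlt; apply/orP; left; apply/eqP; congr Num.sqrt.
by apply: eq_bigr => i _; rewrite !mxE; ring.
Qed.

(** The segment from [z] to [z'] meets finitely many translated faces, all closed. Partition points
    can be chosen so that neighbours share a face, where distances are preserved, and the triangle
    inequality adds up the pieces. *)
Lemma wrapping_lipschitz z z' : enorm (wrapping z - wrapping z') <= Normc.normc (z - z').
Proof.
pose g t : R[i] := z + t%:C * (z' - z).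
(* Both coordinates of every point of the segment are bounded by [B]; this makes the list of faces
   to consider finite. *)
pose B := `|complex.Re z| + `|complex.Re z'| + (`|complex.Im z| + `|complex.Im z'|).
have gB t : 0 <= t <= 1 -> `|complex.Re (g t)| <= B /\ `|complex.Im (g t)| <= B.
  case/andP=> t0 t1.
  have conv (u v : R) : `|u + t * (v - u)| <= `|u| + `|v|.
    have -> : u + t * (v - u) = (1 - t) * u + t * v by ring.
    apply: le_trans (ler_normD _ _) _; rewrite !normrM; apply: lerD.
      by rewrite ler_piMl // ger0_norm ?subr_ge0 // gerBl.
    by rewrite ler_piMl // ger0_norm.
  rewrite /g !reimE; split; apply: le_trans (conv _ _) _; rewrite /B ?lerDl ?lerDr //;
    by rewrite addr_ge0.
have [N NP] := locally_finite a p S0 b0 gF B.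
pose C (i : seq lvertex * (int * int)) :=
  [set t : R | exists2 x, simplex i.1 x & g t = dev i.1 x + period i.2.1 i.2.2].
have clC i : i \in window F N -> closed (C i).
  move=> _; set P := [set plane_coords (dev i.1 x) | x in @simplex R i.1].
  have -> : C i = (fun t => (complex.Re (z - period i.2.1 i.2.2) + t * complex.Re (z' - z),
                          complex.Im (z - period i.2.1 i.2.2) + t * complex.Im (z' - z))) @^-1` P.
    apply/seteqP; split=> t; rewrite /C /P /g /=.
      case=> x sx e; exists x => //; rewrite /plane_coords.
      have -> : dev i.1 x = z + t%:C * (z' - z) - period i.2.1 i.2.2 by rewrite e addrK.
      by rewrite !reimE; congr (_, _); ring.
    case=> x sx [re im]; exists x => //; apply: complex_ext; rewrite !reimE.
      by move: re; rewrite !reimE => ->; ring.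
    by move: im; rewrite !reimE => ->; ring.
  apply: preimage_closed; last exact: dev_coords_closed.
  move=> t _.
  have affc (c d : R) : continuous (fun t : R => c + t * d).
    by move=> u; apply: cvgD; [exact: cvg_cst | apply: cvgMr_tmp; exact: cvg_id].
  have pairc (T U V : topologicalType) (g1 : T -> U) (g2 : T -> V) :
      continuous g1 -> continuous g2 -> continuous (fun x => (g1 x, g2 x)).
    by move=> c1 c2 x; apply: cvg_pair; [exact: c1 | exact: c2].
  exact: (pairc _ _ _ _ _ (affc _ _) (affc _ _) t).
have cov t : 0 <= t <= 1 -> exists2 i, i \in window F N & C i t.
  move=> t01; have [x [f [m [n [fF sx e]]]]] := cover (g t).
  have [re im] := gB t t01; exists (f, (m, n)); last by exists x.
  by apply: (NP f x m n) => //; rewrite -e.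
have [s [sP sl] sC] := closed_cover_chain ler01 clC cov.
have g0 : g 0 = z by rewrite /g mul0r addr0.
have g1 : g 1 = z' by rewrite /g mul1r addrC subrK.
suff H t (l : seq R) : path <%R t l ->
    path (fun x y => `[< exists2 i, i \in window F N & C i x /\ C i y >]) t l ->
    enorm (wrapping (g t) - wrapping (g (last t l))) <= (last t l - t) * Normc.normc (z - z').
  by have := H 0 s sP sC; rewrite (eqP sl) g0 g1 subr0 mul1r.
elim: l t => [|u l IH] t /=; first by rewrite !subrr mul0r enorm0.
move=> /andP[tu ul] /andP[/asboolP[[f [m n]] /window_face /= fF [[x sx xt] [y sy yu]]] cl].
have -> : wrapping (g t) - wrapping (g (last u l)) =
    (wrapping (g t) - wrapping (g u)) + (wrapping (g u) - wrapping (g (last u l))).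
  by rewrite addrA subrK.
apply: le_trans (enormD _ _) _.
have -> : last u l - t = (u - t) + (last u l - u) by ring.
rewrite mulrDl; apply: lerD; last exact: IH.
have wx : wrapping (g t) = pl x by rewrite xt; apply/wrapping_over/over_shift/over_simplex.
have wy : wrapping (g u) = pl y by rewrite yu; apply/wrapping_over/over_shift/over_simplex.
rewrite wx wy (isometry fF sx sy).
have -> : dev f x - dev f y = (u - t)%:C * (z - z').
  transitivity (g t - g u); first by rewrite xt yu /=; ring.
  by rewrite /g rmorphB /=; ring.
rewrite normcE; have -> : cdot ((u - t)%:C * (z - z')) ((u - t)%:C * (z - z')) =
    (u - t) ^+ 2 * cdot (z - z') (z - z') by rewrite /cdot !reimE; ring.
by rewrite sqrtrM ?sqr_ge0 // sqrtr_sqr normcE gtr0_norm // subr_gt0.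
Qed.

(** The path is the image of the straight segment. [wrapping_lipschitz] bounds each step of a
    partition, and the bounds telescope. *)
Lemma wrapping_segment z z' :
  exists2 f, path_in surface (wrapping z) (wrapping z') f &
    (path_length 0 1 f <= (Normc.normc (z - z'))%:E)%E.
Proof.
pose g t : R[i] := z + t%:C * (z' - z).
have lip s t : enorm (wrapping (g s) - wrapping (g t)) <= `|s - t| * Normc.normc (z - z').
  apply: le_trans (wrapping_lipschitz _ _) _.
  have -> : g s - g t = (t - s)%:C * (z - z') by rewrite /g rmorphB /=; ring.
  rewrite normcE; have -> : cdot ((t - s)%:C * (z - z')) ((t - s)%:C * (z - z')) =
      (t - s) ^+ 2 * cdot (z - z') (z - z') by rewrite /cdot !reimE; ring.
  by rewrite sqrtrM ?sqr_ge0 // sqrtr_sqr normcE distrC.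
exists (fun t => wrapping (g t)).
  split.
  - apply: continuous_subspaceT => t; apply/cvgrPdist_le => e e0.
    (* The summand 1 keeps the divisor positive when [z = z']. *)
    pose k := Normc.normc (z - z') + 1.
    have k0 : 0 < k by rewrite ltr_wpDl // normc_ge0.
    near=> u.
    have tu : `|t - u| <= e / k.
      near: u; apply: (@cvgr_dist_le _ _ _ (nbhs t) _ id t); first exact: cvg_id.
      by rewrite divr_gt0.
    rewrite /Num.norm /= mx_normrE; apply/bigmax_leP; split; first exact: ltW.
    move=> [i j] _ /=; rewrite ord1; apply: le_trans (coord_le_enorm _ _) _.
    apply: le_trans (lip _ _) _.
    rewrite ler_pdivlMr // in tu; apply: le_trans tu.
    by rewrite ler_wpM2l // /k lerDl.
  - by rewrite /g mul0r addr0.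
  - by rewrite /g mul1r addrC subrK.
  - by move=> t _; exact: wrapping_surface.
apply: ub_ereal_sup => _ [s [sP sl] <-]; rewrite lee_fin.
suff H (t : R) (l : seq R) : path <%R t l ->
    polygon_length t 1 (fun t => wrapping (g t)) l <= (last t l - t) * Normc.normc (z - z').
  by have := H 0 s sP; rewrite (eqP sl) subr0 mul1r.
elim: l t => [|u l IH] t /=; first by rewrite /polygon_length big_nil subrr mul0r.
case/andP=> tu ul.
have -> : polygon_length t 1 (fun t => wrapping (g t)) (u :: l) =
    enorm (wrapping (g u) - wrapping (g t)) + polygon_length u 1 (fun t => wrapping (g t)) l.
  by rewrite /polygon_length /= big_nat_recl.
have -> : last u l - t = (u - t) + (last u l - u) by ring.
rewrite mulrDl; apply: lerD; last exact: IH.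
by apply: le_trans (lip _ _) _; rewrite gtr0_norm // subr_gt0.
Unshelve. all: by end_near.
Qed.

Lemma surface_isometric : intrinsically_isometric surface (lattice S%:C (a +i* b)).
Proof.
set L := lattice S%:C (a +i* b).
have LP z z' : L (z' - z) <-> wrapping z = wrapping z'.
  split=> [/latticeP[m [n e]]|/wrapping_eq[m [n ->]]].
    by apply/wrapping_eq; exists m, n; rewrite -e addrC subrK.
  by apply/latticeP; exists m, n; rewrite addrC addKr.
have coset_self z : coset L z z by exists 0; [apply/latticeP; exists 0, 0; rewrite period0 | rewrite addr0].
have cosetP z w : coset L z w -> wrapping z = wrapping w.
  by case=> l Ll <-; apply/LP; rewrite addrC addKr.
have coset_eq z z' : wrapping z = wrapping z' -> coset L z = coset L z'.
  move=> e; apply/seteqP; split=> w /cosetP h.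
    by exists (w - z'); [apply/LP; rewrite -e | rewrite addrC subrK].
  by exists (w - z); [apply/LP; rewrite e | rewrite addrC subrK].
(* A coset is mapped through an arbitrary representative, since [wrapping] is constant on cosets. *)
pose f (A : set R[i]) := wrapping (xget 0 A).
have fE z : f (coset L z) = wrapping z.
  apply/esym/cosetP; rewrite /f; apply: (@xgetPex _ 0 (coset L z)); exists z; exact: coset_self.
exists f; split.
  split.
  - by move=> _ [z _ <-]; rewrite fE; exact: wrapping_surface.
  - by move=> A B /set_mem[z _ <-] /set_mem[z' _ <-]; rewrite !fE; exact: coset_eq.
  - move=> _ [x /(realizationP gF)[g gF' sx] <-]; exists (coset L (dev g x)); first by exists (dev g x).
    by rewrite fE; apply/wrapping_over/over_simplex.
move=> _ _ [z _ <-] [z' _ <-]; rewrite !fE; apply/eqP; rewrite eq_le; apply/andP; split.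
(* Upper bound: the segment between any two representatives gives a competing path. *)
- apply: le_ereal_inf_tmp => _ [u [v [/cosetP uz /cosetP vz ->]]].
  rewrite uz vz; have [g gP gle] := wrapping_segment u v.
  by apply: le_trans gle; apply: ereal_inf_lbound; exists g.
(* Lower bound: a path leads to a representative of the second coset no farther from [z] than its
   length. *)
- apply: le_ereal_inf_tmp => _ [g gP <-].
  have [w wz' wle] := path_length_ge gP.
  apply: le_trans wle; apply: ereal_inf_lbound; exists z, w; split=> //.
  by rewrite (coset_eq _ _ (esym wz')).
Qed.

End IntrinsicMetric.

(** * Directions that leave no common obtuse vector *)

Section PlaneAlgebra.
Variable R : realType.
Implicit Types d A B : R[i].

Lemma cdot_orthogonal A B d : ccross A B != 0 -> cdot A d = 0 -> cdot B d = 0 -> d = 0.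
Proof.
move=> c0 Ad Bd; apply: complex_ext; apply: (mulfI c0); rewrite mulr0 /=.
- transitivity (cdot A d * complex.Im B - cdot B d * complex.Im A).
    by rewrite /ccross /cdot; ring.
  by rewrite Ad Bd !mul0r subr0.
- transitivity (cdot B d * complex.Re A - cdot A d * complex.Re B).
    by rewrite /ccross /cdot; ring.
  by rewrite Ad Bd !mul0r subr0.
Qed.

(** For [d] orthogonal to [e], products with [d] are proportional to cross products with [e], by
    [H]. Vectors strictly on opposite sides of the line along [e] then have products of opposite
    signs with [d], unless [d] vanishes. *)
Lemma cdot_two_sides e A B d : cdot e d = 0 -> 0 < ccross e A -> ccross e B < 0 ->
  cdot A d <= 0 -> cdot B d <= 0 -> d = 0.
Proof.
move=> ed eA eB Ad Bd.
have H C : cdot e e * cdot C d = ccross e C * ccross e d.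
  transitivity (ccross e C * ccross e d + cdot e C * cdot e d); first by rewrite /ccross /cdot; ring.
  by rewrite ed mulr0 addr0.
have le1 : ccross e d <= 0.
  by rewrite -(pmulr_rle0 _ eA) -H mulr_ge0_le0 // cdot_ge0.
have ge1 : 0 <= ccross e d.
  by rewrite -(nmulr_rle0 _ eB) -H mulr_ge0_le0 // cdot_ge0.
have e0 : ccross e d = 0 by apply: le_anti; rewrite le1 ge1.
have Ad0 : cdot A d = 0.
  have := H A; rewrite e0 mulr0 => /eqP; rewrite mulf_eq0 => /orP[|/eqP //].
  rewrite /cdot -!expr2 paddr_eq0 ?sqr_ge0 // !sqrf_eq0 => /andP[/eqP re /eqP im].
  by move: eA; rewrite /ccross re im !mul0r subrr ltxx.
by apply: (cdot_orthogonal _ ed Ad0); rewrite gt_eqF.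
Qed.

(** The three vectors satisfy a linear relation whose coefficients are the three positive cross
    products, so nonpositive products with [d] must all vanish. *)
Lemma cdot_three_sides A B C d : 0 < ccross A B -> 0 < ccross B C -> 0 < ccross C A ->
  cdot A d <= 0 -> cdot B d <= 0 -> cdot C d <= 0 -> d = 0.
Proof.
move=> AB BC CA Ad Bd Cd.
have H : ccross B C * cdot A d + ccross C A * cdot B d + ccross A B * cdot C d = 0.
  by rewrite /ccross /cdot; ring.
have a := mulr_ge0_le0 (ltW BC) Ad; have b := mulr_ge0_le0 (ltW CA) Bd.
have c := mulr_ge0_le0 (ltW AB) Cd.
have a0 : ccross B C * cdot A d = 0 by lra.
have b0 : ccross C A * cdot B d = 0 by lra.
apply: (@cdot_orthogonal A B); first by rewrite gt_eqF.
  by move/eqP: a0; rewrite mulf_eq0 gt_eqF //= => /eqP.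
by move/eqP: b0; rewrite mulf_eq0 gt_eqF //= => /eqP.
Qed.

(** First-order condition at a minimum. The chosen [t] makes the quadratic term smaller than the
    linear one. *)
Lemma first_order (c d : R) : (forall t, 0 < t <= 1 -> 2 * t * c <= t ^+ 2 * d) -> c <= 0.
Proof.
move=> H; rewrite leNgt; apply/negP => c0.
pose t := Num.min 1 (c / (`|d| + 1)).
have d1 : 0 < `|d| + 1 by rewrite ltr_pwDr.
have t0 : 0 < t by rewrite lt_min ltr01 divr_gt0.
have t1 : t <= 1 by rewrite ge_min lexx.
have tc : t * (`|d| + 1) <= c by rewrite -ler_pdivlMr // ge_min lexx orbT.
have := H t; rewrite t0 t1 => /(_ isT).
rewrite expr2 -mulrA [2 * _]mulrC -!mulrA ler_pM2l // => h.
have := ler_norm d; have : t * d <= t * `|d| by rewrite ler_pM2l // ler_norm.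
nra.
Qed.

End PlaneAlgebra.

(** * The development covers the plane *)

Section Cover.
Variables (R : realType) (F : seq (seq lvertex)) (S a b : R) (p : nat -> R[i]).
Hypothesis S0 : 0 < S.
Hypothesis b0 : 0 < b.
Hypothesis gF : all good_face F.
Notation dev := (dev S a b p).
Notation over := (over F S a b p).
Notation period := (period S a b).
Notation pos := (pos S a b p).

Definition vertex (w : lvertex) : 'rV[R]_8 := delta_mx 0 (inord (label w)).

Lemma bary_vertex u w : (label u < 8)%N -> (label w < 8)%N ->
  bary (vertex u) w = (label w == label u)%:R.
Proof.
by move=> u8 w8; rewrite /bary mxE eqxx -val_eqE /= !inordK.
Qed.

Lemma vertex_simplex f u : good_face f -> u \in f -> simplex f (vertex u).
Proof.
move=> /and3P[_ _ /allP lf] uf; have u8 := lf _ uf; split=> [v||v].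
- by rewrite mxE ler0n.
- rewrite (bigD1 (inord (label u))) //= mxE !eqxx big1 ?addr0 // => v vu.
  by rewrite mxE (negPf vu) andbF.
- rewrite mxE eqxx /= pnatr_eq0 eqb0 negbK => /eqP ->.
  by rewrite inordK // map_f.
Qed.

Lemma dev_vertex f u : good_face f -> u \in f -> dev f (vertex u) = pos u.
Proof.
move=> gf uf; have [_ ulf /allP lf] := and3P gf.
rewrite /dev (bigD1_seq u) //=; last exact: map_uniq ulf.
rewrite bary_vertex ?lf // eqxx mul1r big_seq_cond big1 ?addr0 // => w /andP[wf wu].
rewrite bary_vertex ?lf //; case: eqP => [e|_]; last by rewrite mul0r.
have := lookup_label ulf wf; rewrite e lookup_label // => uw.
by rewrite uw eqxx in wu.
Qed.

Definition segment (x y : 'rV[R]_8) (t : R) : 'rV[R]_8 := (1 - t) *: x + t *: y.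

Lemma segment_simplex f x y t : 0 <= t <= 1 -> simplex f x -> simplex f y -> simplex f (segment x y t).
Proof.
move=> /andP[t0 t1] [x0 x1 sx] [y0 y1 sy]; split=> [v||v].
- by rewrite !mxE addr_ge0 // mulr_ge0 // subr_ge0.
- under eq_bigr do rewrite !mxE.
  by rewrite big_split /= -!mulr_sumr x1 y1; ring.
- rewrite !mxE; have [xv|xv _] := eqVneq (x 0 v) 0; last exact: sx.
  have [yv|yv _] := eqVneq (y 0 v) 0; last exact: sy.
  by rewrite xv yv !mulr0 addr0 eqxx.
Qed.

Lemma dev_segment f x y t :
  dev f (segment x y t) = dev f x + t%:C * (dev f y - dev f x).
Proof.
transitivity ((1 - t)%:C * dev f x + t%:C * dev f y); last by rewrite rmorphB /=; ring.
rewrite /dev !mulr_sumr -big_split; apply: eq_bigr => w _ /=.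
by rewrite /bary !mxE rmorphD !rmorphM /=; ring.
Qed.

Lemma transfer_simplex f g x m n : good_face f -> good_face g -> simplex f x ->
  (forall u, u \in f -> bary x u != 0 -> shift m n u \in g) ->
  simplex g x /\ dev g x = dev f x + period m n.
Proof.
move=> gf gg sx sub; have [x0 x1 xf] := sx.
have look v : x 0 v != 0 -> lookup g v = shift m n (lookup f v) /\ (v : nat) \in map label g.
  move=> xv; have [uf lu] := lookup_mem (xf _ xv).
  have h : shift m n (lookup f v) \in g.
    by apply: sub => //; rewrite /bary lu inord_val.
  have e : (v : nat) = label (shift m n (lookup f v)) by rewrite -[LHS]lu.
  split; last by rewrite e map_f.
  by rewrite {1}e lookup_label //; case/and3P: gg.
have sg : simplex g x by split=> // v xv; have [] := look v xv.
split=> //; rewrite !dev_lookup //.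
have -> : period m n = \sum_(v < 8) (x 0 v)%:C * period m n.
  by rewrite -mulr_suml -rmorph_sum /= x1 mul1r.
rewrite -big_split; apply: eq_bigr => v _ /=.
have [->|xv] := eqVneq (x 0 v) 0; first by rewrite !mul0r addr0.
by rewrite (look v xv).1 pos_shift mulrDr.
Qed.

(** Each side of a face is the leading pair of one rotation, with the opposite corner in third
    place. *)
Definition rots (f : seq lvertex) := [:: f; rot 1 f; rot 2 f].

Hypothesis orient : forall f u v w, f \in F -> [:: u; v; w] \in rots f ->
  0 < ccross (pos v - pos u) (pos w - pos u).

Hypothesis partner : forall f u v w, f \in F -> [:: u; v; w] \in rots f ->
  exists g m n c, [/\ g \in F, shift m n u \in g, shift m n v \in g, shift m n c \in g &
    ccross (pos v - pos u) (pos c - pos u) < 0].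

Definition adjacent u c := exists g m n, [/\ g \in F, shift m n u \in g & shift m n c \in g].

(** Three neighbours whose directions positively span the plane leave no blind side at a vertex. *)
Hypothesis star : forall f u, f \in F -> u \in f -> exists A B C,
  [/\ adjacent u A, adjacent u B, adjacent u C &
   [/\ 0 < ccross (pos A - pos u) (pos B - pos u), 0 < ccross (pos B - pos u) (pos C - pos u) &
       0 < ccross (pos C - pos u) (pos A - pos u)]].

Definition nearest z w := forall y z', over y z' -> cdot (z - w) (z - w) <= cdot (z - z') (z - z').

(** Moving from a nearest point towards a corner of a face that contains it stays within the
    developed faces, so the distance to [z] cannot decrease to first order. *)
Lemma nearest_obtuse z f x m n g m' n' c : f \in F -> simplex f x ->
  nearest z (dev f x + period m n) -> g \in F ->
  (forall u, u \in f -> bary x u != 0 -> shift m' n' u \in g) -> shift m' n' c \in g ->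
  cdot (pos c - dev f x) (z - (dev f x + period m n)) <= 0.
Proof.
move=> fF sx near gF' sub cg; have gf := allP gF _ fF; have gg := allP gF _ gF'.
have [sg dg] := transfer_simplex gf gg sx sub.
set d := z - _; set e := pos c - _; apply: (@first_order _ _ (cdot e e)) => t /andP[t0 t1].
have st : simplex g (segment x (vertex (shift m' n' c)) t).
  by apply: segment_simplex; rewrite ?t1 ?(ltW t0) //; exact: vertex_simplex.
have : over (segment x (vertex (shift m' n' c)) t) (dev f x + period m n + t%:C * e).
  exists g, (m - m'), (n - n'); split=> //.
  rewrite dev_segment dev_vertex // dg pos_shift /e periodD periodN; ring.
move=> /near; rewrite -/d opprD addrA -/d.
have -> : cdot (d - t%:C * e) (d - t%:C * e) = cdot d d - 2 * t * cdot e d + t ^+ 2 * cdot e e.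
  by rewrite /cdot !reimE; ring.
by lra.
Qed.

Lemma rots_perm f t : t \in rots f -> perm_eq t f.
Proof.
by rewrite !inE => /or3P[] /eqP ->; rewrite ?perm_refl // perm_rot perm_refl.
Qed.

(** If the nearest point differed from [z], some admissible direction would make an acute angle with
    the displacement [d]. The cases interior, side and corner are told apart by the vanishing
    barycentric coordinates. *)
Lemma nearest_self z f x m n : f \in F -> simplex f x -> nearest z (dev f x + period m n) ->
  z = dev f x + period m n.
Proof.
move=> fF sx near; have gf := allP gF _ fF.
set d := z - (dev f x + period m n).
suff d0 : d = 0 by apply/eqP; rewrite -subr_eq0 -/d d0.
have obtuse := nearest_obtuse fF sx near; rewrite -/d in obtuse.
have own c : c \in f -> cdot (pos c - dev f x) d <= 0.
  by move=> cf; apply: (obtuse f 0 0 c) => // [u uf _|];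
    rewrite /shift !addr0 -?surjective_pairing // -[X in (X, _)]surjective_pairing -surjective_pairing.
have [u [v [w [fE [u8 v8 w8] [uv uw vw]]]]] := good_faceP gf.
have x1 := bary_sum1 gf sx; have b_ge0 := bary_ge0 _ sx.
have rotE t : t \in rots f -> \sum_(i <- t) bary x i = 1 /\ dev f x = dev t x.
  move=> /rots_perm tf; split; last by rewrite /dev; apply/perm_big; rewrite perm_sym.
  by rewrite -x1; exact: perm_big.
(* The inequalities at the ends of the side [A B] have a positive combination equal to 0, so [d] is
   orthogonal to the side, while [C] and the vertex [c] beyond it lie on opposite sides. *)
have edge_case A B C : [:: A; B; C] \in rots f -> bary x C = 0 -> bary x A != 0 -> bary x B != 0 -> d = 0.
  move=> tf C0 A0 B0; have [t1 dE] := rotE _ tf; have mem := perm_mem (rots_perm tf).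
  have [g [m' [n' [c [gF' Ag Bg cg neg]]]]] := partner fF tf.
  have sub k : k \in f -> bary x k != 0 -> shift m' n' k \in g.
    by rewrite -mem !inE => /or3P[] /eqP -> // ; rewrite C0 eqxx.
  have oA := own A; have oB := own B; have oC := own C; have oc := obtuse g m' n' c gF' sub cg.
  move: oA oB oC; rewrite -!mem !inE !eqxx !orbT => /(_ isT) oA /(_ isT) oB /(_ isT) oC.
  have dE' : dev f x = (bary x A)%:C * pos A + (bary x B)%:C * pos B.
    by rewrite dE /dev !big_cons big_nil C0 /= mul0r !addr0.
  have t1' : bary x A + bary x B = 1 by move: t1; rewrite !big_cons big_nil C0 !addr0.
  have zero : bary x A * cdot (pos A - dev f x) d + bary x B * cdot (pos B - dev f x) d = 0.
    rewrite dE' /cdot !reimE; have -> : bary x A = 1 - bary x B by rewrite -t1' addrK.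
    by ring.
  have pA : 0 < bary x A by rewrite lt0r A0 b_ge0.
  have pB : 0 < bary x B by rewrite lt0r B0 b_ge0.
  have zA : cdot (pos A - dev f x) d = 0 by nra.
  have zB : cdot (pos B - dev f x) d = 0 by nra.
  have split_cdot k : cdot (pos k - pos A) d = cdot (pos k - dev f x) d - cdot (pos A - dev f x) d.
    by rewrite /cdot !reimE; ring.
  apply: (@cdot_two_sides _ (pos B - pos A) (pos C - pos A) (pos c - pos A)) => //.
  - by rewrite split_cdot zA zB subrr.
  - exact: orient fF tf.
  - by rewrite split_cdot zA subr0.
  - by rewrite split_cdot zA subr0.
have vertex_case A B C : [:: A; B; C] \in rots f -> bary x C = 0 -> bary x B = 0 -> d = 0.
  move=> tf C0 B0; have [t1 dE] := rotE _ tf; have mem := perm_mem (rots_perm tf).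
  have A1 : bary x A = 1 by move: t1; rewrite !big_cons big_nil C0 B0 !addr0.
  have dE' : dev f x = pos A by rewrite dE /dev !big_cons big_nil C0 B0 A1 !mul0r !addr0 mul1r.
  have Af : A \in f by rewrite -mem mem_head.
  have [P [Q [T [adP adQ adT [PQ QT TP]]]]] := star fF Af.
  have adj k : adjacent A k -> cdot (pos k - pos A) d <= 0.
    move=> [g [m' [n' [gF' Ag kg]]]]; rewrite -dE'; apply: (obtuse g m' n' k) => // i.
    by rewrite -mem !inE => /or3P[] /eqP -> //; rewrite ?B0 ?C0 eqxx.
  by apply: (cdot_three_sides PQ QT TP); exact: adj.
have r0 : [:: u; v; w] \in rots f by rewrite fE mem_head.
have r1 : [:: v; w; u] \in rots f by rewrite fE !inE eqxx orbT.
have r2 : [:: w; u; v] \in rots f by rewrite fE !inE eqxx !orbT.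
have [u0|u0] := eqVneq (bary x u) 0; have [v0|v0] := eqVneq (bary x v) 0;
  have [w0|w0] := eqVneq (bary x w) 0.
- by move: x1; rewrite fE !big_cons big_nil u0 v0 w0 !addr0 => /eqP; rewrite eq_sym oner_eq0.
- exact: vertex_case r2 v0 u0.
- exact: vertex_case r1 u0 w0.
- exact: edge_case r1 u0 v0 w0.
- exact: vertex_case r0 w0 v0.
- exact: edge_case r2 v0 w0 u0.
- exact: edge_case r0 w0 u0 v0.
have [uf vf wf] : [/\ u \in f, v \in f & w \in f] by rewrite fE !inE !eqxx !orbT.
(* Seen from an interior point, two corners have as cross product that of the whole face times the
   barycentric coordinate of the third corner. *)
apply: (@cdot_three_sides _ (pos u - dev f x) (pos v - dev f x) (pos w - dev f x)); try exact: own.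
all: have := orient fF r0; have pu : 0 < bary x u by rewrite lt0r u0 b_ge0.
all: have pv : 0 < bary x v by rewrite lt0r v0 b_ge0.
all: have pw : 0 < bary x w by rewrite lt0r w0 b_ge0.
all: have uE : bary x u = 1 - bary x v - bary x w
  by move: x1; rewrite fE !big_cons big_nil addr0 => <-; ring.
all: have dE : dev f x = (bary x u)%:C * pos u + ((bary x v)%:C * pos v + (bary x w)%:C * pos w)
  by rewrite /dev fE !big_cons big_nil addr0.
- rewrite -(pmulr_rgt0 _ pw); congr (0 < _).
  by rewrite dE uE /ccross !reimE; ring.
- rewrite -(pmulr_rgt0 _ pu); congr (0 < _).
  by rewrite dE uE /ccross !reimE; ring.
- rewrite -(pmulr_rgt0 _ pv); congr (0 < _).
  by rewrite dE uE /ccross !reimE; ring.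
Qed.

Lemma dev_parts_continuous f : continuous (fun x : 'rV[R]_8 => complex.Re (dev f x)) /\
  continuous (fun x : 'rV[R]_8 => complex.Im (dev f x)).
Proof.
have scale (T : topologicalType) (g : T -> R) (c : R) : continuous g -> continuous (fun x => g x * c).
  by move=> gc x; apply: cvgMr_tmp; exact: gc.
have sumc (c : lvertex -> R) : continuous (fun x : 'rV[R]_8 => \sum_(w <- f) bary x w * c w).
  apply: continuous_big => [|w _]; first exact: add_continuous.
  exact/scale/coord_continuous.
by split; [under eq_fun do rewrite dev_ReE | under eq_fun do rewrite dev_ImE]; exact: sumc.
Qed.

Definition sqdist z (i : seq lvertex * (int * int)) (x : 'rV[R]_8) : R :=
  let d := z - (dev i.1 x + period i.2.1 i.2.2) in cdot d d.

Lemma sqdist_continuous z i : continuous (sqdist z i).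
Proof.
have [reC imC] := dev_parts_continuous i.1.
have sq (T : topologicalType) (g : T -> R) (c : R) : continuous g -> continuous (fun x => (c - g x) * (c - g x)).
  move=> gc x; have h : {for x, continuous (fun x => c - g x)}.
    by apply: cvgB; [exact: cvg_cst | exact: gc].
  exact: cvgM.
have sumc (T : topologicalType) (g h : T -> R) : continuous g -> continuous h -> continuous (fun x => g x + h x).
  by move=> gc hc x; apply: cvgD; [exact: gc | exact: hc].
have -> : sqdist z i = fun x =>
    (complex.Re (z - period i.2.1 i.2.2) - complex.Re (dev i.1 x)) *
    (complex.Re (z - period i.2.1 i.2.2) - complex.Re (dev i.1 x)) +
    (complex.Im (z - period i.2.1 i.2.2) - complex.Im (dev i.1 x)) *
    (complex.Im (z - period i.2.1 i.2.2) - complex.Im (dev i.1 x)).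
  by apply/funext => x; rewrite /sqdist /cdot !reimE; ring.
by apply: sumc; exact: sq.
Qed.

Lemma sqdist_minimum z i : i.1 \in F ->
  exists2 x, simplex i.1 x & forall y, simplex i.1 y -> sqdist z i x <= sqdist z i y.
Proof.
move=> iF; have gi := allP gF _ iF.
have ne : @simplex R i.1 !=set0.
  have [u [v [w [fE _ _]]]] := good_faceP gi.
  by exists (vertex u); apply: vertex_simplex => //; rewrite fE mem_head.
have [x + xmin] := EVT_min_rV ne (@simplex_compact R i.1) (continuous_subspaceT (@sqdist_continuous z i)).
by rewrite inE => sx; exists x => // y sy; apply: xmin; rewrite inE.
Qed.

Lemma sqdist_list_minimum z (l : seq (seq lvertex * (int * int))) :
  (forall i, i \in l -> i.1 \in F) -> l != [::] -> exists i x, [/\ i \in l, simplex i.1 x &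
    forall j y, j \in l -> simplex j.1 y -> sqdist z i x <= sqdist z j y].
Proof.
elim: l => // i [|j l] IH lF _.
  have [x sx xmin] := sqdist_minimum z (lF i (mem_head _ _)).
  by exists i, x; split; rewrite ?mem_head // => j y; rewrite inE => /eqP ->; exact: xmin.
have [x sx xmin] := sqdist_minimum z (lF i (mem_head _ _)).
have [|//|k [y [kl sy ymin]]] := IH; first by move=> k kl; apply: lF; rewrite inE kl orbT.
have [le|/ltW le] := leP (sqdist z i x) (sqdist z k y).
  exists i, x; split; rewrite ?mem_head // => k' y'; rewrite inE => /orP[/eqP ->|]; first exact: xmin.
  by move=> k'l sy'; apply: le_trans le _; exact: ymin.
exists k, y; split=> //; first by rewrite inE kl orbT.
move=> k' y'; rewrite inE => /orP[/eqP ->|k'l]; last exact: ymin.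
by move=> sy'; apply: le_trans le _; exact: xmin.
Qed.

Hypothesis F0 : F != [::].

(** A minimum over infinitely many translates exists because every face point no farther from [z]
    than a point of the reference face [f0] belongs to a finite window. [nearest_self] then
    identifies the minimizer with [z]. *)
Theorem plane_cover z : exists x, over x z.
Proof.
have [f0 f0F] : exists f0, f0 \in F by case: F F0 => // f0 ? _; exists f0; rewrite mem_head.
have [x0 sx0 _] := @sqdist_minimum z (f0, (0, 0)) f0F.
pose rho := Num.sqrt (sqdist z (f0, (0, 0)) x0).
pose B := `|complex.Re z| + `|complex.Im z| + rho.
have r0 : 0 <= rho by rewrite sqrtr_ge0.
have [N NP] := locally_finite a p S0 b0 gF B.
have near_window f x m n : f \in F -> simplex f x ->
    sqdist z (f, (m, n)) x <= sqdist z (f0, (0, 0)) x0 -> (f, (m, n)) \in window F N.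
  move=> fF sx le; have h : Num.sqrt (sqdist z (f, (m, n)) x) <= rho by rewrite ler_sqrt // cdot_ge0.
  set w := dev f x + period m n.
  have [hr hi] : `|complex.Re (z - w)| <= rho /\ `|complex.Im (z - w)| <= rho.
    by split; apply: le_trans h; rewrite -sqrtr_sqr ler_sqrt ?cdot_ge0 // /sqdist /cdot -/w -!expr2
      ?lerDl ?lerDr ?sqr_ge0.
  apply: (NP f x m n) => //; rewrite -/w.
    have -> : complex.Re w = complex.Re z - complex.Re (z - w) by rewrite !reimE; ring.
    by apply: le_trans (ler_normB _ _) _; rewrite /B; have := normr_ge0 (complex.Im z); lra.
  have -> : complex.Im w = complex.Im z - complex.Im (z - w) by rewrite !reimE; ring.
  by apply: le_trans (ler_normB _ _) _; rewrite /B; have := normr_ge0 (complex.Re z); lra.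
have w0 : (f0, (0, 0)) \in window F N by apply: (near_window f0 x0 0 0).
have [||[f [m n]] [x [iw sx xmin]]] := @sqdist_list_minimum z (window F N).
- by move=> i; exact: window_face.
- by case: (window F N) w0.
have fF := window_face iw.
exists x; exists f, m, n; split=> //; apply: nearest_self => // y z' [g [m' [n' [gF' sy ->]]]].
have [le|/ltW le] := leP (sqdist z (g, (m', n')) y) (sqdist z (f0, (0, 0)) x0).
  by have := xmin (g, (m', n')) y (near_window g y m' n' gF' sy le) sy.
by apply: le_trans (xmin _ _ w0 sx0) le.
Qed.

End Cover.

(** The new weights do not depend on [c], so one family serves all the functions summed later. *)
Lemma supported_sum (R : realType) (T : eqType) (l t : seq T) (wt : T -> R) : uniq t ->
  (forall w, w \in l -> w \notin t -> wt w = 0) ->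
  exists al : T -> R, forall c : T -> R, \sum_(w <- l) wt w * c w = \sum_(w <- t) al w * c w.
Proof.
move=> ut h; exists (fun w => \sum_(i <- l | i == w) wt i) => c.
under [RHS]eq_bigr do rewrite big_distrl /= big_mkcond /=.
rewrite exchange_big /= big_seq [RHS]big_seq; apply: eq_bigr => i il.
have [it|it] := boolP (i \in t).
  rewrite (bigD1_seq i) //= eqxx big1 ?addr0 // => w.
  by rewrite eq_sym => /negPf ->.
rewrite h // mul0r big1_seq // => w /andP[_ wt'].
by case: eqP => [iw|//]; rewrite iw wt' in it.
Qed.

Lemma seq_psumr_eq0 (R : realType) (T : eqType) (l : seq T) (G : T -> R) :
  (forall w, w \in l -> 0 <= G w) -> \sum_(w <- l) G w = 0 -> forall w, w \in l -> G w = 0.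
Proof.
move=> G0; rewrite big_seq => /eqP; rewrite psumr_eq0 // => /allP h w wl.
by have := h w wl; rewrite wl => /eqP.
Qed.

(** [L] is nonnegative on [f] and nonpositive on [g], so equal weighted sums both vanish and no
    weight remains where [L] is nonzero. *)
Lemma separated_support (R : realType) (T : eqType) (f g : seq T) (x y L : T -> R) (t : seq T) :
  (forall w, 0 <= x w) -> (forall w, 0 <= y w) ->
  (forall w, w \in f -> w \notin t -> 0 < L w) -> (forall w, w \in g -> w \notin t -> L w < 0) ->
  (forall w, w \in t -> L w = 0) ->
  \sum_(w <- f) x w * L w = \sum_(w <- g) y w * L w ->
  (forall w, w \in f -> w \notin t -> x w = 0) /\ (forall w, w \in g -> w \notin t -> y w = 0).
Proof.
move=> x0 y0 Lf Lg Lt e.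
have f0 w : w \in f -> 0 <= x w * L w.
  by move=> wf; have [/Lt ->|/(Lf _ wf)/ltW ?] := boolP (w \in t); rewrite ?mulr0 // mulr_ge0.
have g0 w : w \in g -> 0 <= y w * - L w.
  move=> wg; have [/Lt ->|/(Lg _ wg)/ltW] := boolP (w \in t); first by rewrite oppr0 mulr0.
  by rewrite -oppr_ge0 => ?; rewrite mulr_ge0.
have sf : 0 <= \sum_(w <- f) x w * L w by rewrite big_seq sumr_ge0.
have sg : 0 <= \sum_(w <- g) y w * - L w by rewrite big_seq sumr_ge0.
have sgN : \sum_(w <- g) y w * - L w = - \sum_(w <- g) y w * L w.
  by rewrite -sumrN; apply: eq_bigr => w _; rewrite mulrN.
have zf : \sum_(w <- f) x w * L w = 0 by rewrite sgN -e in sg; lra.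
have zg : \sum_(w <- g) y w * - L w = 0 by rewrite sgN -e zf oppr0.
split=> w wl wt.
  have /eqP := seq_psumr_eq0 f0 zf wl.
  by rewrite mulf_eq0 (gt_eqF (Lf _ wl wt)) orbF => /eqP.
have /eqP := seq_psumr_eq0 g0 zg wl.
by rewrite mulf_eq0 oppr_eq0 (lt_eqF (Lg _ wl wt)) orbF => /eqP.
Qed.

(** * Embeddedness *)

Section PlaneInjectivity.
Variables (R : realType) (F : seq (seq lvertex)) (S a b : R) (p : nat -> R[i]).
Hypothesis S0 : 0 < S.
Hypothesis b0 : 0 < b.
Hypothesis gF : all good_face F.
Notation dev := (dev S a b p).
Notation period := (period S a b).
Notation pos := (pos S a b p).

Definition line (u v w : lvertex) : R := ccross (pos v - pos u) (pos w - pos u).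

(** Exempting the two points that span the line admits faces sharing a side or a corner: common
    points are then forced onto [u] and [v]. *)
Definition separated (f g : seq lvertex) := exists u v,
  [/\ u != v, forall w, w \in f -> w \notin [:: u; v] -> 0 < line u v w &
      forall w, w \in g -> w \notin [:: u; v] -> line u v w < 0].

Lemma dev_shift f x m n : good_face f -> simplex f x ->
  dev (map (shift m n) f) x = dev f x + period m n.
Proof.
move=> gf sx; have x1 := bary_sum1 gf sx.
have -> : period m n = \sum_(w <- f) (bary x w)%:C * period m n.
  by rewrite -mulr_suml -rmorph_sum /= x1 mul1r.
rewrite /dev big_map -big_split; apply: eq_bigr => w _ /=.
by rewrite pos_shift mulrDr.
Qed.

Lemma dev_affine f x (k c d : R) : good_face f -> simplex f x ->
  k + c * complex.Re (dev f x) + d * complex.Im (dev f x) =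
  \sum_(w <- f) bary x w * (k + c * complex.Re (pos w) + d * complex.Im (pos w)).
Proof.
move=> gf sx; have x1 := bary_sum1 gf sx.
rewrite dev_ReE dev_ImE -[k in LHS]mulr1 -{1}x1 !mulr_sumr -!big_split.
by apply: eq_bigr => w _ /=; ring.
Qed.

(** From both sides a common point is a combination of [u] and [v]. These have distinct positions,
    because a third vertex of [f] lies strictly off their line, so the two combinations have the
    same coefficients. *)
Lemma separated_inj f g x y : good_face f -> good_face g -> simplex f x -> simplex g y ->
  separated f g -> dev f x = dev g y -> x = y.
Proof.
move=> gf gg sx sy [u [v [uv Lf Lg]]] e.
have x0 := bary_ge0 _ sx; have y0 := bary_ge0 _ sy.
have L0 w : w \in [:: u; v] -> line u v w = 0.
  by rewrite !inE => /orP[] /eqP ->; rewrite /line /ccross !reimE; ring.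
have LE w : line u v w =
    (complex.Im (pos v - pos u) * complex.Re (pos u) - complex.Re (pos v - pos u) * complex.Im (pos u)) +
    (- complex.Im (pos v - pos u)) * complex.Re (pos w) + complex.Re (pos v - pos u) * complex.Im (pos w).
  by rewrite /line /ccross !reimE; ring.
have eL : \sum_(w <- f) bary x w * line u v w = \sum_(w <- g) bary y w * line u v w.
  have eval h z (gh : good_face h) (sz : simplex h z) :
      \sum_(w <- h) bary z w * line u v w = line u v u + ccross (pos v - pos u) (dev h z - pos u).
    under eq_bigr do rewrite LE.
    by rewrite -dev_affine // /line /ccross !reimE; ring.
  by rewrite !eval // e.
have [zx zy] := separated_support x0 y0 Lf Lg L0 eL.
have uuv : uniq [:: u; v] by rewrite /= inE uv.
have [al alE] := supported_sum uuv zx; have [be beE] := supported_sum uuv zy.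
have neq : pos v - pos u != 0.
  have [w wf wuv] : exists2 w, w \in f & w \notin [:: u; v].
    apply/hasP; apply: contraT; rewrite -all_predC => /allP h.
    have /(uniq_leq_size (map_uniq (andP (andP gf).2).1)) : {subset f <= [:: u; v]}.
      by move=> w /h /=; rewrite negbK.
    by have /and3P[/eqP -> _ _] := gf.
  have := Lf w wf wuv; rewrite /line; case: eqP => // ->.
  by rewrite /ccross /= !mul0r subrr ltxx.
have sums c : \sum_(w <- f) bary x w * c w - \sum_(w <- g) bary y w * c w =
    (al u - be u) * c u + (al v - be v) * c v.
  by rewrite alE beE !big_cons !big_nil; ring.
have one : (al u - be u) + (al v - be v) = 0.
  have total h (z : 'rV[R]_8) : good_face h -> simplex h z -> \sum_(w <- h) bary z w * 1 = 1.
    by move=> gh sz; under eq_bigr do rewrite mulr1; exact: bary_sum1.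
  by have := sums (fun=> 1); rewrite !total // subrr !mulr1.
have re0 : (al v - be v) * complex.Re (pos v - pos u) = 0.
  have := sums (fun w => complex.Re (pos w)); rewrite -!dev_ReE e subrr => h.
  transitivity (((al u - be u) * complex.Re (pos u) + (al v - be v) * complex.Re (pos v)) -
      ((al u - be u) + (al v - be v)) * complex.Re (pos u)); first by rewrite !reimE; ring.
  by rewrite -h one mul0r subrr.
have im0 : (al v - be v) * complex.Im (pos v - pos u) = 0.
  have := sums (fun w => complex.Im (pos w)); rewrite -!dev_ImE e subrr => h.
  transitivity (((al u - be u) * complex.Im (pos u) + (al v - be v) * complex.Im (pos v)) -
      ((al u - be u) + (al v - be v)) * complex.Im (pos u)); first by rewrite !reimE; ring.
  by rewrite -h one mul0r subrr.
have zv : al v - be v = 0.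
  apply/eqP; apply: contraNT neq => nz; apply/eqP/complex_ext; apply: (mulfI nz);
    by rewrite mulr0.
have zu : al u - be u = 0 by lra.
apply/rowP => k; apply/eqP; rewrite -subr_eq0; apply/eqP.
(* A barycentric coordinate is the sum of the weights against the indicator of its label. *)
have coord h (z : 'rV[R]_8) : good_face h -> simplex h z -> z 0 k = \sum_(w <- h) bary z w * (label w == (k : nat))%:R.
  move=> gh sz; have [_ _ lz] := sz; have [_ uh /allP h8] := and3P gh.
  transitivity (\sum_(j < 8) z 0 j * ((j : nat) == (k : nat))%:R).
    rewrite (bigD1 k) //= eqxx mulr1 big1 ?addr0 // => j jk.
    by rewrite val_eqE (negPf jk) mulr0.
  rewrite (sum_simplex gh); last first.
    by move=> j jh; have [->|/lz] := eqVneq (z 0 j) 0; rewrite ?mul0r // (negPf jh).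
  by rewrite big_seq [RHS]big_seq; apply: eq_bigr => w /h8 w8; rewrite inordK.
by rewrite (coord _ _ gf sx) (coord _ _ gg sy) sums zu zv !mul0r addr0.
Qed.

(** Cramer's rule: a nonzero area recovers the barycentric coordinates from the developed point. *)
Lemma same_face_inj f u v w x y : good_face f -> f = [:: u; v; w] -> simplex f x -> simplex f y ->
  line u v w != 0 -> dev f x = dev f y -> x = y.
Proof.
move=> gf fE sx sy l0 e.
have x1 := bary_sum1 gf sx; have y1 := bary_sum1 gf sy.
have re : \sum_(i <- f) bary x i * complex.Re (pos i) = \sum_(i <- f) bary y i * complex.Re (pos i).
  by rewrite -!dev_ReE e.
have im : \sum_(i <- f) bary x i * complex.Im (pos i) = \sum_(i <- f) bary y i * complex.Im (pos i).
  by rewrite -!dev_ImE e.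
rewrite fE !big_cons !big_nil !addr0 in x1 y1 re im.
have xu : bary x u = 1 - bary x v - bary x w by rewrite -x1; ring.
have yu : bary y u = 1 - bary y v - bary y w by rewrite -y1; ring.
rewrite xu yu in re im.
pose dR := (1 - bary x v - bary x w) * complex.Re (pos u) + (bary x v * complex.Re (pos v) + bary x w * complex.Re (pos w)) -
  ((1 - bary y v - bary y w) * complex.Re (pos u) + (bary y v * complex.Re (pos v) + bary y w * complex.Re (pos w))).
pose dI := (1 - bary x v - bary x w) * complex.Im (pos u) + (bary x v * complex.Im (pos v) + bary x w * complex.Im (pos w)) -
  ((1 - bary y v - bary y w) * complex.Im (pos u) + (bary y v * complex.Im (pos v) + bary y w * complex.Im (pos w))).
have dR0 : dR = 0 by rewrite /dR re subrr.
have dI0 : dI = 0 by rewrite /dI im subrr.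
have ev : bary x v = bary y v.
  apply/eqP; rewrite -subr_eq0 -(mulIr_eq0 _ (mulIf l0)); apply/eqP.
  transitivity (dR * complex.Im (pos w - pos u) - dI * complex.Re (pos w - pos u)).
    by rewrite /dR /dI /line /ccross !reimE; ring.
  by rewrite dR0 dI0 !mul0r subrr.
have ew : bary x w = bary y w.
  apply/eqP; rewrite -subr_eq0 -(mulIr_eq0 _ (mulIf l0)); apply/eqP.
  transitivity (dI * complex.Re (pos v - pos u) - dR * complex.Im (pos v - pos u)).
    by rewrite /dR /dI /line /ccross !reimE; ring.
  by rewrite dR0 dI0 !mul0r subrr.
have eu : bary x u = bary y u by rewrite xu yu ev ew.
by apply: (bary_inj gf sx sy) => i; rewrite fE !inE => /or3P[] /eqP ->.
Qed.

Variables (xl xh yl yh : R) (M N : nat).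
Hypothesis box : forall f w, f \in F -> w \in f ->
  xl <= complex.Re (pos w) <= xh /\ yl <= complex.Im (pos w) <= yh.
Hypothesis height : yh - yl < N%:R * b.
(** The slant of the second period moves a translate sideways by up to [N%:R * |a|], which the bound
    on [m] has to absorb. *)
Hypothesis width : xh - xl + N%:R * `|a| < M%:R * S.

Lemma dev_box f x : f \in F -> simplex f x ->
  xl <= complex.Re (dev f x) <= xh /\ yl <= complex.Im (dev f x) <= yh.
Proof.
move=> fF sx; have x1 := bary_sum1 (allP gF _ fF) sx; have x0 := bary_ge0 _ sx.
have bounds (c : lvertex -> R) l h : (forall w, w \in f -> l <= c w <= h) ->
    l <= \sum_(w <- f) bary x w * c w <= h.
  move=> lh; rewrite -[l]mul1r -[h]mul1r -x1 !mulr_suml.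
  by apply/andP; split; rewrite big_seq [leRHS]big_seq; apply: ler_sum => w /lh /andP[lw wh];
    rewrite ler_wpM2l.
by rewrite dev_ReE dev_ImE; split; apply: bounds => w /(box fF)[].
Qed.

Hypothesis orient : forall u v w, [:: u; v; w] \in F -> 0 < line u v w.
Hypothesis disjoint : forall f g m n, f \in F -> g \in F -> (`|m| < M)%N -> (`|n| < N)%N ->
  [&& f == g, m == 0 & n == 0] \/ separated f (map (shift m n) g).

(** Both developed points lie in the box, so only finitely many periods can separate them, and for
    these the faces are known to be separated or identical. *)
Theorem plane_dev_inj f g x y m n : f \in F -> g \in F -> simplex f x -> simplex g y ->
  dev f x = dev g y + period m n -> x = y.
Proof.
move=> fF gF' sx sy e; have gf := allP gF _ fF; have gg := allP gF _ gF'.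
have [/andP[fx1 fx2] /andP[fy1 fy2]] := dev_box fF sx.
have [/andP[gx1 gx2] /andP[gy1 gy2]] := dev_box gF' sy.
have im : complex.Im (dev f x) - complex.Im (dev g y) = n%:~R * b by rewrite e ImD /=; ring.
have re : complex.Re (dev f x) - complex.Re (dev g y) = m%:~R * S + n%:~R * a by rewrite e ReD /=; ring.
have nb : `|n%:~R : R| < N%:R.
  rewrite -(ltr_pM2r b0) -[b in ltLHS]gtr0_norm // -normrM -im.
  by apply: le_lt_trans height; rewrite ler_norml; apply/andP; split; lra.
have mb : `|m%:~R : R| < M%:R.
  rewrite -(ltr_pM2r S0) -[S in ltLHS]gtr0_norm // -normrM.
  have -> : m%:~R * S = (complex.Re (dev f x) - complex.Re (dev g y)) - n%:~R * a by rewrite re; ring.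
  apply: le_lt_trans width; apply: le_trans (ler_normB _ _) _; apply: lerD.
    by rewrite ler_norml; apply/andP; split; lra.
  by rewrite normrM ler_wpM2r // ltW.
have toN (k : int) (K : nat) : `|k%:~R : R| < K%:R -> (`|k| < K)%N.
  by rewrite -intr_norm -abszE -[ltLHS]/((`|k|%N)%:R) ltr_nat.
have [/and3P[/eqP fg /eqP m0 /eqP n0]|sep] := disjoint fF gF' (toN _ _ mb) (toN _ _ nb).
  subst; rewrite period0 addr0 in e.
  have [u [v [w [fE _ _]]]] := good_faceP gf.
  by apply: (same_face_inj gf fE sx sy) e; rewrite gt_eqF // orient // -fE.
have gg' : good_face (map (shift m n) g).
  by move: gg; rewrite /good_face size_map -map_comp all_map.
have sy' : simplex (map (shift m n) g) y by case: sy => ? ? ?; split=> //; rewrite -map_comp.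
by apply: (separated_inj gf gg' sx sy' sep); rewrite dev_shift.
Qed.

End PlaneInjectivity.

Section SpaceInjectivity.
Variables (R : realType) (F : seq (seq lvertex)) (q : nat -> 'rV[R]_3).
Hypothesis gF : all good_face F.

Definition det3 (u v w : 'rV[R]_3) : R :=
  let x k := u 0 (inord k) in let y k := v 0 (inord k) in let z k := w 0 (inord k) in
  x 0%N * (y 1%N * z 2%N - y 2%N * z 1%N) - x 1%N * (y 0%N * z 2%N - y 2%N * z 0%N) +
  x 2%N * (y 0%N * z 1%N - y 1%N * z 0%N).

(** Six times a signed tetrahedron volume; its sign tells on which side of the plane through [q i],
    [q j], [q k] the point [q l] lies. *)
Definition plane (i j k l : nat) : R := det3 (q j - q i) (q k - q i) (q l - q i).

(** The second clause makes the three points non-collinear. For a face paired with itself its own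
    corners can be taken: the sign conditions are then vacuous, and injectivity on a single face is
    covered too. *)
Definition space_separated (f g : seq nat) := exists i j k,
  [/\ uniq [:: i; j; k], exists l, plane i j k l != 0,
      forall l, l \in f -> l \notin [:: i; j; k] -> 0 < plane i j k l &
      forall l, l \in g -> l \notin [:: i; j; k] -> plane i j k l < 0].

Lemma space_separated_inj f g x y : good_face f -> good_face g -> simplex f x -> simplex g y ->
  space_separated (map label f) (map label g) -> pl q x = pl q y -> x = y.
Proof.
move=> gf gg sx sy [i [j [k [uijk [l0 pl0] Lf Lg]]]].
rewrite /pl (pl_mapE q gf sx) (pl_mapE q gg sy) => e.
pose wt (z : 'rV[R]_8) (v : nat) := z 0 (inord v).
have wE h z (c : nat -> R) : \sum_(w <- h) bary z w * c (label w) = \sum_(v <- map label h) wt z v * c v.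
  by rewrite big_map.
have total h (z : 'rV[R]_8) : good_face h -> simplex h z -> \sum_(v <- map label h) wt z v * 1 = 1.
  by move=> gh sz; rewrite -(wE h z (fun=> 1)) -[RHS](bary_sum1 gh sz); apply: eq_bigr => w _; rewrite mulr1.
have coord (t : 'I_3) : \sum_(v <- map label f) wt x v * q v 0 t = \sum_(v <- map label g) wt y v * q v 0 t.
  rewrite -!(wE _ _ (fun v => q v 0 t)).
  have /(congr1 (fun u : 'rV[R]_3 => u 0 t)) := e; rewrite !summxE => h.
  transitivity (\sum_(w <- f) (bary x w *: q (label w)) 0 t).
    by apply: eq_bigr => w _; rewrite mxE.
  by rewrite h; apply: eq_bigr => w _; rewrite mxE.
pose A t := q j 0 t - q i 0 t; pose B t := q k 0 t - q i 0 t.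
pose o0 : 'I_3 := inord 0; pose o1 : 'I_3 := inord 1; pose o2 : 'I_3 := inord 2.
(* Normal vector of the plane, the cross product of [A] and [B]; some vertex off the plane shows
   that it is nonzero. *)
pose n0 := A o1 * B o2 - A o2 * B o1; pose n1 := A o2 * B o0 - A o0 * B o2.
pose n2 := A o0 * B o1 - A o1 * B o0.
have planeE l : plane i j k l = n0 * q l 0 o0 + n1 * q l 0 o1 + n2 * q l 0 o2 -
    (n0 * q i 0 o0 + n1 * q i 0 o1 + n2 * q i 0 o2) * 1.
  by rewrite /plane /det3 !mxE /n0 /n1 /n2 /A /B /o0 /o1 /o2; ring.
have L0 l : l \in [:: i; j; k] -> plane i j k l = 0.
  by rewrite !inE => /or3P[] /eqP ->; rewrite /plane /det3 !mxE; ring.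
have planeS h z : \sum_(v <- map label h) wt z v * plane i j k v =
    n0 * (\sum_(v <- map label h) wt z v * q v 0 o0) + n1 * (\sum_(v <- map label h) wt z v * q v 0 o1) +
    n2 * (\sum_(v <- map label h) wt z v * q v 0 o2) -
    (n0 * q i 0 o0 + n1 * q i 0 o1 + n2 * q i 0 o2) * (\sum_(v <- map label h) wt z v * 1).
  rewrite !mulr_sumr -!big_split /= -sumrB; apply: eq_bigr => v _.
  by rewrite planeE; ring.
have eL : \sum_(v <- map label f) wt x v * plane i j k v = \sum_(v <- map label g) wt y v * plane i j k v.
  by rewrite !planeS !coord !total.
have wt0 h z : simplex h z -> forall v, 0 <= wt z v by move=> [z0 _ _] v; exact: z0.
have [zx zy] := separated_support (wt0 _ _ sx) (wt0 _ _ sy) Lf Lg L0 eL.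
have [al alE] := supported_sum uijk zx; have [be beE] := supported_sum uijk zy.
have sums c : \sum_(w <- map label f) wt x w * c w - \sum_(w <- map label g) wt y w * c w =
    (al i - be i) * c i + (al j - be j) * c j + (al k - be k) * c k.
  by rewrite alE beE !big_cons !big_nil; ring.
have one : (al i - be i) + (al j - be j) + (al k - be k) = 0.
  by have := sums (fun=> 1); rewrite !total // subrr !mulr1.
have dep t : (al j - be j) * A t + (al k - be k) * B t = 0.
  have := sums (fun v => q v 0 t); rewrite coord subrr => h.
  transitivity (((al i - be i) * q i 0 t + (al j - be j) * q j 0 t + (al k - be k) * q k 0 t) -
    ((al i - be i) + (al j - be j) + (al k - be k)) * q i 0 t); first by rewrite /A /B; ring.
  by rewrite -h one mul0r subrr.
have nz : (n0 != 0) || (n1 != 0) || (n2 != 0).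
  apply: contraNT pl0; rewrite !negb_or !negbK => /andP[/andP[/eqP z0 /eqP z1] /eqP z2].
  by rewrite planeE z0 z1 z2 !mul0r !addr0 mul0r subrr.
(* Taking the cross product of the relation with [B] and with [A] leaves [c] and [d] times the
   normal vector. *)
have kill (c d : R) : (forall t, c * A t + d * B t = 0) -> c = 0 /\ d = 0.
  move=> h; have [h0 h1 h2] := And3 (h o0) (h o1) (h o2).
  have c0 : c * n0 = 0.
    by transitivity ((c * A o1 + d * B o1) * B o2 - (c * A o2 + d * B o2) * B o1); [rewrite /n0; ring | rewrite h1 h2; ring].
  have c1 : c * n1 = 0.
    by transitivity ((c * A o2 + d * B o2) * B o0 - (c * A o0 + d * B o0) * B o2); [rewrite /n1; ring | rewrite h0 h2; ring].
  have c2 : c * n2 = 0.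
    by transitivity ((c * A o0 + d * B o0) * B o1 - (c * A o1 + d * B o1) * B o0); [rewrite /n2; ring | rewrite h0 h1; ring].
  have d0 : d * n0 = 0.
    by transitivity (A o1 * (c * A o2 + d * B o2) - A o2 * (c * A o1 + d * B o1)); [rewrite /n0; ring | rewrite h1 h2; ring].
  have d1 : d * n1 = 0.
    by transitivity (A o2 * (c * A o0 + d * B o0) - A o0 * (c * A o2 + d * B o2)); [rewrite /n1; ring | rewrite h0 h2; ring].
  have d2 : d * n2 = 0.
    by transitivity (A o0 * (c * A o1 + d * B o1) - A o1 * (c * A o0 + d * B o0)); [rewrite /n2; ring | rewrite h0 h1; ring].
  by case/orP: nz => [/orP[]|] z; split; apply: (mulIf z); rewrite mul0r.
have [zj zk] := kill _ _ dep; have zi : al i - be i = 0 by lra.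
apply/rowP => v; apply/eqP; rewrite -subr_eq0; apply/eqP.
have value h (z : 'rV[R]_8) : good_face h -> simplex h z -> z 0 v = \sum_(w <- map label h) wt z w * (w == (v : nat))%:R.
  move=> gh sz; have [_ _ lz] := sz; have [_ uh /allP h8] := and3P gh.
  transitivity (\sum_(w < 8) z 0 w * ((w : nat) == (v : nat))%:R).
    rewrite (bigD1 v) //= eqxx mulr1 big1 ?addr0 // => w wv.
    by rewrite val_eqE (negPf wv) mulr0.
  rewrite (sum_simplex gh); last first.
    by move=> w wh; have [->|/lz] := eqVneq (z 0 w) 0; rewrite ?mul0r // (negPf wh).
  rewrite big_map big_seq [RHS]big_seq; apply: eq_bigr => w /h8 w8.
  by rewrite /wt inordK.
by rewrite (value f x gf sx) (value g y gg sy) sums zi zj zk !mul0r !addr0.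
Qed.

Hypothesis disjoint : forall f g, f \in F -> g \in F ->
  space_separated (map label f) (map label g).

Theorem space_pl_inj f g x y : f \in F -> g \in F -> simplex f x -> simplex g y ->
  pl q x = pl q y -> x = y.
Proof.
move=> fF gF' sx sy; apply: (space_separated_inj _ _ sx sy); last exact: disjoint.
  exact: (allP gF).
exact: (allP gF).
Qed.

End SpaceInjectivity.

(** * Angles along an arc of directions *)

Section Arcs.
Variable R : realType.
Implicit Types z c e : R[i].

Definition arc_pairs (T : Type) (z : T) (s : seq T) (e : T) := zip (z :: s) (rcons s e).

(** Angles telescope only while the total stays below a half turn, which the condition against the
    first direction [z] guarantees at every stage. *)
Lemma carg_arc_from z c s e : 0 < ccross z c -> path (fun u v => 0 < ccross u v) c (rcons s e) ->
  all (fun u => 0 < ccross z u) (rcons s e) ->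
  carg z c + \sum_(p <- arc_pairs c s e) carg p.1 p.2 = carg z e.
Proof.
elim: s c => [|d s IH] c zc /=.
  by rewrite /arc_pairs /= big_cons big_nil addr0 !andbT => ce ze; exact: carg_add.
move=> /andP[cd ds] /andP[zd zs]; rewrite /arc_pairs /= big_cons addrA carg_add //.
exact: IH.
Qed.

Lemma carg_arc z s e : path (fun u v => 0 < ccross u v) z (rcons s e) ->
  all (fun u => 0 < ccross z u) (rcons s e) ->
  \sum_(p <- arc_pairs z s e) carg p.1 p.2 = carg z e.
Proof.
case: s => [|d s] /=; first by rewrite /arc_pairs /= big_cons big_nil addr0.
move=> /andP[_ ds] /andP[zd zs]; rewrite /arc_pairs /= big_cons.
exact: carg_arc_from.
Qed.
End Arcs.

(** * Cone angles *)

Section ConeAngle.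
Variables (R : realType) (F : seq (seq lvertex)) (S a b : R).
Variables (p : nat -> R[i]) (q : nat -> 'rV[R]_3).
Hypothesis gF : all good_face F.
Notation pos := (pos S a b p).
Hypothesis edge : forall f u v, f \in F -> u \in f -> v \in f ->
  dot (q (label u) - q (label v)) (q (label u) - q (label v)) = cdot (pos u - pos v) (pos u - pos v).

Lemma dot_cdot f u v w : f \in F -> u \in f -> v \in f -> w \in f ->
  dot (q (label v) - q (label u)) (q (label w) - q (label u)) = cdot (pos v - pos u) (pos w - pos u).
Proof.
move=> fF uf vf wf; have two : 2 != 0 :> R by rewrite pnatr_eq0.
by apply: (mulfI two); rewrite dot_polarization cdot_polarization !(edge fF).
Qed.

Lemma angle_carg f u v w : f \in F -> u \in f -> v \in f -> w \in f ->
  angle (q (label u)) (q (label v)) (q (label w)) = carg (pos v - pos u) (pos w - pos u).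
Proof.
move=> fF uf vf wf.
by rewrite /angle /carg /enorm !normcE !(dot_cdot fF).
Qed.

Lemma angleC (u v w : 'rV[R]_3) : angle u v w = angle u w v.
Proof.
rewrite /angle [enorm _ * _]mulrC; congr (acos (_ / _)).
by apply: eq_bigr => i _; rewrite mulrC.
Qed.

(** The Gram determinant of two sides is the same in space and in the plane, where it is the square
    of the cross product; dependent vectors would make it 0. *)
Lemma face_nondegenerate f u v w : f \in F -> u \in f -> v \in f -> w \in f ->
  ccross (pos v - pos u) (pos w - pos u) != 0 ->
  nondegenerate_triangle (q (label u)) (q (label v)) (q (label w)).
Proof.
move=> fF uf vf wf c0; rewrite /nondegenerate_triangle.
set A := q (label v) - _; set B := q (label w) - _.
have gram : dot A A * dot B B - dot A B ^+ 2 != 0.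
  rewrite /A /B !(dot_cdot fF) //; set P := pos v - _ in c0 *; set Q := pos w - _ in c0 *.
  suff -> : cdot P P * cdot Q Q - cdot P Q ^+ 2 = ccross P Q ^+ 2 by rewrite sqrf_eq0.
  by rewrite /cdot /ccross; ring.
have dotZl (c : R) (x y : 'rV[R]_3) : dot (c *: x) y = c * dot x y.
  by rewrite /dot mulr_sumr; apply: eq_bigr => i _; rewrite mxE mulrA.
have dotCc (x y : 'rV[R]_3) : dot x y = dot y x by apply: eq_bigr => i _; rewrite mulrC.
rewrite free_cons span_seq1 seq1_free; apply/andP; split.
  apply: contraNN gram => /vlineP[k AE]; rewrite AE !dotZl [dot B (k *: B)]dotCc dotZl.
  by rewrite expr2; apply/eqP; ring.
apply: contraNneq gram => ->.
have d0 (x : 'rV[R]_3) : dot x 0 = 0 by rewrite /dot big1 // => i _; rewrite mxE mulr0.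
by rewrite !d0 mulr0 expr2 mulr0 subrr.
Qed.

Hypothesis area : forall u v w, [:: u; v; w] \in F -> ccross (pos v - pos u) (pos w - pos u) != 0.

Lemma nondegenerate_faces (u v w : 'I_8) : [set u; v; w]%SET \in faces (face_complex F) ->
  nondegenerate_triangle (q u) (q v) (q w).
Proof.
rewrite mem_faces => /andP[uniq_uvw /hasP[f fF /=]]; rewrite andbT => /and3P[].
move=> /lookup_mem[uf lu] /lookup_mem[vf lv] /lookup_mem[wf lw].
rewrite -lu -lv -lw; apply: (face_nondegenerate fF) => //.
have : uniq [:: lookup f u; lookup f v; lookup f w].
  apply: (@map_uniq _ _ label).
  have -> : map label [:: lookup f u; lookup f v; lookup f w] = map val [:: u; v; w] by rewrite /= lu lv lw.
  by rewrite (map_inj_uniq val_inj).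
have [x [y [z [fE _ _]]]] := good_faceP (allP gF _ fF).
have xyz : ccross (pos y - pos x) (pos z - pos x) != 0 by apply: area; rewrite -fE.
move: (lookup f u) (lookup f v) (lookup f w) uf vf wf {lu lv lw} => A B C; rewrite fE.
have e1 : ccross (pos z - pos y) (pos x - pos y) = ccross (pos y - pos x) (pos z - pos x).
  by rewrite /ccross !reimE; ring.
have e2 : ccross (pos x - pos z) (pos y - pos z) = ccross (pos y - pos x) (pos z - pos x).
  by rewrite /ccross !reimE; ring.
have sw P Q T : ccross (pos Q - pos P) (pos T - pos P) = - ccross (pos T - pos P) (pos Q - pos P).
  by rewrite /ccross !reimE; ring.
(* Of the 27 assignments only the six orderings survive [uniq]; cyclic ones keep the cross product,
   the others change its sign. *)
rewrite !inE => /or3P[] /eqP -> /or3P[] /eqP -> /or3P[] /eqP ->;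
  rewrite /= ?inE ?eqxx ?orbT ?andbF //= => _;
  first [exact: xyz | by rewrite e1 | by rewrite e2 | by rewrite sw oppr_eq0 |
         by rewrite sw oppr_eq0 e1 | by rewrite sw oppr_eq0 e2].
Qed.

(* [(a0, s0)], [(a1, s1)], [(a2, s2)] list the link of [v] in cyclic order, cut
   into three arcs, each shorter than a half turn. *)
Variables (v : nat) (a0 a1 a2 : lvertex) (s0 s1 s2 : seq lvertex).
Definition center : lvertex := (v, 0, 0).
Definition link_pairs := arc_pairs a0 s0 a1 ++ arc_pairs a1 s1 a2 ++ arc_pairs a2 s2 a0.
(** [cone_angle] counts a face once through [p.1 < p.2]; link edges are normalized in the same way
    before the two index sets are compared. *)
Definition ordered_labels (c : lvertex * lvertex) : nat * nat :=
  (minn (label c.1) (label c.2), maxn (label c.1) (label c.2)).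
Definition direction (w : lvertex) := pos w - pos center.
Definition short_arc z s e :=
  path (fun c d => 0 < ccross (direction c) (direction d)) z (rcons s e) &&
  all (fun c => 0 < ccross (direction z) (direction c)) (rcons s e).

Hypothesis v8 : (v < 8)%N.
Hypothesis arcs : [&& short_arc a0 s0 a1, short_arc a1 s1 a2 & short_arc a2 s2 a0].
Hypothesis star_faces : forall c, c \in link_pairs -> exists f m n,
  [/\ f \in F, shift m n center \in f, shift m n c.1 \in f & shift m n c.2 \in f].
Hypothesis link_uniq : uniq (map ordered_labels link_pairs).
Hypothesis link_complete : forall i j, (i < 8)%N -> (j < 8)%N ->
  ((i < j)%N && (uniq [:: v; i; j] && has (fun f => all (fun k => k \in map label f) [:: v; i; j]) F)) =
  ((i, j) \in map ordered_labels link_pairs).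
Hypothesis link_bound : all (fun c => (label c.1 < 8)%N && (label c.2 < 8)%N) link_pairs.

Lemma sum_arc z s e : short_arc z s e ->
  \sum_(c <- arc_pairs z s e) carg (direction c.1) (direction c.2) = carg (direction z) (direction e).
Proof.
move=> /andP[pz az]; rewrite -(carg_arc (s := map direction s)).
- have mapz (f : lvertex -> R[i]) (k l : seq lvertex) :
      zip (map f k) (map f l) = map (fun c => (f c.1, f c.2)) (zip k l).
    by elim: k l => [|x k IH] [|y l] //=; rewrite IH.
  by rewrite /arc_pairs -map_rcons -map_cons mapz big_map; exact: eq_bigr.
- by rewrite -map_rcons path_map.
- by rewrite -map_rcons all_map.
Qed.

(** Each arc telescopes to one angle, and the three directions that remain wind once around the
    centre. *)
Lemma link_sum : \sum_(c <- link_pairs) carg (direction c.1) (direction c.2) = 2 * pi.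
Proof.
have /and3P[h0 h1 h2] := arcs.
rewrite !big_cat /= !sum_arc // addrA carg_triangle //.
- by move: h0 => /andP[_]; rewrite all_rcons => /andP[].
- by move: h1 => /andP[_]; rewrite all_rcons => /andP[].
- by move: h2 => /andP[_]; rewrite all_rcons => /andP[].
Qed.

Theorem cone_angle_2pi : cone_angle (face_complex F) (fun w : 'I_8 => q w) (Ordinal v8) = 2 * pi.
Proof.
rewrite -link_sum /cone_angle.
pose emb (ij : nat * nat) : 'I_8 * 'I_8 := (inord ij.1, inord ij.2).
have bound ij : ij \in map ordered_labels link_pairs -> (ij.1 < 8)%N /\ (ij.2 < 8)%N.
  move=> /mapP[c /(allP link_bound)/andP[c1 c2] ->] /=.
  by rewrite /minn /maxn; case: ifP.
transitivity (\sum_(ij <- map ordered_labels link_pairs) angle (q v) (q ij.1) (q ij.2)).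
  transitivity (\sum_(P <- map emb (map ordered_labels link_pairs)) angle (q v) (q P.1) (q P.2)).
    have ue : uniq (map emb (map ordered_labels link_pairs)).
      rewrite map_inj_in_uniq // => -[i j] [i' j'] /bound[/= i8 j8] /bound[/= i8' j8'] [].
      by move=> /(congr1 val) /=; rewrite !inordK // => -> /(congr1 val) /=; rewrite !inordK // => ->.
    rewrite big_uniq //=; apply: eq_bigl => -[i j] /=.
    rewrite mem_faces -(map_inj_uniq val_inj) /= link_complete //.
    apply/idP/mapP => [h|[[i' j'] h [-> ->]]].
      by exists ((i : nat), (j : nat)) => //; rewrite /emb /= !inord_val.
    by have [/= i8 j8] := bound _ h; rewrite !inordK.
  rewrite big_map big_seq [RHS]big_seq; apply: eq_bigr => ij /bound[h1 h2].
  by rewrite /= !inordK.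
rewrite big_map big_seq [RHS]big_seq; apply: eq_bigr => c cl.
have [f [m [n [fF cf c1f c2f]]]] := star_faces cl.
have rel k : pos (shift m n k) - pos (shift m n center) = direction k.
  by rewrite !pos_shift /direction opprD addrACA subrr addr0.
rewrite -!rel -(angle_carg fF cf c1f c2f).
rewrite /ordered_labels /= /minn /maxn; case: ifP => // _.
exact: angleC.
Qed.

End ConeAngle.

Delimit Scope Z_scope with ZZ.

(** * Integer interval arithmetic *)

Section IntegerIntervals.
Variable R : realType.

Definition z2r (z : Z) : R := (ssrZ.int_of_Z z)%:~R.

Lemma z2r0 : z2r 0%ZZ = 0. Proof. by []. Qed.
Lemma z2r1 : z2r 1%ZZ = 1. Proof. by rewrite /z2r /= rmorph1. Qed.
Lemma z2rD x y : z2r (x + y)%ZZ = z2r x + z2r y.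
Proof. by rewrite /z2r -rmorphD; congr (_%:~R); lia. Qed.
Lemma z2rN x : z2r (- x)%ZZ = - z2r x.
Proof. by rewrite /z2r -rmorphN; congr (_%:~R); lia. Qed.
Lemma z2rB x y : z2r (x - y)%ZZ = z2r x - z2r y.
Proof. by rewrite /Z.sub z2rD z2rN. Qed.
Lemma z2rM x y : z2r (x * y)%ZZ = z2r x * z2r y.
Proof. by rewrite /z2r -rmorphM; congr (_%:~R); lia. Qed.
Lemma ler_z2r x y : (x <= y)%ZZ -> z2r x <= z2r y.
Proof. by move=> h; rewrite /z2r ler_int; lia. Qed.
Lemma ltr_z2r x y : (x < y)%ZZ -> z2r x < z2r y.
Proof. by move=> h; rewrite /z2r ltr_int; lia. Qed.
Lemma z2r_int (m : int) : z2r (ssrZ.Z_of_int m) = m%:~R.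
Proof. by rewrite /z2r ssrZ.Z_of_intK. Qed.
Lemma z2r_abs x : z2r (Z.abs x) = `|z2r x|.
Proof. by rewrite /z2r -intr_norm; congr (_%:~R); lia. Qed.

(* The interval [(c, r)] has centre [c] and radius [r]. *)
Definition interval := (Z * Z)%type.
Implicit Types I J : interval.

Definition inside I (x : R) := `|x - z2r I.1| <= z2r I.2.
Definition iadd I J : interval := ((I.1 + J.1)%ZZ, (I.2 + J.2)%ZZ).
Definition isub I J : interval := ((I.1 - J.1)%ZZ, (I.2 + J.2)%ZZ).
(** With [c] and [d] the centres, the error is [c (y - d) + (x - c) y], where [y] is bounded by the
    magnitude of its interval. Integer operations are exact, so no rounding occurs. *)
Definition imul I J : interval :=
  ((I.1 * J.1)%ZZ, (Z.abs I.1 * J.2 + I.2 * (Z.abs J.1 + J.2))%ZZ).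
Definition isum (s : seq interval) : interval := foldr iadd (0%ZZ, 0%ZZ) s.
Definition iconst (z : Z) : interval := (z, 0%ZZ).
Definition magnitude I : Z := (Z.abs I.1 + I.2)%ZZ.
Definition ipos I : bool := (I.2 <? I.1)%ZZ.
Definition ineg I : bool := (I.2 <? - I.1)%ZZ.

Lemma inside_const z : inside (iconst z) (z2r z).
Proof. by rewrite /inside subrr normr0. Qed.

Lemma inside_add I J x y : inside I x -> inside J y -> inside (iadd I J) (x + y).
Proof.
move=> hx hy; rewrite /inside /= !z2rD opprD addrACA.
by apply: le_trans (ler_normD _ _) (lerD hx hy).
Qed.

Lemma inside_sub I J x y : inside I x -> inside J y -> inside (isub I J) (x - y).
Proof.
move=> hx hy; rewrite /inside /= z2rB z2rD.
have -> : x - y - (z2r I.1 - z2r J.1) = (x - z2r I.1) - (y - z2r J.1) by ring.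
exact: le_trans (ler_normB _ _) (lerD hx hy).
Qed.

Lemma magnitudeP I x : inside I x -> `|x| <= z2r (magnitude I).
Proof.
move=> hx; rewrite z2rD z2r_abs -[x](subrK (z2r I.1)) addrC.
by apply: le_trans (ler_normD _ _) _; rewrite lerD2l.
Qed.

Lemma inside_mul I J x y : inside I x -> inside J y -> inside (imul I J) (x * y).
Proof.
move=> hx hy; rewrite /inside /= !(z2rM, z2rD, z2r_abs).
have -> : x * y - z2r I.1 * z2r J.1 = z2r I.1 * (y - z2r J.1) + (x - z2r I.1) * y by ring.
apply: le_trans (ler_normD _ _) _; rewrite !normrM; apply: lerD; first by rewrite ler_wpM2l.
have := magnitudeP hy; rewrite z2rD z2r_abs => my.
exact: ler_pM.
Qed.

Lemma inside_pos I x : inside I x -> ipos I -> 0 < x.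
Proof.
move=> hx /Z.ltb_lt/ltr_z2r; rewrite /inside ler_distl in hx.
by case/andP: hx => hx _; rewrite -subr_gt0 => h; apply: lt_le_trans h hx.
Qed.

Lemma inside_neg I x : inside I x -> ineg I -> x < 0.
Proof.
move=> hx /Z.ltb_lt/ltr_z2r; rewrite /inside ler_distl in hx.
case/andP: hx => _ hx; rewrite z2rN => h; apply: le_lt_trans hx _.
by rewrite addrC -ltrBrDr sub0r.
Qed.

Lemma inside_sum (T : eqType) (s : seq T) (f : T -> R) (g : T -> interval) :
  (forall k, k \in s -> inside (g k) (f k)) ->
  inside (isum (map g s)) (\sum_(k <- s) f k).
Proof.
elim: s => [|k s IH] h; first by rewrite big_nil /inside /= subrr normr0.
rewrite big_cons; apply: inside_add; first by apply: h; rewrite mem_head.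
by apply: IH => j js; apply: h; rewrite inE js orbT.
Qed.

Lemma z2r_sum (T : Type) (s : seq T) (f : T -> Z) :
  z2r (foldr Z.add 0%ZZ (map f s)) = \sum_(k <- s) z2r (f k).
Proof. by elim: s => [|k s IH]; rewrite ?big_nil // big_cons /= z2rD IH. Qed.
End IntegerIntervals.

(** Supplies the complete normed structure on which [banach_fixed_point] works. *)
HB.instance Definition _ (R : realType) m n := Complete.on 'M[R]_(m, n).

(** * Solving the edge-length equations *)

Section Newton.
Variables (R : realType) (n : nat).
Notation vec := 'rV[R]_n.+1.
Variables (E : eqType) (es : seq E) (G : E -> vec -> R) (A : nat -> E -> R).
Variables (x0 : vec) (r D : R) (free : pred nat).
Definition entry (x : vec) (k : nat) : R := x 0 (inord k).
Definition near_box : set vec :=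
  [set x | forall k, (k <= n)%N -> `|entry x k - entry x0 k| <= r /\ (~~ free k -> entry x k = entry x0 k)].
Hypothesis D0 : 0 < D.
Hypothesis r0 : 0 <= r.
(** With [J] the difference quotient of [G] between the two points, this bounds the sup-norm
    operator norm of [D - A J] by [D / 2] on the free coordinates. *)
Hypothesis quasi_inverse : forall x y M, near_box x -> near_box y ->
  (forall k, (k <= n)%N -> `|entry x k - entry y k| <= M) ->
  forall i, (i <= n)%N -> free i ->
  `|D * (entry x i - entry y i) - \sum_(e <- es) A i e * (G e x - G e y)| <= D / 2 * M.
Hypothesis small_residual : forall i, (i <= n)%N -> free i ->
  `|\sum_(e <- es) A i e * G e x0| <= D / 2 * r.

Definition newton_step (x : vec) : vec :=
  \row_(i < n.+1) if free i then x 0 i - (\sum_(e <- es) A i e * G e x) / D else x0 0 i.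

Lemma entryE (x : vec) (i : 'I_n.+1) : x 0 i = entry x i.
Proof. by rewrite /entry inord_val. Qed.

Lemma vec_norm_le (x : vec) M : 0 <= M -> (forall k, (k <= n)%N -> `|entry x k| <= M) -> `|x| <= M.
Proof.
move=> M0 h; rewrite -[leLHS]/(mx_norm x) mx_normrE; apply: bigmax_le => // -[i j] _ /=.
by rewrite ord1 entryE h // -ltnS.
Qed.

Lemma entry_le_norm (x : vec) k : `|entry x k| <= `|x|.
Proof.
rewrite -[leRHS]/(mx_norm x) mx_normrE.
exact: (le_bigmax _ (fun ij : 'I_1 * 'I_n.+1 => `|x ij.1 ij.2|) (0, inord k)).
Qed.

Lemma newton_contracts x y M : near_box x -> near_box y -> 0 <= M ->
  (forall k, (k <= n)%N -> `|entry x k - entry y k| <= M) ->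
  forall k, (k <= n)%N -> `|entry (newton_step x) k - entry (newton_step y) k| <= M / 2.
Proof.
move=> bx by_ M0 xy k kn; rewrite /entry !mxE inordK //; case: ifPn => fk; last first.
  by rewrite subrr normr0 divr_ge0.
have := quasi_inverse bx by_ xy kn fk.
have -> : D * (entry x k - entry y k) - \sum_(e <- es) A k e * (G e x - G e y) =
  D * ((entry x k - (\sum_(e <- es) A k e * G e x) / D) -
       (entry y k - (\sum_(e <- es) A k e * G e y) / D)).
  have -> : \sum_(e <- es) A k e * (G e x - G e y) =
      \sum_(e <- es) A k e * G e x - \sum_(e <- es) A k e * G e y.
    by rewrite -sumrB; apply: eq_bigr => e _; rewrite mulrBr.
  by field; rewrite gt_eqF.
rewrite normrM gtr0_norm // -mulrA ler_pM2l // /entry => /le_trans; apply.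
by rewrite mulrC.
Qed.

(** Half of the radius pays for the distance between the images of [x] and [x0], the other half for
    the step made at [x0]. *)
Lemma newton_box x : near_box x -> near_box (newton_step x).
Proof.
have bx0 : near_box x0 by move=> k _; rewrite subrr normr0.
move=> bx k kn; split; last by move=> /negPf fk; rewrite /entry mxE inordK // fk.
have h : `|entry (newton_step x) k - entry (newton_step x0) k| <= r / 2.
  by apply: newton_contracts => // j jn; have [] := bx j jn.
have h0 : `|entry (newton_step x0) k - entry x0 k| <= r / 2.
  rewrite /entry mxE inordK //; case: ifPn => fk; last by rewrite subrr normr0 divr_ge0.
  rewrite [x0 0 (inord k) - _]addrC addrK normrN normrM normfV [`|D|]gtr0_norm //.
  rewrite ler_pdivrMr //; apply: le_trans (small_residual kn fk) _.
  by rewrite mulrAC [r / 2 * D]mulrC mulrA.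
apply: le_trans (ler_distD (entry (newton_step x0) k) _ _) _.
by rewrite [r]splitr lerD.
Qed.

Lemma near_box_closed : closed near_box.
Proof.
have -> : near_box = \bigcap_(k in [set k | (k <= n)%N])
    ((entry^~ k) @^-1` [set t | `|t - entry x0 k| <= r /\ (~~ free k -> t = entry x0 k)]).
  by apply/seteqP; split=> x h k kn; have := h k kn.
apply: closed_bigI => k _; apply: preimage_closed.
  by move=> x _; exact: coord_continuous.
have -> : [set t | `|t - entry x0 k| <= r /\ (~~ free k -> t = entry x0 k)] =
    [set` `[entry x0 k - r, entry x0 k + r]] `&` [set t | free k \/ t = entry x0 k].
  apply/seteqP; split=> t /=; rewrite in_itv /= ler_distl.
    by move=> [-> h]; split=> //; have [fk|/h] := boolP (free k); [left | right].
  by move=> [-> [fk|->]]; split=> //; rewrite fk.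
apply: closedI; first exact: itv_closed.
case: (boolP (free k)) => fk.
  have -> : [set t | true \/ t = entry x0 k] = setT by apply/seteqP; split=> // t _; left.
  exact: closedT.
have -> : [set t | false \/ t = entry x0 k] = [set entry x0 k].
  by apply/seteqP; split=> t /=; [case | right].
exact: closed_eq.
Qed.

(** A fixed point only kills the combinations of equations formed by [A]; the equations themselves
    need injectivity of that matrix, supplied separately. *)
Lemma newton_zero : exists x, near_box x /\
  forall i, (i <= n)%N -> free i -> \sum_(e <- es) A i e * G e x = 0.
Proof.
have fU : set_fun near_box near_box newton_step by move=> x; exact: newton_box.
have half : 0 <= 2^-1 :> R by rewrite invr_ge0.
have ctr : is_contraction (mkfun_fun fU).
  exists (NngNum half); split => /=; first by rewrite invf_lt1 // ltr1n.
  move=> [x y] /= [bx by_]; apply: vec_norm_le => [|k kn]; first by rewrite mulr_ge0.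
  rewrite /entry mxE [X in _ + X]mxE mulrC; apply: newton_contracts => // j jn.
  by have := entry_le_norm (x - y) j; rewrite /entry mxE [X in _ + X]mxE.
have ne : near_box !=set0 by exists x0 => k _; rewrite subrr normr0.
have [x bx /= xE] := banach_fixed_point ctr near_box_closed ne.
exists x; split=> // i ile fi.
have /(congr1 (entry^~ i)) := xE.
rewrite /mkfun /entry mxE inordK // fi => /eqP; rewrite eq_sym -subr_eq0 addrAC subrr sub0r.
by rewrite oppr_eq0 mulf_eq0 invr_eq0 (gt_eqF D0) orbF => /eqP.
Qed.

End Newton.

Definition edge_data := (nat * nat * int * int)%type.

Section EdgeSystem.
(* Coordinates are numbered so that [5 * v + c] is the [c]-th of the three space
   coordinates of [v] for [c < 3], and its plane coordinates for [c = 3, 4]. *)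
Variables (scale shear : Z) (height : interval) (centre : seq Z) (radius : Z).
Variables (edges : seq edge_data) (free : seq nat).
(* [inverse / denominator] approximates the inverse Jacobian, and [left_inverse /
   left_denominator] the inverse of [inverse]: since [inverse] is thus injective, a
   fixed point of the Newton step solves the equations. *)
Variables (inverse : seq (seq Z)) (denominator : Z).
Variables (left_inverse : seq (seq Z)) (left_denominator : Z).

Definition start (k : nat) : Z := nth Z0 centre k.
Definition coord (k : nat) : interval := (start k, radius).
Definition period_x (m n : int) : Z := (ssrZ.Z_of_int m * scale + ssrZ.Z_of_int n * shear)%ZZ.
Definition iperiod (m n : int) (c : nat) : interval :=
  if c == 3 then iconst (period_x m n) else
  if c == 4 then imul (iconst (ssrZ.Z_of_int n)) height else iconst Z0.
Definition idiff (X : nat -> interval) (e : edge_data) (c : nat) : interval :=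
  let: (u, v, m, n) := e in iadd (isub (X (5 * v + c)%N) (X (5 * u + c)%N)) (iperiod m n c).
(** Space components count positively and plane components negatively, so that the defect of an edge
    is its squared length in space minus that in the plane. *)
Definition isign (c : nat) (I : interval) : interval := if (c < 3)%N then I else isub (iconst Z0) I.
Definition iresidual (e : edge_data) : interval :=
  isum [seq isign c (imul (idiff (fun k => iconst (start k)) e c) (idiff (fun k => iconst (start k)) e c)) | c <- iota 0 5].
Definition incidence (e : edge_data) (c k : nat) (I : interval) : interval :=
  let: (u, v, _, _) := e in
  if k == (5 * v + c)%N then I else if k == (5 * u + c)%N then isub (iconst Z0) I else iconst Z0.
(** A sum of two edge vectors replaces twice one of them, because increments are taken between two
    different points of the box. *)
Definition iderivative (k : nat) (e : edge_data) : interval :=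
  isum [seq incidence e c k (isign c (iadd (idiff coord e c) (idiff coord e c))) | c <- iota 0 5].

Definition dot_row (row : seq Z) (col : seq interval) : interval :=
  isum [seq imul (iconst aj.1) aj.2 | aj <- zip row col].
Definition zsum (s : seq Z) : Z := foldr Z.add Z0 s.

Definition check_sizes :=
  [&& uniq free, all (fun k => k < 40)%N free, size inverse == size free,
      all (fun row => size row == size edges) inverse,
      all (fun e : edge_data => let: (u, v, _, _) := e in [&& u < 8, v < 8 & u != v])%N edges &
      (0 <? denominator)%ZZ && (0 <=? radius)%ZZ].
(** Absolute row sums bound the operator norm for the sup norm. The derivative intervals hold on the
    whole box, so one evaluation treats all pairs of points. *)
Definition check_contraction :=
  let cols := [seq (k, [seq iderivative k e | e <- edges]) | k <- free] in
  all (fun ir => (2 * zsum [seq magnitude (isub (iconst (if ir.1 == kc.1 then denominator else Z0)) (dot_row ir.2 kc.2))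
                           | kc <- cols] <=? denominator)%ZZ) (zip free inverse).
Definition check_residual :=
  let col := [seq iresidual e | e <- edges] in
  all (fun row => (2 * magnitude (dot_row row col) <=? denominator * radius)%ZZ) inverse.
Definition zdot (s t : seq Z) : Z := zsum [seq (ab.1 * ab.2)%ZZ | ab <- zip s t].
Definition columns := [seq [seq nth Z0 row e | row <- inverse] | e <- iota 0 (size edges)].
(** Strict row sums: [left_inverse] times [inverse] differs from [left_denominator] times the
    identity by less than [left_denominator] in norm, so [inverse] has trivial kernel. *)
Definition check_injective :=
  all (fun er => (zsum [seq Z.abs ((if er.1 == ec.1 then left_denominator else Z0) - zdot er.2 ec.2)
                       | ec <- zip (iota 0 (size edges)) columns] <? left_denominator)%ZZ)
      (zip (iota 0 (size edges)) left_inverse) && (size left_inverse == size edges) &&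
      all (fun row => size row == size free) left_inverse.
Definition check_system := [&& check_sizes, check_contraction, check_residual & check_injective].

Variables (R : realType) (b : R).
Hypothesis b_inside : inside height b.
Hypothesis system_ok : check_system.

Notation vec := 'rV[R]_40.
Notation z2r := (@z2r R).

Definition rperiod (m n : int) (c : nat) : R :=
  if c == 3 then m%:~R * z2r scale + n%:~R * z2r shear else if c == 4 then n%:~R * b else 0.
Definition diff (x : vec) (e : edge_data) (c : nat) : R :=
  let: (u, v, m, n) := e in entry x (5 * v + c) - entry x (5 * u + c) + rperiod m n c.
Definition sign (c : nat) (t : R) : R := if (c < 3)%N then t else 0 - t.
Definition defect (e : edge_data) (x : vec) : R := \sum_(c <- iota 0 5) sign c (diff x e c * diff x e c).

Lemma inside_sign c I t : inside I t -> inside (isign c I) (sign c t).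
Proof. by move=> h; rewrite /isign /sign; case: ifP => // _; apply: inside_sub => //; exact: inside_const. Qed.

Lemma inside_period m n c : inside (iperiod m n c) (rperiod m n c).
Proof.
rewrite /iperiod /rperiod; case: ifP => _.
  by rewrite -!z2r_int -!z2rM -z2rD; exact: inside_const.
case: ifP => _; last exact: inside_const.
by apply: inside_mul => //; rewrite -z2r_int; exact: inside_const.
Qed.

Lemma inside_diff (X : nat -> interval) (x : vec) e c :
  (forall k, (k < 40)%N -> inside (X k) (entry x k)) -> e \in edges -> (c < 5)%N ->
  inside (idiff X e c) (diff x e c).
Proof.
move=> hX eE c5; have /and4P[/and5P[_ _ _ _ /andP[/allP/(_ _ eE)]]] := system_ok.
case: e eE => [[[u v] m] n] _ /and3P[u8 v8 _] _ _ _ _; rewrite /idiff /diff.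
apply: inside_add; last exact: inside_period.
by apply: inside_sub; apply: hX; lia.
Qed.

Definition x0 : vec := \row_(i < 40) z2r (start i).

Lemma entry_x0 k : (k < 40)%N -> entry x0 k = z2r (start k).
Proof. by move=> k40; rewrite /entry mxE inordK. Qed.

Notation box := (near_box x0 (z2r radius) (fun k => k \in free)).

Lemma inside_coord x k : box x -> (k < 40)%N -> inside (coord k) (entry x k).
Proof.
move=> bx k40; have [] := bx k; first by rewrite -ltnS.
by rewrite entry_x0 // => h _; exact: h.
Qed.

Definition derivative (x y : vec) (k : nat) (e : edge_data) : R :=
  \sum_(c <- iota 0 5) let: (u, v, _, _) := e in
    sign c (diff x e c + diff y e c) * ((k == (5 * v + c)%N)%:R - (k == (5 * u + c)%N)%:R).

Lemma inside_derivative x y k e : box x -> box y -> e \in edges ->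
  inside (iderivative k e) (derivative x y k e).
Proof.
move=> bx by_ eE; apply: inside_sum => c; rewrite mem_iota /= => c5.
have hd : inside (isign c (iadd (idiff coord e c) (idiff coord e c))) (sign c (diff x e c + diff y e c)).
  apply/inside_sign/inside_add; apply: inside_diff => // j j40; exact: inside_coord.
have /and4P[/and5P[_ _ _ _ /andP[/allP/(_ _ eE)]]] := system_ok.
move: hd; case: e eE => [[[u v] m] n] _ hd /and3P[u8 v8 uv] _ _ _ _; rewrite /incidence.
case: eqP => [->|_].
  have -> : (5 * v + c)%N == (5 * u + c)%N = false by apply/negbTE; lia.
  by rewrite subr0 mulr1.
case: eqP => _; last by rewrite subrr mulr0; exact: inside_const.
have -> : sign c (diff x (u, v, m, n) c + diff y (u, v, m, n) c) * (false%:R - true%:R) =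
  0 - sign c (diff x (u, v, m, n) c + diff y (u, v, m, n) c) by rewrite sub0r mulrN1 sub0r.
by apply: inside_sub => //; exact: inside_const.
Qed.

(* The residuals are quadratic, so their increments are exactly linear, with
   the derivative taken at the midpoint. *)
Lemma defect_increment x y e : e \in edges ->
  defect e x - defect e y = \sum_(k <- iota 0 40) derivative x y k e * (entry x k - entry y k).
Proof.
move=> eE; have /and4P[/and5P[_ _ _ _ /andP[/allP/(_ _ eE)]]] := system_ok.
case: e eE => [[[u v] m] n] _ /and3P[u8 v8 uv] _ _ _ _.
rewrite /derivative; under [RHS]eq_bigr do rewrite mulr_suml.
rewrite exchange_big /= -sumrB big_seq [RHS]big_seq; apply: eq_bigr => c; rewrite mem_iota /= => c5.
pose d k := entry x k - entry y k.
have pick j : (j < 40)%N -> \sum_(k <- iota 0 40) (k == j)%:R * d k = d j.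
  move=> j40; rewrite (bigD1_seq j) ?iota_uniq ?mem_iota //= eqxx mul1r big1 ?addr0 // => k /negPf ->.
  by rewrite mul0r.
transitivity (sign c (diff x (u, v, m, n) c + diff y (u, v, m, n) c) *
    (\sum_(k <- iota 0 40) (k == (5 * v + c)%N)%:R * d k - \sum_(k <- iota 0 40) (k == (5 * u + c)%N)%:R * d k)).
  rewrite !pick; [|lia|lia]; rewrite /d /diff /sign; case: ifP => _; ring.
rewrite -sumrB mulr_sumr; apply: eq_bigr => k _; rewrite /d; ring.
Qed.

Definition approx (k : nat) (e : nat) : R := z2r (nth Z0 (nth [::] inverse (index k free)) e).
Definition eidx := iota 0 (size edges).
Definition edge_at (j : nat) : edge_data := nth (0%N, 0%N, 0, 0) edges j.
(** Equations are indexed by position in [edges], which is also the column index of [inverse]. *)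
Definition eqn (j : nat) (x : vec) : R := defect (edge_at j) x.

Lemma edge_at_mem j : j \in eidx -> edge_at j \in edges.
Proof. by rewrite mem_iota /= add0n => h; rewrite mem_nth. Qed.

Lemma row_size k : k \in free -> size (nth [::] inverse (index k free)) = size edges.
Proof.
move=> kf; have /and4P[/and5P[_ _ /eqP si /allP rows _] _ _ _] := system_ok.
by apply/eqP/rows; rewrite mem_nth // si index_mem.
Qed.

Lemma row_mem k : k \in free -> (k, nth [::] inverse (index k free)) \in zip free inverse.
Proof.
move=> kf; have /and4P[/and5P[_ _ /eqP si _ _] _ _ _] := system_ok.
have lt : (index k free < size free)%N by rewrite index_mem.
have -> : (k, nth [::] inverse (index k free)) = nth (0%N, [::]) (zip free inverse) (index k free).
  by rewrite nth_zip ?si // nth_index.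
by rewrite mem_nth // size_zip si minnn.
Qed.

Lemma zip_iota (S T : Type) (a : S) (c : T) (s : seq S) (t : seq T) : size s = size t ->
  zip s t = [seq (nth a s j, nth c t j) | j <- iota 0 (size t)].
Proof.
move=> st; rewrite -[LHS](mkseq_nth (a, c)) size_zip st minnn /mkseq.
by apply: eq_map => j; rewrite nth_zip.
Qed.

Lemma inside_dot_row k (g : edge_data -> interval) (h : edge_data -> R) : k \in free ->
  (forall e, e \in edges -> inside (g e) (h e)) ->
  inside (dot_row (nth [::] inverse (index k free)) (map g edges)) (\sum_(j <- eidx) approx k j * h (edge_at j)).
Proof.
move=> kf gh; rewrite /dot_row (zip_iota Z0 (g (0%N, 0%N, 0, 0))) ?size_map ?row_size //.
rewrite -map_comp; apply: inside_sum => j jE; rewrite /=.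
have jlt : (j < size edges)%N by move: jE; rewrite mem_iota.
rewrite (nth_map (0%N, 0%N, 0, 0)) //; apply: inside_mul; first exact: inside_const.
by apply: gh; exact: edge_at_mem.
Qed.

Lemma system_quasi_inverse x y M : box x -> box y ->
  (forall k, (k <= 39)%N -> `|entry x k - entry y k| <= M) ->
  forall i, (i <= 39)%N -> i \in free ->
  `|z2r denominator * (entry x i - entry y i) - \sum_(j <- eidx) approx i j * (eqn j x - eqn j y)|
     <= z2r denominator / 2 * M.
Proof.
move=> bx by_ xyM i _ ifr.
have /and4P[/and5P[ufree /allP f40 _ _ _] contr _ _] := system_ok.
pose d k := entry x k - entry y k.
(* Row [i] of [denominator] times the identity minus [A J], with [J] the exact difference
   quotients. *)
pose w k := z2r (if i == k then denominator else Z0) - \sum_(j <- eidx) approx i j * derivative x y k (edge_at j).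
have i40 : (i < 40)%N := f40 i ifr.
have -> : z2r denominator * (entry x i - entry y i) - \sum_(j <- eidx) approx i j * (eqn j x - eqn j y) =
    \sum_(k <- iota 0 40) w k * d k.
  rewrite /w; under [RHS]eq_bigr do rewrite mulrBl.
  rewrite sumrB; congr (_ - _).
    rewrite (bigD1_seq i) ?iota_uniq ?mem_iota //= eqxx big1 ?addr0 // => k.
    by rewrite eq_sym => /negPf ->; rewrite z2r0 mul0r.
  under [RHS]eq_bigr do rewrite mulr_suml.
  rewrite exchange_big /= big_seq [RHS]big_seq; apply: eq_bigr => j jE.
  rewrite /eqn defect_increment ?edge_at_mem // mulr_sumr; apply: eq_bigr => k _.
  by rewrite mulrA.
have M0 : 0 <= M by apply: le_trans (xyM 0%N isT).
have fixed k : (k < 40)%N -> k \notin free -> d k = 0.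
  move=> k40 kf; have [_ ex] := bx k k40; have [_ ey] := by_ k k40.
  by rewrite /d (ex kf) (ey kf) subrr.
(* Frozen coordinates agree in [x] and [y], so only free columns contribute. *)
have -> : \sum_(k <- iota 0 40) w k * d k = \sum_(k <- free) w k * d k.
  have : forall k, (k \in iota 0 40) = (k < 40)%N by move=> k; rewrite mem_iota.
  move: (iota_uniq 0 40); move: (iota 0 40) => s us sE.
  rewrite (bigID (fun k => k \in free)) /= [X in _ + X]big1_seq ?addr0; last first.
    by move=> k /andP[kf]; rewrite sE => k40; rewrite fixed // mulr0.
  rewrite -big_filter; apply: perm_big; apply: uniq_perm; rewrite ?filter_uniq //.
  by move=> k; rewrite mem_filter sE; case kf: (k \in free) => //=; exact: f40.
pose mag k := magnitude (isub (iconst (if i == k then denominator else Z0))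
    (dot_row (nth [::] inverse (index i free)) [seq iderivative k e | e <- edges])).
have wmag k : `|w k| <= z2r (mag k).
  apply/magnitudeP/inside_sub; first exact: inside_const.
  by apply: (@inside_dot_row i (iderivative k) (derivative x y k)) => // e eE; exact: inside_derivative.
have bound : 2 * \sum_(k <- free) z2r (mag k) <= z2r denominator.
  have h : (2 * zsum [seq mag k | k <- free] <=? denominator)%ZZ.
    by move: contr => /allP/(_ _ (row_mem ifr)); rewrite -map_comp.
  have two : 2 = z2r 2%ZZ :> R by [].
  by rewrite -z2r_sum two -z2rM; apply/ler_z2r/Z.leb_le.
apply: le_trans (ler_norm_sum _ _ _) _.
apply: (@le_trans _ _ (\sum_(k <- free) z2r (mag k) * M)).
  rewrite big_seq [leRHS]big_seq; apply: ler_sum => k kf; rewrite normrM ler_pM //.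
  by apply: xyM; rewrite -ltnS f40.
rewrite -mulr_suml ler_wpM2r // ler_pdivlMr // mulrC; exact: bound.
Qed.

Lemma system_small_residual i : (i <= 39)%N -> i \in free ->
  `|\sum_(j <- eidx) approx i j * eqn j x0| <= z2r denominator / 2 * z2r radius.
Proof.
move=> _ ifr; have /and4P[/and5P[_ _ /eqP si _ _] _ res _] := system_ok.
have h : inside (dot_row (nth [::] inverse (index i free)) [seq iresidual e | e <- edges])
    (\sum_(j <- eidx) approx i j * eqn j x0).
  apply: (@inside_dot_row i iresidual (defect^~ x0)) => // e eE; apply: inside_sum => c.
  rewrite mem_iota /= => c5; apply/inside_sign/inside_mul; apply: inside_diff => // k k40;
    by rewrite entry_x0 //; exact: inside_const.
apply: le_trans (magnitudeP h) _.
rewrite -mulrA [_^-1 * _]mulrC mulrA ler_pdivlMr // mulrC.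
have /Z.leb_le : (2 * magnitude (dot_row (nth [::] inverse (index i free)) [seq iresidual e | e <- edges])
    <=? denominator * radius)%ZZ.
    by move: res => /allP; apply; rewrite mem_nth // si index_mem.
by move=> /(@ler_z2r R); rewrite !z2rM.
Qed.

Lemma seq_argmax (s : seq nat) (v : nat -> R) : s != [::] ->
  exists2 e, e \in s & forall e', e' \in s -> `|v e'| <= `|v e|.
Proof.
elim: s => // e [|e1 s] IH _; first by exists e; rewrite ?mem_head // => e'; rewrite inE => /eqP ->.
have [//|k ks kmax] := IH; have [le|/ltW le] := leP `|v k| `|v e|.
  exists e; rewrite ?mem_head // => e'; rewrite inE => /orP[/eqP -> //|/kmax h].
  exact: le_trans h le.
exists k; first by rewrite inE ks orbT.
by move=> e'; rewrite inE => /orP[/eqP -> //|/kmax].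
Qed.

(** At an entry [v e] of largest absolute value, row [e] of [left_inverse] writes
    [left_denominator * v e] as a sum bounded by a strictly smaller multiple of that value, unless
    [v e = 0]. *)
Lemma system_injective (v : nat -> R) :
  (forall i, i \in free -> \sum_(j <- eidx) approx i j * v j = 0) -> forall j, j \in eidx -> v j = 0.
Proof.
move=> ker; have /and4P[/and5P[ufree _ /eqP si /allP rows _] _ _ /andP[/andP[inj /eqP sl] /allP lrows]] := system_ok.
case es0 : (eidx == [::]); first by move=> j; rewrite (eqP es0).
have [e eE emax] := seq_argmax v (negbT es0).
have elt : (e < size edges)%N by move: eE; rewrite mem_iota.
suff z : v e = 0.
  by move=> j /emax; rewrite z normr0 normr_le0 => /eqP.
pose lrow := nth [::] left_inverse e.
have lsize : size lrow = size free by apply/eqP/lrows; rewrite mem_nth // sl.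
pose C j := zdot lrow [seq nth Z0 row j | row <- inverse].
have CE j : z2r (C j) = \sum_(t <- iota 0 (size free)) z2r (nth Z0 lrow t) * approx (nth 0%N free t) j.
  rewrite /C /zdot (zip_iota Z0 Z0) ?size_map ?si // -map_comp z2r_sum.
  rewrite big_seq [RHS]big_seq; apply: eq_bigr => t; rewrite mem_iota add0n /= => tf.
  by rewrite z2rM /approx index_uniq // (nth_map [::]) ?si.
have CV : \sum_(j <- eidx) z2r (C j) * v j = 0.
  under eq_bigr do rewrite CE mulr_suml.
  rewrite exchange_big /= big1_seq // => t /andP[_]; rewrite mem_iota add0n /= => tf.
  under eq_bigr do rewrite -mulrA; rewrite -mulr_sumr ker ?mulr0 //.
  by rewrite mem_nth.
pose K j := ((if e == j then left_denominator else Z0) - C j)%ZZ.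
have KV : z2r left_denominator * v e = \sum_(j <- eidx) z2r (K j) * v j.
  under [RHS]eq_bigr do rewrite z2rB mulrBl.
  rewrite sumrB CV subr0 (bigD1_seq e) ?iota_uniq //= eqxx big1 ?addr0 // => j.
  by rewrite eq_sym => /negPf ->; rewrite z2r0 mul0r.
have Ksum : \sum_(j <- eidx) `|z2r (K j)| < z2r left_denominator.
  have mem : (e, lrow) \in zip (iota 0 (size edges)) left_inverse.
    have -> : (e, lrow) = nth (0%N, [::]) (zip (iota 0 (size edges)) left_inverse) e.
      by rewrite nth_zip ?size_iota // nth_iota.
    by rewrite mem_nth // size_zip size_iota sl minnn.
  have := allP inj _ mem; rewrite (zip_iota 0%N [::]) ?size_map ?size_iota // -map_comp => /Z.ltb_lt.
  move=> /(@ltr_z2r R); rewrite z2r_sum; apply: le_lt_trans.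
  rewrite le_eqVlt; apply/orP; left; apply/eqP; rewrite big_seq [RHS]big_seq.
  apply: eq_bigr => j; rewrite mem_iota add0n /= => jlt.
  by rewrite -z2r_abs /K /C nth_iota // add0n (nth_map 0%N) ?size_iota // nth_iota.
have := ler_norm_sum eidx (fun j => z2r (K j) * v j) xpredT; rewrite -KV normrM => h.
have h2 : \sum_(j <- eidx) `|z2r (K j) * v j| <= (\sum_(j <- eidx) `|z2r (K j)|) * `|v e|.
  rewrite mulr_suml big_seq [leRHS]big_seq; apply: ler_sum => j jE.
  by rewrite normrM ler_wpM2l // emax.
have := le_trans h h2; apply: contraTeq => ve; rewrite -ltNge ltr_pM2r ?normr_gt0 //.
by apply: lt_le_trans Ksum _; exact: ler_norm.
Qed.

Theorem system_solution : exists x : vec,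
  (forall k, (k < 40)%N -> inside (coord k) (entry x k)) /\ forall e, e \in edges -> defect e x = 0.
Proof.
have /and4P[/and5P[_ _ _ _ /andP[_ /andP[D0 r0]]] _ _ _] := system_ok.
have pD : 0 < z2r denominator by rewrite -z2r0; apply: ltr_z2r; apply/Z.ltb_lt.
have pr : 0 <= z2r radius by rewrite -z2r0; apply: ler_z2r; apply/Z.leb_le.
have [x [bx sol]] := newton_zero pD pr system_quasi_inverse system_small_residual.
exists x; split=> [k|e eE]; first exact: inside_coord.
have h : forall j, j \in eidx -> eqn j x = 0.
  apply: (system_injective (v := eqn^~ x)) => i ifr; apply: sol => //.
  by have /and4P[/and5P[_ /allP/(_ _ ifr)]] := system_ok.
have := h (index e edges); rewrite mem_iota /= add0n index_mem eE /eqn /edge_at nth_index //.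
exact.
Qed.

End EdgeSystem.

(** Three arcs, each given by its first vertex and its interior vertices; an arc ends where the next
    one starts. *)
Definition link := ((lvertex * seq lvertex) * (lvertex * seq lvertex) * (lvertex * seq lvertex))%type.

Record certificate := Certificate {
  scale : Z; shear : Z; height : interval; centre : seq Z; radius : Z;
  edges : seq edge_data; free : seq nat;
  inverse : seq (seq Z); denominator : Z; left_inverse : seq (seq Z); left_denominator : Z;
  triangles : seq (seq lvertex); links : seq link;
  planes : seq (seq (nat * nat * nat));
  frame_x : interval; frame_y : interval }.

(** * Certified tori *)

Section Checks.
Variable C : certificate.
Notation F := (triangles C).
Notation coord := (coord (centre C) (radius C)).

Definition ire (w : lvertex) : interval :=
  iadd (coord (5 * label w + 3)%N) (iconst (period_x (scale C) (shear C) w.1.2 w.2)).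
Definition iim (w : lvertex) : interval :=
  iadd (coord (5 * label w + 4)%N) (imul (iconst (Z_of_int w.2)) (height C)).
Definition place (w : lvertex) : interval * interval := (ire w, iim w).
Definition icross (U V W : interval * interval) : interval :=
  isub (imul (isub V.1 U.1) (isub W.2 U.2)) (imul (isub V.2 U.2) (isub W.1 U.1)).
Definition iline (u v w : lvertex) : interval := icross (place u) (place v) (place w).
Definition left_of (u v w : lvertex) : bool :=
  [&& label u < 8, label v < 8 & label w < 8]%N && ipos (iline u v w).
Definition right_of (u v w : lvertex) : bool :=
  [&& label u < 8, label v < 8 & label w < 8]%N && ineg (iline u v w).
Definition iplane (i j k l : nat) : interval :=
  let x v := isub (coord (5 * v + 0)%N) (coord (5 * i + 0)%N) in
  let y v := isub (coord (5 * v + 1)%N) (coord (5 * i + 1)%N) in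
  let z v := isub (coord (5 * v + 2)%N) (coord (5 * i + 2)%N) in
  iadd (isub (imul (x j) (isub (imul (y k) (z l)) (imul (z k) (y l))))
             (imul (y j) (isub (imul (x k) (z l)) (imul (z k) (x l)))))
       (imul (z j) (isub (imul (x k) (y l)) (imul (y k) (x l)))).
Definition above (i j k l : nat) : bool := (l < 8)%N && ipos (iplane i j k l).
Definition below (i j k l : nat) : bool := (l < 8)%N && ineg (iplane i j k l).

Definition check_faces := (F != [::]) && all good_face F.
Definition common_shifts (f g : seq lvertex) : seq (int * int) :=
  flatten [seq [seq (v.1.2 - u.1.2, v.2 - u.2) | v <- g & label u == label v] | u <- f].
(** The default of [head] concerns faces without common label, where there is nothing to check. *)
Definition check_compatible :=
  all (fun f => all (fun g => let s := common_shifts f g in all (pred1 (head (0, 0) s)) s) F) F.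
Definition has_edge (u v : lvertex) :=
  ((label u, label v, v.1.2 - u.1.2, v.2 - u.2) : edge_data) \in edges C.
Definition check_edges :=
  all (fun f => all (fun u => all (fun v => [|| u == v, has_edge u v | has_edge v u]) f) f) F.
Definition check_orientation :=
  all (fun f => if f is [:: u; v; w] then left_of u v w else false) F.
(** Searches all faces for a translated copy of the side with a vertex on its right; that vertex is
    translated back before its side is tested. *)
Definition across (u v : lvertex) :=
  has (fun g => has (fun u' => let m := u'.1.2 - u.1.2 in let n := u'.2 - u.2 in
    [&& label u' == label u, shift m n v \in g &
        has (fun c => right_of u v (shift (- m) (- n) c)) g]) g) F.
Definition check_partner :=
  all (fun f => all (fun t => if t is [:: u; v; w] then across u v else false) (rots f)) F.
Definition in_frame (I J : interval) := (I.1 - I.2 <=? J.1 - J.2)%ZZ && (J.1 + J.2 <=? I.1 + I.2)%ZZ.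
(** The last two inequalities are the bounds [height] and [width] for [N = 2] and [M = 3]; [small_n]
    and [small_m] list the translations that these leave open. *)
Definition check_frame :=
  all (all (fun w => in_frame (frame_x C) (ire w) && in_frame (frame_y C) (iim w))) F &&
  [&& 0 <? scale C, (height C).2 <? (height C).1,
      2 * (frame_y C).2 <? 2 * ((height C).1 - (height C).2) &
      2 * (frame_x C).2 + 2 * Z.abs (shear C) <? 3 * scale C]%ZZ.
Definition face_sides (T : Type) (f : seq T) := zip f (rot 1 f).
Definition swap_pair (T : Type) (uv : T * T) := (uv.2, uv.1).
Definition placed := (lvertex * (interval * interval))%type.
Definition place_face (f : seq lvertex) : seq placed := [seq (w, place w) | w <- f].
(** The candidate lines are the sides of the two faces. Sides of [g] are reversed, so that the
    positively oriented [g] falls on the right. *)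
Definition plane_separated (f g : seq placed) :=
  has (fun uv : placed * placed => [&& uv.1.1 != uv.2.1,
         all (fun w : placed => (w.1 \in [:: uv.1.1; uv.2.1]) || ineg (icross uv.1.2 uv.2.2 w.2)) g &
         all (fun w : placed => (w.1 \in [:: uv.1.1; uv.2.1]) || ipos (icross uv.1.2 uv.2.2 w.2)) f])
      (face_sides f ++ map (@swap_pair _) (face_sides g)).
Definition small_m : seq int := [:: -2; -1; 0; 1; 2].
Definition small_n : seq int := [:: -1; 0; 1].
Definition check_plane :=
  all (fun f => let f' := place_face f in all (fun g => all (fun m => all (fun n =>
    [&& m == 0, n == 0 & f == g] || plane_separated f' (place_face (map (shift m n) g))) small_n) small_m) F) F.
(** A vertex strictly off the plane, on either side, certifies that the three spanning points are
    not collinear. *)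
Definition space_separates (f g : seq lvertex) (t : nat * nat * nat) :=
  let: (i, j, k) := t in
  [&& uniq [:: i; j; k], [&& i < 8, j < 8 & k < 8]%N,
      has (fun l => above i j k l || below i j k l) (iota 0 8),
      all (fun w => (label w \in [:: i; j; k]) || above i j k (label w)) f &
      all (fun w => (label w \in [:: i; j; k]) || below i j k (label w)) g].
Definition check_space :=
  [&& size (planes C) == size F, all (fun s => size s == size F) (planes C) &
      all (fun fs => all (fun gt => space_separates fs.1 gt.1 gt.2) (zip F fs.2)) (zip F (planes C))].
Definition left_arc (v : nat) (z : lvertex) (s : seq lvertex) (e : lvertex) :=
  path (left_of (center v)) z (rcons s e) && all (left_of (center v) z) (rcons s e).
(** The centre may occur in the face under any translation, which is then applied to the link
    edge. *)
Definition shares_face (v : nat) (c d : lvertex) :=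
  has (fun f => has (fun u => [&& label u == v, shift u.1.2 u.2 c \in f & shift u.1.2 u.2 d \in f]) f) F.
Definition check_link (v : nat) (l : link) :=
  let: ((a0, s0), (a1, s1), (a2, s2)) := l in
  let pairs := link_pairs a0 a1 a2 s0 s1 s2 in
  let labels := map ordered_labels pairs in
  [&& left_arc v a0 s0 a1, left_arc v a1 s1 a2, left_arc v a2 s2 a0 &
  [&& all (fun c => shares_face v c.1 c.2) pairs, uniq labels,
      all (fun i => all (fun j => ((i < j)%N && (uniq [:: v; i; j] &&
        has (fun f => all (fun k => k \in map label f) [:: v; i; j]) F)) == ((i, j) \in labels)) (iota 0 8)) (iota 0 8) &
      all (fun c => (label c.1 < 8)%N && (label c.2 < 8)%N) pairs]].
Definition check_links :=
  (size (links C) == 8%N) && all (fun vl => check_link vl.1 vl.2) (zip (iota 0 8) (links C)).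

Definition check_geometry :=
  [&& check_faces, check_compatible, check_edges, check_orientation, check_partner,
      check_frame, check_plane, check_space & check_links].
Definition check_newton :=
  check_system (scale C) (shear C) (height C) (centre C) (radius C) (edges C) (free C)
    (inverse C) (denominator C) (left_inverse C) (left_denominator C).
End Checks.

Lemma mem_zip_left (S T : eqType) (s : seq S) (t : seq T) x : size s = size t -> x \in s ->
  exists2 y, y \in t & (x, y) \in zip s t.
Proof.
elim: s t => // a s IH [|c t] // [st]; rewrite inE => /orP[/eqP ->|xs].
  by exists c; rewrite mem_head.
by have [y yt h] := IH t st xs; exists y; rewrite inE ?yt ?h orbT.
Qed.

Section Certified.
Variables (C : certificate) (R : realType) (b : R).
Notation F := (triangles C).
Hypothesis newton_ok : check_newton C.
Hypothesis b_inside : inside (height C) b.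
Notation S := (z2r R (scale C)).
Notation a := (z2r R (shear C)).

Variable x : 'rV[R]_40.
Hypothesis x_inside : forall k, (k < 40)%N -> inside (coord (centre C) (radius C) k) (entry x k).
Hypothesis x_zero : forall e, e \in edges C -> defect (scale C) (shear C) b e x = 0.

Definition planar (v : nat) : R[i] := entry x (5 * v + 3) +i* entry x (5 * v + 4).
Definition spatial (v : nat) : 'rV[R]_3 := \row_(c < 3) entry x (5 * v + c).
Notation pos := (pos S a b planar).
Notation line := (line S a b planar).

Lemma inside_re w : (label w < 8)%N -> inside (ire C w) (complex.Re (pos w)).
Proof.
move=> w8; rewrite ReD /=; apply: inside_add; first by apply: x_inside; lia.
by rewrite -!z2r_int -!z2rM -z2rD; exact: inside_const.
Qed.

Lemma inside_im w : (label w < 8)%N -> inside (iim C w) (complex.Im (pos w)).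
Proof.
move=> w8; rewrite ImD /=; apply: inside_add; first by apply: x_inside; lia.
by apply: inside_mul => //; rewrite -z2r_int; exact: inside_const.
Qed.

Lemma inside_line u v w : [&& label u < 8, label v < 8 & label w < 8]%N ->
  inside (iline C u v w) (line u v w).
Proof.
move=> /and3P[u8 v8 w8]; rewrite /line /ccross !(ReD, ImD, ReN, ImN).
by apply: inside_sub; apply: inside_mul; apply: inside_sub; rewrite ?inside_re ?inside_im.
Qed.

Lemma left_ofP u v w : left_of C u v w -> 0 < line u v w.
Proof. by move=> /andP[/inside_line h1 h2]; exact: inside_pos h1 h2. Qed.

Lemma right_ofP u v w : right_of C u v w -> line u v w < 0.
Proof. by move=> /andP[/inside_line h1 h2]; exact: inside_neg h1 h2. Qed.

Lemma inside_plane i j k l : [&& i < 8, j < 8 & k < 8]%N -> (l < 8)%N ->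
  inside (iplane C i j k l) (plane spatial i j k l).
Proof.
move=> /and3P[i8 j8 k8] l8; rewrite /plane /det3 !mxE !inordK //.
by apply: inside_add; first apply: inside_sub; apply: inside_mul; apply: inside_sub;
  try (apply: inside_mul; apply: inside_sub); apply: x_inside; lia.
Qed.

Lemma edge_length e : e \in edges C -> let: (u, v, m, n) := e in
  dot (spatial v - spatial u) (spatial v - spatial u) =
  cdot (planar v - planar u + period S a b m n) (planar v - planar u + period S a b m n).
Proof.
move=> /x_zero; case: e => [[[u v] m] n].
rewrite /defect /= !big_cons big_nil /sign /diff /rperiod /= => h.
apply/eqP; rewrite -subr_eq0 -h; apply/eqP.
rewrite /dot !big_ord_recl big_ord0 !mxE /= /cdot !reimE /= /bump /=; ring.
Qed.

Hypothesis geometry_ok : check_geometry C.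

Let ok_faces : check_faces C. Proof. by case/and5P: geometry_ok. Qed.
Let ok_compatible : check_compatible C. Proof. by case/and5P: geometry_ok. Qed.
Let ok_edges : check_edges C. Proof. by case/and5P: geometry_ok. Qed.
Let ok_orientation : check_orientation C. Proof. by case/and5P: geometry_ok. Qed.
Let ok_partner : check_partner C. Proof. by case/and5P: geometry_ok => _ _ _ _ /and5P[]. Qed.
Let ok_frame : check_frame C. Proof. by case/and5P: geometry_ok => _ _ _ _ /and5P[]. Qed.
Let ok_plane : check_plane C. Proof. by case/and5P: geometry_ok => _ _ _ _ /and5P[]. Qed.
Let ok_space : check_space C. Proof. by case/and5P: geometry_ok => _ _ _ _ /and5P[]. Qed.
Let ok_links : check_links C. Proof. by case/and5P: geometry_ok => _ _ _ _ /and5P[]. Qed.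

Let gF : all good_face F. Proof. by case/andP: ok_faces. Qed.

Lemma scale_gt0 : 0 < S.
Proof. by case/andP: ok_frame => _ /and4P[/Z.ltb_lt/(@ltr_z2r R)]. Qed.

Lemma height_bound : z2r R ((height C).1 - (height C).2)%ZZ <= b.
Proof. by move: b_inside; rewrite /inside ler_distl z2rB => /andP[]. Qed.

Lemma height_gt0 : 0 < b.
Proof.
case/andP: ok_frame => _ /and4P[_ /Z.ltb_lt/(@ltr_z2r R) h _ _].
by apply: lt_le_trans height_bound; rewrite z2rB subr_gt0.
Qed.

Lemma face_compatible f g : f \in F -> g \in F -> exists m n : int,
  forall u v, u \in f -> v \in g -> label u = label v -> v = shift m n u.
Proof.
move=> fF gF'; have /allP/(_ _ gF')/allP h := allP ok_compatible _ fF.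
set s := common_shifts f g in h.
exists (head (0, 0) s).1, (head (0, 0) s).2 => u v uf vg uv.
have : (v.1.2 - u.1.2, v.2 - u.2) \in s.
  apply/flattenP; exists [seq (v.1.2 - u.1.2, v.2 - u.2) | v <- g & label u == label v].
    by apply/mapP; exists u.
  by apply/mapP; exists v; rewrite ?mem_filter ?uv ?eqxx.
move=> /h /eqP <-; case: u v {uf vg} uv => [[l m] n] [[l' m'] n'] /=; rewrite /label /= => ->.
by rewrite /shift /= ![_ + (_ - _)]addrC !subrK.
Qed.

Lemma face_edge f u v : f \in F -> u \in f -> v \in f ->
  dot (spatial (label u) - spatial (label v)) (spatial (label u) - spatial (label v)) =
  cdot (pos u - pos v) (pos u - pos v).
Proof.
move=> fF uf vf; have /allP/(_ _ uf)/allP/(_ _ vf) := allP ok_edges _ fF.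
have posB k l : planar (label l) - planar (label k) + period S a b (l.1.2 - k.1.2) (l.2 - k.2) = pos l - pos k.
  by rewrite periodD periodN /pos; ring.
have dotN (k l : 'rV[R]_3) : dot (k - l) (k - l) = dot (l - k) (l - k).
  by rewrite /dot; apply: eq_bigr => i _; rewrite !mxE; ring.
have cdotN (k l : R[i]) : cdot (k - l) (k - l) = cdot (l - k) (l - k).
  by rewrite /cdot !reimE; ring.
case/or3P => [/eqP ->|/edge_length|/edge_length]; last first.
- by rewrite posB.
- by rewrite posB dotN cdotN.
by rewrite !subrr /cdot /dot /= !mul0r addr0 big1 // => i _; rewrite mxE mul0r.
Qed.

Lemma face_positive u v w : [:: u; v; w] \in F -> 0 < line u v w.
Proof. by move=> fF; apply: left_ofP; exact: (allP ok_orientation _ fF). Qed.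

Lemma face_oriented f u v w : f \in F -> [:: u; v; w] \in rots f ->
  0 < ccross (pos v - pos u) (pos w - pos u).
Proof.
move=> fF; have [k [l [m [fE _ _]]]] := good_faceP (allP gF _ fF).
rewrite fE in fF *; have := face_positive fF; rewrite /line => h.
rewrite /rots !inE /= => /or3P[] /eqP[-> -> ->] //; move: h; congr (0 < _);
  by rewrite /ccross !reimE; ring.
Qed.

Lemma shiftK m n : cancel (shift (- m) (- n)) (shift m n).
Proof. by case=> [[l i] j]; rewrite /shift /= !subrK. Qed.

Lemma shift_to u u' : label u' = label u -> shift (u'.1.2 - u.1.2) (u'.2 - u.2) u = u'.
Proof.
case: u u' => [[l i] j] [[l' i'] j']; rewrite /label /shift /= => ->.
by rewrite ![_ + (_ - _)]addrC !subrK.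
Qed.

Lemma face_partner f u v w : f \in F -> [:: u; v; w] \in rots f ->
  exists g m n c, [/\ g \in F, shift m n u \in g, shift m n v \in g, shift m n c \in g &
    ccross (pos v - pos u) (pos c - pos u) < 0].
Proof.
move=> fF tf; have := allP (allP ok_partner _ fF) _ tf.
case/hasP => g gF' /hasP[u' u'g /and3P[/eqP lu vg /hasP[c cg /right_ofP neg]]].
exists g, (u'.1.2 - u.1.2), (u'.2 - u.2), (shift (- (u'.1.2 - u.1.2)) (- (u'.2 - u.2)) c).
by split=> //; rewrite ?shift_to ?shiftK.
Qed.

Section Link.
Variables (v : nat) (a0 a1 a2 : lvertex) (s0 s1 s2 : seq lvertex).
Hypothesis v8 : (v < 8)%N.
Hypothesis ok_link : check_link C v ((a0, s0), (a1, s1), (a2, s2)).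

Lemma left_arcP z s e : left_arc C v z s e -> short_arc S a b planar v z s e.
Proof.
move=> /andP[h1 h2]; apply/andP; split.
  by apply: sub_path h1 => c d; exact: left_ofP.
by apply: sub_all h2 => c; exact: left_ofP.
Qed.

Lemma link_arcs : [&& short_arc S a b planar v a0 s0 a1, short_arc S a b planar v a1 s1 a2 &
  short_arc S a b planar v a2 s2 a0].
Proof. by case/and4P: ok_link => /left_arcP -> /left_arcP -> /left_arcP ->. Qed.

Lemma link_star c : c \in link_pairs a0 a1 a2 s0 s1 s2 -> exists f m n,
  [/\ f \in F, shift m n (center v) \in f, shift m n c.1 \in f & shift m n c.2 \in f].
Proof.
case/and4P: ok_link => _ _ _ /and4P[/allP h _ _ _] /h /hasP[f fF /hasP[u uf /and3P[/eqP lu c1 c2]]].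
exists f, u.1.2, u.2; split=> //.
by have -> : shift u.1.2 u.2 (center v) = u by rewrite /center /shift /= !add0r -lu -!surjective_pairing.
Qed.

Lemma link_angle : cone_angle (face_complex F) (fun w : 'I_8 => spatial w) (Ordinal v8) = 2 * pi.
Proof.
have /and4P[_ _ _ /and4P[_ lu lc lb]] := ok_link.
have io k : (k < 8)%N -> k \in iota 0 8 by rewrite mem_iota.
have complete i j (i8 : (i < 8)%N) (j8 : (j < 8)%N) := eqP (allP (allP lc i (io i i8)) j (io j j8)).
exact: (cone_angle_2pi face_edge v8 link_arcs link_star lu complete lb).
Qed.

Lemma link_adjacent u : label u = v -> forall z s e, {subset arc_pairs z s e <= link_pairs a0 a1 a2 s0 s1 s2} ->
  adjacent F u (shift u.1.2 u.2 z).
Proof.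
move=> lu z s e sub.
have : (z, head e s) \in arc_pairs z s e by case: s {sub} => [|d s]; rewrite mem_head.
move=> /sub/link_star[f [m [n [fF cf zf _]]]].
have twist w : shift (m - u.1.2) (n - u.2) (shift u.1.2 u.2 w) = shift m n w.
  by rewrite /shift /= -!addrA ![u.1.2 + (_ - _)]addrC ![u.2 + (_ - _)]addrC !subrK.
exists f, (m - u.1.2), (n - u.2); split=> //; last by rewrite twist.
have uE : shift u.1.2 u.2 (center v) = u by rewrite /center /shift /= !add0r -lu -!surjective_pairing.
by rewrite -[X in shift _ _ X]uE twist.
Qed.

Lemma link_directions u : label u = v -> exists A B D,
  [/\ adjacent F u A, adjacent F u B, adjacent F u D &
   [/\ 0 < ccross (pos A - pos u) (pos B - pos u), 0 < ccross (pos B - pos u) (pos D - pos u) &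
       0 < ccross (pos D - pos u) (pos A - pos u)]].
Proof.
move=> lu; have uE : shift u.1.2 u.2 (center v) = u by rewrite /center /shift /= !add0r -lu -!surjective_pairing.
have rel w : pos (shift u.1.2 u.2 w) - pos u = direction S a b planar v w.
  by rewrite -[in X in _ - X]uE !pos_shift /direction opprD addrACA subrr addr0.
exists (shift u.1.2 u.2 a0), (shift u.1.2 u.2 a1), (shift u.1.2 u.2 a2).
have /and3P[h0 h1 h2] := link_arcs; split.
- by apply: (link_adjacent lu (s := s0) (e := a1)) => c h; rewrite !mem_cat h.
- by apply: (link_adjacent lu (s := s1) (e := a2)) => c h; rewrite !mem_cat h orbT.
- by apply: (link_adjacent lu (s := s2) (e := a0)) => c h; rewrite !mem_cat h !orbT.
rewrite !rel; split.
- by move: h0 => /andP[_]; rewrite all_rcons => /andP[].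
- by move: h1 => /andP[_]; rewrite all_rcons => /andP[].
- by move: h2 => /andP[_]; rewrite all_rcons => /andP[].
Qed.
End Link.

Lemma vertex_link v : (v < 8)%N -> exists a0 a1 a2 s0 s1 s2,
  check_link C v ((a0, s0), (a1, s1), (a2, s2)).
Proof.
move=> v8; have /andP[/eqP sz /allP h] := ok_links.
have v8' : v \in iota 0 8 by rewrite mem_iota.
have [[[[a0 s0] [a1 s1]] [a2 s2]] _ vl] := @mem_zip_left _ _ (iota 0 8) (links C) v (esym sz) v8'.
by exists a0, a1, a2, s0, s1, s2; exact: h vl.
Qed.

Lemma face_star f u : f \in F -> u \in f -> exists A B D,
  [/\ adjacent F u A, adjacent F u B, adjacent F u D &
   [/\ 0 < ccross (pos A - pos u) (pos B - pos u), 0 < ccross (pos B - pos u) (pos D - pos u) &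
       0 < ccross (pos D - pos u) (pos A - pos u)]].
Proof.
move=> fF uf; have /and3P[_ _ /allP/(_ _ uf) u8] := allP gF _ fF.
have [a0 [a1 [a2 [s0 [s1 [s2 h]]]]]] := vertex_link u8.
exact: (link_directions h).
Qed.

Lemma certified_cover z : exists y, over F S a b planar y z.
Proof.
apply: (plane_cover scale_gt0 height_gt0 gF face_oriented face_partner face_star).
by case/andP: ok_faces.
Qed.

Lemma in_frameP I J t : in_frame I J -> inside J t ->
  z2r R (I.1 - I.2)%ZZ <= t <= z2r R (I.1 + I.2)%ZZ.
Proof.
move=> /andP[/Z.leb_le/(@ler_z2r R) h1 /Z.leb_le/(@ler_z2r R) h2]; rewrite /inside ler_distl -z2rB -z2rD.
by move=> /andP[t1 t2]; rewrite (le_trans h1 t1) (le_trans t2 h2).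
Qed.

Lemma face_frame f w : f \in F -> w \in f ->
  z2r R ((frame_x C).1 - (frame_x C).2)%ZZ <= complex.Re (pos w) <= z2r R ((frame_x C).1 + (frame_x C).2)%ZZ /\
  z2r R ((frame_y C).1 - (frame_y C).2)%ZZ <= complex.Im (pos w) <= z2r R ((frame_y C).1 + (frame_y C).2)%ZZ.
Proof.
move=> fF wf; have /and3P[_ _ /allP/(_ _ wf) w8] := allP gF _ fF.
have /andP[/allP/(_ _ fF)/allP/(_ _ wf)/andP[hx hy] _] := ok_frame.
by split; [exact: in_frameP hx (inside_re w8) | exact: in_frameP hy (inside_im w8)].
Qed.

Lemma face_disjoint f g m n : f \in F -> g \in F -> (`|m| < 3)%N -> (`|n| < 2)%N ->
  [&& f == g, m == 0 & n == 0] \/ separated S a b planar f (map (shift m n) g).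
Proof.
move=> fF gF' m3 n2.
have mm : m \in small_m by move: m3; case: m => [[|[|[|k]]]|[|[|k]]].
have nn : n \in small_n by move: n2; case: n => [[|[|k]]|[|k]].
have good w : w \in f ++ map (shift m n) g -> (label w < 8)%N.
  have /and3P[_ _ /allP f8] := allP gF _ fF; have /and3P[_ _ /allP g8] := allP gF _ gF'.
  by rewrite mem_cat => /orP[/f8 //|/mapP[w' /g8 w8 ->]].
have := allP (allP (allP (allP ok_plane _ fF) _ gF') _ mm) _ nn.
case/orP => [/and3P[m0 n0 fg]|/hasP[[[u pu] [v pv]] uvP /and3P[/= uv /allP hg /allP hf]]]; [by left; rewrite m0 n0 fg|right].
have [ug vg pE] : [/\ (label u < 8)%N, (label v < 8)%N & (pu, pv) = (place C u, place C v)].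
  have sides (k : seq lvertex) c d : (c, d) \in face_sides (place_face C k) ->
      [/\ c.1 \in k, d.1 \in k & (c.2, d.2) = (place C c.1, place C d.1)].
    move=> /(nthP (c, c)) [i il e]; rewrite size_zip size_rot minnn in il.
    have [ci di] : c \in place_face C k /\ d \in place_face C k.
      move: e; rewrite nth_zip ?size_rot // => -[<- <-].
      split; first by rewrite mem_nth.
      by rewrite -(mem_rot 1) mem_nth ?size_rot.
    by case/mapP: ci => c' c'k ->; case/mapP: di => d' d'k ->.
  move: uvP; rewrite mem_cat => /orP[/sides[/= uf vf ->]|/mapP[[c d] /sides[cg dg pE] [du cv]]].
    by split=> //; apply: good; rewrite mem_cat ?uf ?vf.
  move: cg dg pE; rewrite -du -cv /= => vg' ug' [-> ->].
  by split=> //; apply: good; rewrite mem_cat ?vg' ?ug' orbT.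
case: pE hg hf => -> -> hg hf.
exists u, v; split=> // w wl wuv; apply: (@inside_pos _ (iline C u v w)) || apply: (@inside_neg _ (iline C u v w)).
- by apply: inside_line; rewrite ug vg good // mem_cat wl.
- by have := hf (w, place C w) (map_f _ wl); rewrite (negPf wuv).
- by apply: inside_line; rewrite ug vg good // mem_cat wl orbT.
- by have := hg (w, place C w) (map_f _ wl); rewrite (negPf wuv).
Qed.

Lemma certified_dev_inj f g y z m n : f \in F -> g \in F -> simplex f y -> simplex g z ->
  dev S a b planar f y = dev S a b planar g z + period S a b m n -> y = z.
Proof.
have /andP[_ /and4P[_ _ hy hx]] := ok_frame.
(* The remaining goals are the two size conditions on the frame. The lattice height is known only
   through its interval, so its lower end is used. *)
apply: (plane_dev_inj scale_gt0 height_gt0 gF face_frame _ _ face_positive face_disjoint).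
- move/Z.ltb_lt/(@ltr_z2r R): hy; rewrite !z2rM => hy.
  apply: (@lt_le_trans _ _ (2 * z2r R ((height C).1 - (height C).2)%ZZ)).
    apply: le_lt_trans hy; rewrite z2rB z2rD (_ : z2r R 2%ZZ = 2) //.
    by rewrite opprD opprK addrACA subrr add0r mulr_natl mulr2n.
  by rewrite ler_pM2l // height_bound.
- move/Z.ltb_lt/(@ltr_z2r R): hx; rewrite z2rD !z2rM z2r_abs z2rB z2rD.
  rewrite (_ : z2r R 2%ZZ = 2) // (_ : z2r R 3%ZZ = 3) //; apply: le_lt_trans.
  by rewrite lerD2r opprD opprK addrACA subrr add0r mulr_natl mulr2n.
Qed.

Lemma face_space_separated f g : f \in F -> g \in F ->
  space_separated spatial (map label f) (map label g).
Proof.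
move=> fF gF'; have /and3P[/eqP sz /allP szs /allP h] := ok_space.
have [s sP fs] := mem_zip_left (esym sz) fF.
have [[[i j] k] _ gt] := mem_zip_left (esym (eqP (szs _ sP))) gF'.
have /and5P[uijk ijk8 /hasP[l _ hl] /allP hf /allP hg] := allP (h _ fs) _ gt.
exists i, j, k; split=> //.
- exists l; case/orP: hl => /andP[l8 sgn]; have hp := inside_plane ijk8 l8.
    by rewrite gt_eqF // (inside_pos hp sgn).
  by rewrite lt_eqF // (inside_neg hp sgn).
- move=> _ /mapP[w wf ->] /negPf nw; have := hf w wf; rewrite nw => /andP[w8 sgn].
  exact: inside_pos (inside_plane ijk8 w8) sgn.
- move=> _ /mapP[w wf ->] /negPf nw; have := hg w wf; rewrite nw => /andP[w8 sgn].
  exact: inside_neg (inside_plane ijk8 w8) sgn.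
Qed.

Lemma certified_pl_inj f g y z : f \in F -> g \in F -> simplex f y -> simplex g z ->
  pl spatial y = pl spatial z -> y = z.
Proof. exact: (space_pl_inj gF face_space_separated). Qed.

Lemma certified_paper_torus : paper_torus 8 (surface F spatial).
Proof.
exists (face_complex F), (fun v : 'I_8 => spatial v); split=> //.
- split; last first.
    exact: (realization_homeomorphic_torus scale_gt0 height_gt0 gF face_compatible certified_dev_inj certified_cover).
  apply: face_complex_simplicial => // v.
  have [a0 [a1 [a2 [s0 [s1 [s2 h]]]]]] := vertex_link (ltn_ord v).
  have : (a0, head a1 s0) \in link_pairs a0 a1 a2 s0 s1 s2.
    by rewrite mem_cat; apply/orP; left; case: s0 {h} => [|? ?]; exact: mem_head.
  move=> /(link_star h)[f [m [n [fF cf _ _]]]]; apply/hasP; exists f => //.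
  by apply/mapP; exists (shift m n (center v)).
- move=> u v w; apply: (nondegenerate_faces gF face_edge) => {}u {}v {}w uvw.
  by rewrite gt_eqF // face_positive.
- move=> y z /set_mem/(realizationP gF)[f fF sy] /set_mem/(realizationP gF)[g gF' sz]; exact: (certified_pl_inj fF gF' sy sz).
- move=> v; have [a0 [a1 [a2 [s0 [s1 [s2 h]]]]]] := vertex_link (ltn_ord v).
  by rewrite -(link_angle (ltn_ord v) h); congr (cone_angle _ _ _); exact: val_inj.
Qed.

Lemma certified_isometric : intrinsically_isometric (surface F spatial) (lattice S%:C (a +i* b)).
Proof.
exact: (surface_isometric scale_gt0 height_gt0 gF face_compatible certified_dev_inj certified_cover face_edge certified_pl_inj).
Qed.

End Certified.

(** One solution [x] of the edge equations provides both properties of the same surface. *)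
Theorem certified (C : certificate) (R : realType) (b : R) :
  check_newton C -> check_geometry C -> inside (height C) b ->
  exists2 X : set 'rV[R]_3, paper_torus 8 X &
    intrinsically_isometric X (lattice (z2r R (scale C))%:C (z2r R (shear C) +i* b)).
Proof.
move=> newton_ok geometry_ok b_inside.
have [x [x_inside x_zero]] := system_solution b_inside newton_ok.
exists (surface (triangles C) (spatial x)).
  exact: certified_paper_torus x_inside x_zero geometry_ok.
exact: certified_isometric x_inside x_zero geometry_ok.
Qed.

(* Coordinates in units of 10^-7 of the first period; [planes] lists, for each pair
   of faces, three vertices spanning a plane that separates them. *)
Definition square_certificate : certificate := {|
  scale := 10000000%ZZ; shear := 0%ZZ; height := (10000001, 1)%ZZ; radius := 20%ZZ;
  centre :=
  [:: -2734317; -932073; -788487; 2483136; 399709; -2862468; -1510020; -1146755; 2524297;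
  1090438; 1860188; -2062036; -1988598; -2294533; 1399931; 2797571; 968394; 1671372; 7259847;
  -3777311; -1497203; 3074024; 283400; 2281499; 6076799; 2634799; 620848; 1205792; -2489836;
  -2838450; 2728865; 1239069; 1658252; -2516287; -3609855; -2927436; -1398206; -894976;
  -7248126; 1258737]%ZZ;
  edges :=
  [:: (0, 1, Posz 0, Posz 0); (0, 2, Posz 0, Posz 0); (0, 3, Posz 0, Posz 0); (0, 4, Posz 0,
  Negz 0); (0, 5, Posz 0, Posz 0); (1, 2, Posz 0, Posz 0); (1, 3, Posz 0, Posz 0); (1, 4, Posz
  0, Posz 0); (1, 5, Posz 1, Posz 0); (1, 6, Posz 1, Posz 0); (1, 7, Posz 1, Posz 0); (2, 3,
  Negz 0, Posz 1); (2, 4, Posz 0, Posz 0); (2, 5, Posz 0, Posz 0); (2, 6, Posz 0, Posz 1); (2,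
  7, Posz 0, Posz 0); (3, 4, Posz 0, Negz 0); (3, 6, Posz 1, Posz 0); (3, 7, Posz 1, Negz 0);
  (4, 5, Posz 0, Posz 1); (4, 6, Posz 0, Posz 1); (4, 7, Posz 1, Posz 0); (5, 6, Posz 0, Posz
  0); (5, 7, Posz 0, Posz 0)]%N;
  free :=
  [:: 3; 5; 6; 8; 9; 10; 12; 13; 14; 15; 18; 19; 20; 21; 23; 24; 25; 28; 29; 30; 31; 33; 35;
  39]%N;
  inverse :=
  [:: [:: 2278; -592; 490; 15; 52; 534; -413; -469; 205; 5; 15229; 81; 64; 100; -138; 3; -6;
  -51; -73; -54; 5; 424; 754; -215]; [:: 2443; 451; 508; 24; 75; -509; -469; -100; -22; -1;
  -178; 8; 70; -41; -48; 7; -1; 262; -31; -80; 12; 40; 186; 18]; [:: -4776; -504; -77; 134; 365;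
  137; 181; -523; -97; 25; -698; 215; 420; 197; -525; 32; -5; -877; -125; -405; -8; 162; 3053;
  68]; [:: -816; -104; -14; 24; 78; 23; 31; -412; 250; 4; 15661; 30; 92; 43; -98; 7; -5; -147;
  -16; -79; -1; 341; 563; -261]; [:: -3511; 309; 0; -117; -321; 10; -91; 453; 82; -21; 592;
  -178; -366; -154; 446; -28; 4; 691; 107; 355; 4; -138; -2578; -57]; [:: 855; 5; 461; 148; 438;
  124; -444; -116; 390; 7; 3189; -28; 423; -47; -385; 538; 1; 381; -7; -462; 32; -259; 1952;
  -426]; [:: 631; -931; -70; 270; 822; 103; -265; -95; 236; -10; 2772; -658; 738; -375; -555;
  -16; 4; 2457; 404; -870; 117; -565; 2279; -289]; [:: 1627; 204; 29; -57; -153; 443; -57; -383;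
  -104; -8; 12900; -66; -146; -65; 200; -517; -6; 231; 41; 165; -1; 524; -1132; 118]; [:: 60;
  -53; -4; 14; 47; 7; -16; -7; 30; -17; 198; -40; 49; -557; 512; 4; 0; 147; 24; -31; -19; -37;
  -2777; -22]; [:: -77; 85; 466; 55; 364; -12; 145; 13; -47; -94; -195; 944; -50; -50; -892;
  -19; 4; 11018; -11; -393; 449; 25; 1690; 24]; [:: 1669; 82; 28; -109; -33; 434; 23; -375; -49;
  -140; 12749; 914; -554; -207; -499; -63; -3; 14138; -366; 42; 546; 873; -1286; 57]; [:: -596;
  658; 50; -214; -580; -99; 306; 91; -228; -41; -2577; -297; -641; -286; 769; -50; -2; 1635;
  -321; 631; 24; 479; -4572; 280]; [:: -73; -143; 421; 403; 525; -4; 1; 4; -50; 51; -133; 287;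
  176; 69; -413; 10; -513; -3533; -28; -573; -111; 34; 3199; 12]; [:: -144; -327; -80; 644; 210;
  -20; 66; 19; -67; 9; -524; 105; 395; 167; -395; 32; 125; 216; -101; -235; 27; 127; 2055; 50];
  [:: 1710; 33; 25; -101; 10; 446; -118; -387; -32; -19; 12930; 300; -533; -180; 90; -51; 501;
  1520; -350; -6; 52; 845; -908; 36]; [:: 181; 315; -25; 450; -343; 24; -75; -22; 88; -22; 631;
  -189; -389; -162; 474; -30; 8; 738; 114; 380; 5; -147; -2742; -61]; [:: -1; 554; 515; -189;
  -30; -69; -272; 54; 284; 14; -2297; 415; -533; -254; -12; -52; -3; -1277; -279; 591; -47; 422;
  423; 250]; [:: 1835; -660; -24; 40; 624; 533; 44; -458; -254; 7; 15650; 37; 140; 135; -152;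
  10; -6; -184; -20; -128; 0; 345; 864; -260]; [:: 682; -815; -64; 274; 716; 116; -252; -106;
  234; -27; 3163; -622; 767; 369; 42; 75; 4; 2321; 381; -866; 84; -578; -872; -345]; [:: -433;
  402; 491; -55; 84; -44; -314; 36; -182; 515; -1681; 291; -394; -187; 6; -38; 3; -794; -204;
  -90; 498; 309; -499; 183]; [:: 892; -991; -75; 317; 874; 141; -307; -129; 342; -89; 3841;
  -754; 933; 449; 49; 91; 4; 2813; 463; -951; -2; -702; 6988; -420]; [:: 2411; -722; -33; 148;
  675; 541; 21; -469; 235; -465; 15922; -19; 200; 163; -141; 16; 0; 53; 14; -730; 546; 295;
  4415; -290]; [:: -979; 28; 448; 138; 390; -361; -331; 304; 452; 18; -10895; 181; 385; 113;
  -456; 31; 7; -385; -136; -413; 7; -657; 2544; -489]; [:: -121; 666; 55; -217; -579; -107;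
  -223; 87; 302; -39; -3340; -347; -642; -286; 820; -49; -3; 1324; 210; 646; 10; 485; -4755;
  -260]]%ZZ;
  (* [left_inverse] is the Jacobian at the centre in the free coordinates, divided by 1000 and
     rounded; its product with [inverse] is thus close to [10^10 / 10^3] times the identity. *)
  denominator := 10000000000%ZZ; left_denominator := 10000000%ZZ;
  left_inverse :=
  [:: [:: 82; -256; -1156; -82; -1381; 0; 0; 0; 0; 0; 0; 0; 0; 0; 0; 0; 0; 0; 0; 0; 0; 0; 0; 0];
  [:: -9555; 0; 0; 0; 0; 9189; -2400; 9555; -2000; 0; 0; 0; 0; 0; 0; 0; 0; 0; 0; 0; 0; 0; 0; 0];
  [:: 9553; 0; 0; 0; 0; 0; 0; 0; 0; 11064; -9553; 8354; 0; 0; 0; 0; 0; 0; 0; 0; 0; 0; 0; 0]; [::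
  -403; 0; 0; 0; 0; 0; 0; 0; 0; 0; 0; 0; 2474; 8012; 403; 8646; 0; 0; 0; 0; 0; 0; 0; 0]; [::
  -9946; 0; 0; 0; 0; 0; 0; 0; 0; 0; 0; 0; 0; 0; 0; 0; 10738; 9946; 6476; 0; 0; 0; 0; 0]; [:: 0;
  -9445; 1104; -9638; 619; 9445; -1684; 9638; -619; 0; 0; 0; 0; 0; 0; 0; 0; 0; 0; 0; 0; 0; 0;
  0]; [:: 0; -11320; -4957; 9471; -9735; 0; 0; 0; 0; 11320; -9471; 9735; 0; 0; 0; 0; 0; 0; 0; 0;
  0; 0; 0; 0]; [:: 0; -2731; -9168; -486; 9973; 0; 0; 0; 0; 0; 0; 0; 2731; 9168; 486; -9973; 0;
  0; 0; 0; 0; 0; 0; 0]; [:: 0; -10995; -4262; 9972; -7858; 0; 0; 0; 0; 0; 0; 0; 0; 0; 0; 0;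
  10995; -9972; 7858; 0; 0; 0; 0; 0]; [:: 0; -11183; -5498; 9919; -9401; 0; 0; 0; 0; 0; 0; 0; 0;
  0; 0; 0; 0; 0; 0; 11183; 5498; -9919; 0; 0]; [:: 0; 130; -224; 455; 337; 0; 0; 0; 0; 0; 0; 0;
  0; 0; 0; 0; 0; 0; 0; 0; 0; 0; -130; -337]; [:: 0; 0; 0; 0; 0; -1875; -7320; -891; 9646; 1875;
  891; -9646; 0; 0; 0; 0; 0; 0; 0; 0; 0; 0; 0; 0]; [:: 0; 0; 0; 0; 0; 6715; -4544; 9152; 9354;
  0; 0; 0; -6715; 10272; -9152; -9354; 0; 0; 0; 0; 0; 0; 0; 0]; [:: 0; 0; 0; 0; 0; -1549; -6389;
  -391; -8477; 0; 0; 0; 0; 0; 0; 0; 1549; 391; 8477; 0; 0; 0; 0; 0]; [:: 0; 0; 0; 0; 0; -1737;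
  -7294; -444; 9980; 0; 0; 0; 0; 0; 0; 0; 0; 0; 0; 1737; 6602; 444; 0; 0]; [:: 0; 0; 0; 0; 0;
  9575; -2187; -9907; -282; 0; 0; 0; 0; 0; 0; 0; 0; 0; 0; 0; 0; 0; -9575; 282]; [:: 0; 0; 0; 0;
  0; 0; 0; 0; 0; 8590; -9957; -292; -8590; 4211; 9957; 292; 0; 0; 0; 0; 0; 0; 0; 0]; [:: 0; 0;
  0; 0; 0; 0; 0; 0; 0; 137; 448; 335; 0; 0; 0; 0; 0; 0; 0; -137; 541; -448; 0; 0]; [:: 0; 0; 0;
  0; 0; 0; 0; 0; 0; 11450; -9016; -9928; 0; 0; 0; 0; 0; 0; 0; 0; 0; 0; -11450; 9928]; [:: 0; 0;
  0; 0; 0; 0; 0; 0; 0; 0; 0; 0; -8264; 4906; -9543; 2170; 8264; 9543; -2170; 0; 0; 0; 0; 0]; [::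
  0; 0; 0; 0; 0; 0; 0; 0; 0; 0; 0; 0; -8452; 3670; -9596; 627; 0; 0; 0; 8452; -3670; 9596; 0;
  0]; [:: 0; 0; 0; 0; 0; 0; 0; 0; 0; 0; 0; 0; 2860; 8944; 941; -9636; 0; 0; 0; 0; 0; 0; -2860;
  9636]; [:: 0; 0; 0; 0; 0; 0; 0; 0; 0; 0; 0; 0; 0; 0; 0; 0; -188; -53; -1543; 188; 1236; 53; 0;
  0]; [:: 0; 0; 0; 0; 0; 0; 0; 0; 0; 0; 0; 0; 0; 0; 0; 0; 11124; -9517; 8194; 0; 0; 0; -11124;
  -8194]]%ZZ;
  triangles :=
  [:: [:: (0, Posz 0, Posz 0); (1, Posz 0, Posz 0); (2, Posz 0, Posz 0)]; [:: (0, Posz 0, Posz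
  0); (3, Posz 0, Posz 0); (1, Posz 0, Posz 0)]; [:: (0, Posz 0, Posz 0); (2, Posz 0, Posz 0);
  (5, Posz 0, Posz 0)]; [:: (0, Posz 0, Posz 0); (4, Posz 0, Negz 0); (3, Posz 0, Posz 0)]; [::
  (0, Posz 0, Posz 0); (5, Posz 0, Posz 0); (4, Posz 0, Negz 0)]; [:: (1, Posz 0, Posz 0); (4,
  Posz 0, Posz 0); (2, Posz 0, Posz 0)]; [:: (1, Posz 0, Posz 0); (3, Posz 0, Posz 0); (6, Posz
  1, Posz 0)]; [:: (1, Posz 0, Posz 0); (7, Posz 1, Posz 0); (4, Posz 0, Posz 0)]; [:: (1, Posz
  0, Posz 0); (6, Posz 1, Posz 0); (5, Posz 1, Posz 0)]; [:: (1, Posz 0, Posz 0); (5, Posz 1,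
  Posz 0); (7, Posz 1, Posz 0)]; [:: (2, Posz 0, Posz 0); (6, Posz 0, Posz 1); (3, Negz 0, Posz
  1)]; [:: (2, Posz 0, Posz 0); (3, Negz 0, Posz 1); (7, Posz 0, Posz 0)]; [:: (2, Posz 0, Posz
  0); (4, Posz 0, Posz 0); (6, Posz 0, Posz 1)]; [:: (2, Posz 0, Posz 0); (7, Posz 0, Posz 0);
  (5, Posz 0, Posz 0)]; [:: (3, Posz 0, Posz 0); (4, Posz 0, Negz 0); (7, Posz 1, Negz 0)]; [::
  (4, Posz 0, Posz 0); (5, Posz 0, Posz 1); (6, Posz 0, Posz 1)]]%N;
  links :=
  [:: (((1, Posz 0, Posz 0), [::]), ((2, Posz 0, Posz 0), [:: (5, Posz 0, Posz 0); (4, Posz 0,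
  Negz 0)]), ((3, Posz 0, Posz 0), [::])); (((2, Posz 0, Posz 0), [:: (0, Posz 0, Posz 0); (3,
  Posz 0, Posz 0)]), ((6, Posz 1, Posz 0), [:: (5, Posz 1, Posz 0); (7, Posz 1, Posz 0)]), ((4,
  Posz 0, Posz 0), [::])); (((4, Posz 0, Posz 0), [:: (6, Posz 0, Posz 1); (3, Negz 0, Posz
  1)]), ((7, Posz 0, Posz 0), [::]), ((5, Posz 0, Posz 0), [:: (0, Posz 0, Posz 0); (1, Posz 0,
  Posz 0)])); (((1, Posz 0, Posz 0), [:: (0, Posz 0, Posz 0); (4, Posz 0, Negz 0); (7, Posz 1,
  Negz 0)]), ((2, Posz 1, Negz 0), [::]), ((6, Posz 1, Posz 0), [::])); (((3, Posz 0, Posz 1),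
  [::]), ((0, Posz 0, Posz 1), [:: (5, Posz 0, Posz 1); (6, Posz 0, Posz 1)]), ((2, Posz 0, Posz
  0), [:: (1, Posz 0, Posz 0); (7, Posz 1, Posz 0)])); (((0, Posz 0, Posz 0), [:: (2, Posz 0,
  Posz 0); (7, Posz 0, Posz 0)]), ((1, Negz 0, Posz 0), [::]), ((6, Posz 0, Posz 0), [:: (4,
  Posz 0, Negz 0)])); (((1, Negz 0, Posz 0), [:: (3, Negz 0, Posz 0)]), ((2, Posz 0, Negz 0),
  [::]), ((4, Posz 0, Negz 0), [:: (5, Posz 0, Posz 0)])); (((4, Negz 0, Posz 0), [::]), ((1,
  Negz 0, Posz 0), [::]), ((5, Posz 0, Posz 0), [:: (2, Posz 0, Posz 0); (3, Negz 0, Posz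
  1)]))]%N;
  planes :=
  [:: [:: (0, 1, 2); (0, 2, 1); (0, 2, 1); (0, 2, 3); (0, 2, 5); (0, 1, 2); (0, 2, 1); (0, 1,
  4); (0, 2, 1); (1, 5, 2); (0, 2, 3); (1, 3, 2); (2, 6, 4); (1, 5, 2); (0, 4, 3); (0, 4, 5)];
  [:: (0, 1, 2); (0, 1, 3); (0, 1, 3); (0, 1, 3); (0, 1, 3); (0, 1, 3); (0, 1, 3); (0, 1, 4);
  (0, 1, 3); (1, 3, 5); (0, 2, 3); (1, 3, 2); (0, 2, 3); (1, 3, 5); (0, 4, 3); (1, 3, 4)]; [::
  (0, 1, 2); (0, 3, 1); (0, 2, 5); (0, 4, 3); (0, 2, 5); (0, 1, 2); (0, 5, 1); (0, 1, 4); (0, 5,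
  1); (0, 5, 2); (2, 3, 5); (2, 7, 3); (0, 2, 5); (0, 5, 2); (0, 4, 3); (0, 4, 5)]; [:: (0, 3,
  2); (0, 3, 1); (0, 3, 4); (0, 3, 4); (0, 3, 4); (0, 3, 4); (1, 3, 4); (0, 1, 4); (1, 3, 4);
  (0, 3, 5); (2, 3, 4); (0, 3, 2); (2, 3, 4); (0, 7, 3); (0, 4, 3); (0, 3, 4)]; [:: (0, 5, 2);
  (0, 3, 1); (0, 5, 2); (0, 4, 3); (0, 4, 5); (0, 5, 4); (0, 5, 1); (0, 1, 4); (0, 5, 1); (0, 5,
  1); (2, 3, 6); (2, 7, 3); (2, 5, 4); (0, 5, 2); (0, 4, 3); (0, 4, 5)]; [:: (0, 2, 1); (0, 3,
  1); (0, 2, 1); (0, 4, 3); (0, 4, 5); (1, 2, 4); (1, 4, 2); (1, 4, 2); (1, 4, 2); (1, 4, 5);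
  (1, 4, 2); (1, 4, 2); (1, 4, 2); (1, 4, 2); (1, 4, 3); (1, 4, 2)]; [:: (0, 1, 2); (0, 3, 1);
  (0, 1, 5); (1, 4, 3); (0, 1, 5); (1, 2, 4); (1, 3, 6); (1, 4, 7); (1, 3, 6); (1, 3, 5); (1, 3,
  6); (1, 3, 2); (1, 2, 6); (1, 3, 5); (1, 4, 3); (1, 6, 4)]; [:: (0, 4, 1); (0, 4, 1); (0, 4,
  1); (0, 4, 1); (0, 4, 1); (1, 2, 4); (1, 7, 4); (1, 4, 7); (1, 6, 4); (1, 7, 4); (1, 7, 4);
  (1, 7, 4); (2, 6, 4); (1, 7, 4); (1, 7, 4); (4, 5, 6)]; [:: (0, 1, 2); (0, 3, 1); (0, 1, 5);
  (1, 4, 3); (0, 1, 5); (1, 2, 4); (1, 6, 3); (1, 4, 6); (1, 5, 6); (1, 6, 5); (2, 3, 6); (2, 7,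
  3); (1, 2, 6); (1, 5, 2); (1, 4, 3); (1, 5, 6)]; [:: (1, 2, 5); (1, 5, 3); (0, 2, 5); (0, 5,
  3); (0, 1, 5); (1, 5, 4); (1, 5, 3); (1, 4, 7); (1, 5, 6); (1, 5, 7); (2, 3, 5); (2, 7, 3);
  (2, 5, 4); (1, 7, 5); (3, 7, 4); (4, 5, 6)]; [:: (0, 3, 2); (0, 3, 2); (2, 5, 3); (2, 4, 3);
  (2, 6, 3); (1, 2, 4); (1, 6, 3); (1, 4, 7); (2, 6, 3); (2, 5, 3); (2, 3, 6); (2, 6, 3); (2, 6,
  3); (2, 5, 3); (2, 4, 3); (2, 6, 3)]; [:: (1, 2, 3); (1, 2, 3); (2, 3, 7); (0, 2, 3); (2, 3,
  7); (1, 2, 4); (1, 2, 3); (1, 4, 7); (2, 3, 7); (2, 3, 7); (2, 3, 6); (2, 3, 7); (2, 3, 7);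
  (2, 3, 7); (2, 3, 7); (2, 3, 7)]; [:: (2, 4, 6); (0, 3, 2); (0, 5, 2); (2, 4, 3); (2, 4, 5);
  (1, 2, 4); (1, 6, 2); (2, 4, 6); (1, 6, 2); (2, 4, 5); (2, 3, 6); (2, 7, 3); (2, 4, 6); (2, 7,
  5); (2, 4, 3); (2, 4, 6)]; [:: (1, 2, 5); (1, 5, 3); (0, 2, 5); (0, 3, 7); (0, 2, 5); (1, 2,
  4); (1, 5, 3); (1, 4, 7); (1, 2, 5); (1, 5, 7); (2, 3, 5); (2, 7, 3); (2, 5, 7); (2, 5, 7);
  (3, 7, 4); (4, 5, 7)]; [:: (0, 3, 4); (0, 3, 4); (0, 3, 4); (0, 3, 4); (0, 3, 4); (1, 3, 4);
  (1, 3, 4); (1, 4, 7); (1, 3, 4); (3, 4, 7); (2, 3, 4); (2, 7, 3); (2, 3, 4); (3, 4, 7); (3, 4,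
  7); (3, 4, 7)]; [:: (0, 5, 4); (1, 4, 3); (0, 5, 4); (0, 4, 3); (0, 5, 4); (1, 2, 4); (1, 4,
  6); (4, 6, 5); (1, 6, 5); (4, 6, 5); (2, 3, 6); (2, 7, 3); (2, 6, 4); (4, 7, 5); (3, 7, 4);
  (4, 5, 6)]]%N;
  frame_x := (131019, 7380147)%ZZ; frame_y := (-789857, 7952408)%ZZ |}.

(** The shear is half the scale, for real part one half. The height interval starts at 8660254, the
    integer part of [10^7 * sqrt 3 / 2]. *)
Definition hexagonal_certificate : certificate := {|
  scale := 10000000%ZZ; shear := 5000000%ZZ; height := (8660255, 1)%ZZ; radius := 20%ZZ;
  centre :=
  [:: 397073; 1942022; 798926; -20403; -378544; -838846; -2546579; 330405; 2522307; 3549453;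
  2066588; 1448411; 419774; -1476654; 648111; -2131483; -785467; 770625; 3226730; 1435214;
  2013939; -1725978; -2343801; -1255000; 4851411; -1809787; -1156844; 654638; -1142981;
  -4016379; -538259; 582747; -1306058; 938446; -6054748; 840777; 2241689; 675489; -2792447;
  -34518]%ZZ;
  edges :=
  [:: (0, 1, Posz 0, Posz 0); (0, 2, Posz 0, Posz 0); (0, 3, Posz 0, Posz 0); (0, 4, Posz 1,
  Negz 0); (0, 5, Posz 0, Posz 0); (1, 2, Posz 0, Posz 0); (1, 3, Posz 0, Posz 0); (1, 4, Posz
  0, Posz 0); (1, 5, Posz 0, Posz 1); (1, 6, Posz 0, Posz 1); (1, 7, Posz 0, Posz 1); (2, 4,
  Posz 0, Posz 0); (2, 5, Posz 0, Posz 0); (2, 6, Negz 0, Posz 1); (2, 7, Posz 0, Posz 0); (3,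
  4, Posz 1, Negz 0); (3, 6, Posz 0, Posz 1); (3, 7, Posz 1, Posz 0); (4, 5, Negz 0, Posz 1);
  (4, 6, Negz 0, Posz 1); (4, 7, Posz 0, Posz 1); (5, 6, Posz 0, Posz 0); (5, 7, Posz 0, Posz
  0); (6, 7, Posz 1, Negz 0)]%N;
  free :=
  [:: 1; 4; 6; 8; 9; 10; 11; 13; 14; 15; 16; 18; 19; 22; 23; 24; 25; 28; 29; 32; 33; 35; 36;
  39]%N;
  inverse :=
  [:: [:: 496; 683; -8; 283; 457; -370; 40; -338; 105; -472; 165; 490; 65; -51; -171; -20; -90;
  65; -326; -299; 3; 408; -239; -31]; [:: 462; 545; 27; -300; -425; -296; -142; -304; 149; -358;
  109; 368; 52; -11; -198; 70; 322; -231; 458; -839; 6; -789; -59; 309]; [:: -96; 468; 2; 137;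
  -100; -253; -11; -329; -328; -618; -183; 413; 44; -132; 88; 6; 25; -18; -195; -262; 48; 465;
  198; 1]; [:: -71; 560; -22; -148; 209; -304; 117; -390; 295; 479; -55; 218; 54; 187; -621;
  -57; -264; 189; 39; -5; 321; -244; -300; -44]; [:: -88; 429; 31; -37; 77; -233; -159; -63;
  454; -502; 542; 314; 41; -40; -91; 78; 360; -259; 283; -878; -253; -696; -364; 300]; [:: -244;
  1360; -37; 278; -160; 116; 190; 163; -164; 157; -21; 81; -5; 598; 695; -93; -430; 309; 6;
  -471; -257; 85; 151; -531]; [:: 185; -1119; -11; 172; -284; -33; 56; -577; -301; -406; 285;
  614; 829; -142; -746; -28; -127; 91; -318; -251; 200; 374; -587; 91]; [:: -194; 1169; 30;
  -277; 396; 330; -158; -178; 325; -56; -62; -65; -227; -490; -610; 77; 356; -256; 12; 429; 266;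
  -128; -72; 451]; [:: -61; 412; 12; -186; 232; 198; -65; -177; 539; -213; -71; 348; -647; 309;
  344; 32; 146; -105; 482; -1020; -129; -816; 251; 27]; [:: 210; -50; -408; 225; -203; 27;
  -1011; 65; -84; 486; -152; -97; -4; 81; -149; -368; -559; -83; 106; -165; 128; -110; 106;
  136]; [:: 269; 652; -695; -42; 168; -353; 694; -344; -219; -622; 316; 673; 61; -304; 375; 548;
  -282; -324; -339; -409; -355; 613; 47; 253]; [:: 354; 284; -705; -199; 299; -154; -319; -238;
  254; -212; 20; 124; 27; 79; -281; 146; 483; 276; -59; 194; 147; -65; -265; -234]; [:: -123;
  153; 135; 232; -241; -83; 855; 40; 298; -432; 59; 8; 15; 117; -308; -531; 524; -26; 435; -790;
  103; -827; -162; 110]; [:: 84; -289; 2; -367; 357; 157; -11; -677; 41; -496; 223; -143; -28;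
  -59; 242; 5; 25; -18; -257; -227; -216; 371; -78; -51]; [:: 1; 247; -29; -299; 339; -134; 151;
  338; 196; 98; -124; 0; 25; 203; -528; -74; -342; 246; -138; -275; 321; 88; -232; -130]; [::
  10; -178; 6; 190; -216; 96; -29; -192; 290; -200; 0; -287; -16; 212; -374; 14; 65; -47; 419;
  -1029; 158; -788; -130; 153]; [:: -64; 226; -3; 276; -267; -123; 16; -12; -1647; 467; 332; 89;
  22; 74; -248; -8; -35; 25; -372; 197; -48; -343; -390; 30]; [:: 3; 238; -32; -288; 327; -130;
  165; -95; -1029; 138; 269; -31; 24; 234; -589; -81; -373; 268; 437; -288; 160; 72; -595;
  -148]; [:: 0; 27; 42; -285; 297; -15; -218; 6; -622; 285; 86; 14; 3; 5; -22; 107; 493; -354;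
  375; -376; -75; -1366; 92; 399]; [:: 4; 132; -82; 184; -173; -71; 427; -49; 251; -316; 40;
  321; 11; -293; 562; -210; -966; 694; 342; -1118; -182; -659; -142; -928]; [:: 39; -51; 6;
  -351; 362; 27; -34; -48; 350; -128; -56; -401; -2; 460; -946; 17; 76; -55; -24; 1013; 434;
  -162; -313; 316]; [:: -92; 483; -85; 569; -542; -263; 440; 527; -512; 315; -4; -69; 48; 483;
  -1211; -216; -996; 716; 29; -737; -549; 232; 415; -252]; [:: 36; -154; -14; -13; 1; 85; 74;
  -467; -183; -315; 208; 370; -18; -589; 1301; -37; -168; 121; -140; -42; 281; 321; 141; 610];
  [:: 10; -32; -12; 18; -21; 18; 60; 5; 403; -142; -72; 237; -5; -323; 692; -29; -136; 98; 341;
  -914; -235; -739; -261; 794]]%ZZ;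
  denominator := 10000000000%ZZ; left_denominator := 10000000%ZZ;
  left_inverse :=
  [:: [:: 8977; 7856; -8977; -5085; -7856; 0; 0; 0; 0; 0; 0; 0; 0; 0; 0; 0; 0; 0; 0; 0; 0; 0; 0;
  0]; [:: 987; 2053; 0; 0; 0; 3339; -987; 2913; -2053; 0; 0; 0; 0; 0; 0; 0; 0; 0; 0; 0; 0; 0; 0;
  0]; [:: 5455; 3628; 0; 0; 0; 0; 0; 0; 0; -5057; -5455; -6494; -3628; 0; 0; 0; 0; 0; 0; 0; 0;
  0; 0; 0]; [:: 7336; -6861; 0; 0; 0; 0; 0; 0; 0; 0; 0; 0; 0; -6285; -7531; 6861; 0; 0; 0; 0; 0;
  0; 0; 0]; [:: 6198; -7276; 0; 0; 0; 0; 0; 0; 0; 0; 0; 0; 0; 0; 0; 0; -4414; 2245; 7276; 0; 0;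
  0; 0; 0]; [:: 0; 0; -7990; -7998; -5803; 5811; 7990; 7998; 5803; 0; 0; 0; 0; 0; 0; 0; 0; 0; 0;
  0; 0; 0; 0; 0]; [:: 0; 0; -3522; 1409; -4228; 0; 0; 0; 0; -2585; 3522; -1409; 4228; 0; 0; 0;
  0; 0; 0; 0; 0; 0; 0; 0]; [:: 0; 0; -1641; -7555; 2604; 0; 0; 0; 0; 0; 0; 0; 0; -5348; 7555;
  -2604; 0; 0; 0; 0; 0; 0; 0; 0]; [:: 0; 0; -2779; 2669; 2189; 0; 0; 0; 0; 0; 0; 0; 0; 0; 0; 0;
  -1942; -2669; -2189; 0; 0; 0; 0; 0]; [:: 0; 0; -6259; 6832; -1888; 0; 0; 0; 0; 0; 0; 0; 0; 0;
  0; 0; 0; 0; 0; -3273; -6832; 0; 0; 0]; [:: 0; 0; -9577; -630; 10153; 0; 0; 0; 0; 0; 0; 0; 0;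
  0; 0; 0; 0; 0; 0; 0; 0; 3359; 9577; -10153]; [:: 0; 0; 0; 0; 0; 105; 6349; 443; 8407; 0; 0; 0;
  0; -5527; -443; -8407; 0; 0; 0; 0; 0; 0; 0; 0]; [:: 0; 0; 0; 0; 0; 7753; 5211; 667; -9329; 0;
  0; 0; 0; 0; 0; 0; -7753; -667; 9329; 0; 0; 0; 0; 0]; [:: 0; 0; 0; 0; 0; 5210; 1731; -5170;
  3915; 0; 0; 0; 0; 0; 0; 0; 0; 0; 0; -3452; 5170; 0; 0; 0]; [:: 0; 0; 0; 0; 0; 2452; -1587;
  -2632; -1365; 0; 0; 0; 0; 0; 0; 0; 0; 0; 0; 0; 0; -2452; 1587; 1365]; [:: 0; 0; 0; 0; 0; 0; 0;
  0; 0; -8291; 1881; 1037; -10488; -6229; -1037; 10488; 0; 0; 0; 0; 0; 0; 0; 0]; [:: 0; 0; 0; 0;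
  0; 0; 0; 0; 0; -3186; -2736; 5423; 2341; 0; 0; 0; 0; 0; 0; -4153; -5423; 0; 0; 0]; [:: 0; 0;
  0; 0; 0; 0; 0; 0; 0; -5945; -6054; 7962; -2939; 0; 0; 0; 0; 0; 0; 0; 0; 5945; 6054; 2939]; [::
  0; 0; 0; 0; 0; 0; 0; 0; 0; 0; 0; 0; 0; -5997; -9776; -415; -7647; 9776; 415; 0; 0; 0; 0; 0];
  [:: 0; 0; 0; 0; 0; 0; 0; 0; 0; 0; 0; 0; 0; -2075; -5613; -4492; 0; 0; 0; 2075; 5613; 0; 0; 0];
  [:: 0; 0; 0; 0; 0; 0; 0; 0; 0; 0; 0; 0; 0; -6039; 6925; 7549; 0; 0; 0; 0; 0; -2346; 7935;
  -7549]; [:: 0; 0; 0; 0; 0; 0; 0; 0; 0; 0; 0; 0; 0; 0; 0; 0; -2543; 4163; -4077; -3921; -4163;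
  0; 0; 0]; [:: 0; 0; 0; 0; 0; 0; 0; 0; 0; 0; 0; 0; 0; 0; 0; 0; -5301; -3299; 7964; 0; 0; 5301;
  6797; -7964]; [:: 0; 0; 0; 0; 0; 0; 0; 0; 0; 0; 0; 0; 0; 0; 0; 0; 0; 0; 0; -3963; 2538; 2758;
  3318; 5280]]%ZZ;
  triangles :=
  [:: [:: (0, Posz 0, Posz 0); (1, Posz 0, Posz 0); (2, Posz 0, Posz 0)]; [:: (0, Posz 0, Posz
  0); (3, Posz 0, Posz 0); (1, Posz 0, Posz 0)]; [:: (0, Posz 0, Posz 0); (2, Posz 0, Posz 0);
  (5, Posz 0, Posz 0)]; [:: (0, Posz 0, Posz 0); (4, Posz 1, Negz 0); (3, Posz 0, Posz 0)]; [::
  (0, Posz 0, Posz 0); (5, Posz 0, Posz 0); (4, Posz 1, Negz 0)]; [:: (1, Posz 0, Posz 0); (4,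
  Posz 0, Posz 0); (2, Posz 0, Posz 0)]; [:: (1, Posz 0, Posz 0); (3, Posz 0, Posz 0); (6, Posz
  0, Posz 1)]; [:: (1, Posz 0, Posz 0); (7, Posz 0, Posz 1); (4, Posz 0, Posz 0)]; [:: (1, Posz
  0, Posz 0); (6, Posz 0, Posz 1); (5, Posz 0, Posz 1)]; [:: (1, Posz 0, Posz 0); (5, Posz 0,
  Posz 1); (7, Posz 0, Posz 1)]; [:: (2, Posz 0, Posz 0); (4, Posz 0, Posz 0); (6, Negz 0, Posz
  1)]; [:: (2, Posz 0, Posz 0); (7, Posz 0, Posz 0); (5, Posz 0, Posz 0)]; [:: (2, Posz 0, Posz
  0); (6, Negz 0, Posz 1); (7, Posz 0, Posz 0)]; [:: (3, Posz 0, Posz 0); (4, Posz 1, Negz 0);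
  (7, Posz 1, Posz 0)]; [:: (3, Posz 0, Posz 0); (7, Posz 1, Posz 0); (6, Posz 0, Posz 1)]; [::
  (4, Posz 0, Posz 0); (5, Negz 0, Posz 1); (6, Negz 0, Posz 1)]]%N;
  links :=
  [:: (((2, Posz 0, Posz 0), [::]), ((5, Posz 0, Posz 0), [:: (4, Posz 1, Negz 0)]), ((3, Posz
  0, Posz 0), [:: (1, Posz 0, Posz 0)])); (((2, Posz 0, Posz 0), [:: (0, Posz 0, Posz 0); (3,
  Posz 0, Posz 0)]), ((6, Posz 0, Posz 1), [:: (5, Posz 0, Posz 1)]), ((7, Posz 0, Posz 1), [::
  (4, Posz 0, Posz 0)])); (((1, Posz 0, Posz 0), [:: (4, Posz 0, Posz 0)]), ((6, Negz 0, Posz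
  1), [:: (7, Posz 0, Posz 0)]), ((5, Posz 0, Posz 0), [:: (0, Posz 0, Posz 0)])); (((1, Posz 0,
  Posz 0), [::]), ((0, Posz 0, Posz 0), [:: (4, Posz 1, Negz 0)]), ((7, Posz 1, Posz 0), [:: (6,
  Posz 0, Posz 1)])); (((0, Negz 0, Posz 1), [:: (5, Negz 0, Posz 1); (6, Negz 0, Posz 1)]),
  ((2, Posz 0, Posz 0), [:: (1, Posz 0, Posz 0)]), ((7, Posz 0, Posz 1), [:: (3, Negz 0, Posz
  1)])); (((2, Posz 0, Posz 0), [:: (7, Posz 0, Posz 0)]), ((1, Posz 0, Negz 0), [::]), ((6,
  Posz 0, Posz 0), [:: (4, Posz 1, Negz 0); (0, Posz 0, Posz 0)])); (((1, Posz 0, Negz 0), [::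
  (3, Posz 0, Negz 0)]), ((7, Posz 1, Negz 0), [:: (2, Posz 1, Negz 0)]), ((4, Posz 1, Negz 0),
  [:: (5, Posz 0, Posz 0)])); (((1, Posz 0, Negz 0), [:: (5, Posz 0, Posz 0)]), ((2, Posz 0,
  Posz 0), [::]), ((6, Negz 0, Posz 1), [:: (3, Negz 0, Posz 0); (4, Posz 0, Negz 0)]))]%N;
  planes :=
  [:: [:: (0, 1, 2); (0, 1, 2); (0, 1, 2); (0, 1, 4); (0, 1, 4); (0, 1, 2); (0, 1, 6); (0, 1,
  2); (0, 1, 6); (0, 1, 7); (0, 1, 2); (0, 1, 2); (0, 6, 2); (0, 1, 7); (0, 1, 7); (0, 1, 4)];
  [:: (0, 2, 1); (0, 1, 3); (0, 3, 1); (0, 3, 1); (0, 3, 1); (0, 4, 1); (0, 3, 1); (0, 4, 1);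
  (0, 3, 1); (1, 7, 3); (1, 2, 6); (1, 2, 3); (0, 6, 1); (0, 3, 1); (0, 3, 1); (0, 3, 1)]; [::
  (0, 2, 1); (0, 1, 3); (0, 2, 5); (0, 3, 4); (0, 5, 2); (1, 2, 4); (1, 5, 3); (1, 2, 5); (2, 6,
  5); (1, 2, 5); (0, 5, 2); (0, 5, 2); (0, 6, 2); (0, 3, 4); (0, 3, 7); (4, 6, 5)]; [:: (0, 4,
  1); (0, 1, 3); (0, 4, 3); (0, 3, 4); (0, 4, 3); (0, 4, 1); (1, 4, 3); (0, 4, 1); (3, 4, 6);
  (0, 4, 5); (0, 4, 2); (0, 4, 5); (0, 6, 4); (0, 3, 4); (0, 3, 4); (3, 5, 4)]; [:: (0, 4, 1);
  (0, 1, 3); (0, 2, 5); (0, 3, 4); (0, 4, 5); (1, 2, 4); (1, 4, 3); (0, 4, 1); (1, 4, 5); (0, 4,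
  5); (0, 4, 2); (0, 4, 5); (0, 6, 4); (0, 3, 4); (0, 3, 4); (0, 5, 4)]; [:: (0, 2, 1); (0, 1,
  4); (1, 4, 2); (0, 1, 4); (1, 4, 2); (1, 2, 4); (1, 4, 2); (1, 4, 2); (1, 4, 2); (1, 4, 2);
  (1, 4, 2); (1, 4, 2); (1, 4, 2); (1, 4, 2); (1, 4, 2); (1, 4, 2)]; [:: (0, 6, 1); (0, 1, 3);
  (1, 3, 5); (1, 3, 4); (1, 3, 4); (1, 2, 4); (1, 3, 6); (1, 7, 4); (1, 3, 6); (1, 3, 5); (2, 6,
  4); (1, 3, 5); (1, 3, 6); (1, 3, 4); (1, 3, 6); (1, 3, 6)]; [:: (0, 2, 1); (0, 1, 4); (1, 5,
  2); (0, 1, 4); (0, 1, 4); (1, 2, 4); (1, 4, 7); (1, 4, 7); (1, 4, 7); (1, 4, 7); (2, 6, 4);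
  (1, 7, 2); (2, 7, 4); (1, 4, 7); (1, 4, 7); (1, 4, 7)]; [:: (0, 6, 1); (0, 1, 3); (2, 5, 6);
  (3, 6, 4); (1, 5, 4); (1, 2, 4); (1, 6, 3); (1, 7, 4); (1, 5, 6); (1, 5, 6); (2, 6, 4); (1, 5,
  6); (1, 5, 6); (3, 6, 4); (3, 6, 7); (1, 5, 6)]; [:: (0, 7, 1); (1, 3, 7); (1, 5, 2); (0, 5,
  4); (0, 5, 4); (1, 2, 4); (1, 5, 3); (1, 7, 4); (1, 6, 5); (1, 5, 7); (1, 2, 6); (1, 5, 7);
  (1, 7, 6); (3, 4, 7); (3, 6, 7); (4, 7, 5)]; [:: (0, 2, 1); (1, 6, 2); (0, 2, 5); (0, 2, 4);
  (0, 2, 4); (1, 2, 4); (2, 4, 6); (2, 4, 6); (2, 4, 6); (1, 6, 2); (2, 4, 6); (2, 5, 6); (2, 4,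
  6); (2, 4, 6); (2, 3, 6); (2, 4, 6)]; [:: (0, 2, 1); (1, 3, 2); (0, 2, 5); (0, 5, 4); (0, 5,
  4); (1, 2, 4); (1, 5, 3); (1, 2, 7); (1, 6, 5); (1, 7, 5); (2, 6, 5); (2, 5, 7); (2, 7, 5);
  (3, 4, 7); (3, 6, 7); (4, 6, 5)]; [:: (0, 2, 6); (0, 1, 6); (0, 2, 6); (0, 4, 6); (0, 4, 6);
  (1, 2, 4); (1, 6, 3); (2, 4, 7); (1, 6, 5); (1, 6, 7); (2, 6, 4); (2, 5, 7); (2, 6, 7); (2, 4,
  7); (2, 6, 7); (4, 6, 5)]; [:: (0, 7, 1); (0, 1, 3); (0, 4, 3); (0, 4, 3); (0, 4, 3); (1, 2,
  4); (1, 4, 3); (1, 7, 4); (3, 4, 6); (3, 7, 4); (2, 6, 4); (3, 7, 4); (2, 7, 4); (3, 4, 7);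
  (3, 4, 7); (3, 5, 4)]; [:: (0, 7, 1); (0, 1, 3); (0, 7, 3); (0, 4, 3); (0, 4, 3); (1, 2, 4);
  (1, 6, 3); (1, 7, 4); (3, 7, 6); (3, 7, 6); (2, 6, 3); (3, 7, 6); (2, 7, 6); (3, 7, 4); (3, 6,
  7); (3, 7, 6)]; [:: (0, 4, 1); (0, 1, 3); (4, 5, 6); (3, 4, 5); (0, 4, 5); (1, 2, 4); (1, 6,
  3); (1, 7, 4); (1, 6, 5); (4, 5, 7); (2, 6, 4); (4, 5, 6); (4, 5, 6); (3, 4, 5); (3, 6, 7);
  (4, 5, 6)]]%N;
  frame_x := (532286, 6676269)%ZZ; frame_y := (2304678, 6322059)%ZZ |}.

Lemma square_newton : check_newton square_certificate. Proof. by vm_cast_no_check (erefl true). Qed.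
Lemma square_geometry : check_geometry square_certificate. Proof. by vm_cast_no_check (erefl true). Qed.
Lemma hexagonal_newton : check_newton hexagonal_certificate. Proof. by vm_cast_no_check (erefl true). Qed.
Lemma hexagonal_geometry : check_geometry hexagonal_certificate. Proof. by vm_cast_no_check (erefl true). Qed.

(** * From certificates to reduced moduli *)

Lemma complex_div_real (R : realType) (s u v : R) : s != 0 -> (u +i* v) / s%:C = (u / s) +i* (v / s).
Proof.
move=> s0; have sC : s%:C != 0 by apply: contraNneq s0 => /(congr1 (@complex.Re R)) /= ->.
apply: (mulIf sC); rewrite divfK //; apply: complex_ext; rewrite /= ?mulr0 ?subr0 ?add0r ?divfK //.
Qed.

(** The identity matrix shows membership in the orbit, and the nonnegative real part settles the
    choice among several representatives. *)
Lemma reduced_modulus_refl (R : realType) (tau : R[i]) :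
  modular_domain tau -> 0 <= complex.Re tau -> reduced_modulus tau tau.
Proof.
move=> dom re; split=> //; exists 1, 0, 0, 1; split=> //.
by rewrite mul1r mul0r add0r addr0 divr1.
Qed.

(** The lattice is spanned by [S] and [S * tau] with [S] the scale, which passes from moduli to the
    integer units of the certificate. *)
Lemma realizes_domain (R : realType) (C : certificate) (tau : R[i]) :
  check_newton C -> check_geometry C -> 0 < z2r R (scale C) ->
  modular_domain tau -> 0 <= complex.Re tau ->
  z2r R (shear C) = z2r R (scale C) * complex.Re tau ->
  inside (height C) (z2r R (scale C) * complex.Im tau) ->
  exists X : set 'rV[R]_3, paper_torus 8 X /\ realizes X tau.
Proof.
move=> newton geometry S0 dom re shearE hb.
have [X XP iso] := certified newton geometry hb; exists X; split=> //.
have S1 : z2r R (scale C) != 0 by rewrite gt_eqF.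
exists (z2r R (scale C))%:C, (z2r R (shear C) +i* (z2r R (scale C) * complex.Im tau)).
have -> : (z2r R (shear C) +i* (z2r R (scale C) * complex.Im tau)) / (z2r R (scale C))%:C = tau.
  rewrite complex_div_real // shearE ![z2r R _ * _]mulrC !mulfK //.
  exact: complex_ext.
split=> //; first by apply: contraNneq S1 => /(congr1 (@complex.Re R)) /= ->.
  by case: dom.
exact: reduced_modulus_refl.
Qed.

Lemma rectangular_domain (R : realType) (Y : R) : 1 <= Y -> modular_domain (0 +i* Y).
Proof.
move=> Y1; split=> /=; first exact: lt_le_trans Y1.
  by rewrite -[leLHS]sqrtr1 ler_sqrt ?expr0n /= ?add0r; nra.
by rewrite normr0 invr_ge0.
Qed.

Lemma rhombic_domain (R : realType) (H : R) : Num.sqrt 3 / 2 <= H -> modular_domain (2^-1 +i* H).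
Proof.
move=> H1; have s0 : 0 <= Num.sqrt 3 :> R by rewrite sqrtr_ge0.
have s3 : Num.sqrt 3 ^+ 2 = 3 :> R by rewrite sqr_sqrtr.
split=> /=; first by nra.
  by rewrite -[leLHS]sqrtr1 ler_sqrt; nra.
by rewrite ger0_norm // invr_ge0.
Qed.

Lemma scaled_bounds (R : realType) (s t u : R) : 0 < s -> t <= u < t + s^-1 ->
  s * t <= s * u /\ s * u < s * t + 1.
Proof.
move=> s0 /andP[tu ut]; rewrite ler_pM2l //; split=> //.
by move: ut; rewrite -(ltr_pM2l s0) mulrDr divff // gt_eqF.
Qed.

(** Radius 1 around [lo + 1] covers two units above [lo]: one for the range of moduli, one for
    replacing an irrational height by its integer part. *)
Lemma inside_unit (R : realType) (I : interval) (lo x : R) :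
  z2r R I.1 = lo + 1 -> I.2 = 1%ZZ -> lo <= x -> x <= lo + 1 + 1 -> inside I x.
Proof. by rewrite /inside ler_distl => -> ->; rewrite z2r1 => *; lra. Qed.

(** Squaring reduces both comparisons with the irrational number to comparisons of integers. *)
Lemma sqrt3_bounds (R : realType) (s B : Z) : (0 <= s)%ZZ -> (0 <= B)%ZZ ->
  (2 * B * (2 * B) <= 3 * (s * s))%ZZ -> (3 * (s * s) <= 2 * (B + 1) * (2 * (B + 1)))%ZZ ->
  z2r R B <= z2r R s * (Num.sqrt 3 / 2) <= z2r R B + 1.
Proof.
move=> /(@ler_z2r R) s0 /(@ler_z2r R) B0 /(@ler_z2r R) lo /(@ler_z2r R) hi.
rewrite z2r0 in s0 B0; rewrite !(z2rM, z2rD) z2r1 in lo hi.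
have two : z2r R 2%ZZ = 2 by []. have three : z2r R 3%ZZ = 3 by [].
rewrite two three in lo hi.
have r0 : 0 <= Num.sqrt 3 :> R by rewrite sqrtr_ge0.
have r3 : Num.sqrt 3 ^+ 2 = 3 :> R by rewrite sqr_sqrtr.
have sr : (z2r R s * Num.sqrt 3) ^+ 2 = 3 * (z2r R s * z2r R s) by rewrite exprMn r3 expr2 mulrC.
have lo' : 2 * z2r R B <= z2r R s * Num.sqrt 3.
  by rewrite -(ler_pXn2r (n := 2)) ?nnegrE ?mulr_ge0 // sr expr2.
have hi' : z2r R s * Num.sqrt 3 <= 2 * (z2r R B + 1).
  by rewrite -(ler_pXn2r (n := 2)) ?nnegrE ?mulr_ge0 ?addr_ge0 // sr expr2.
by rewrite mulrA ler_pdivlMr // ler_pdivrMr // [_ * 2]mulrC lo' [_ * 2]mulrC hi'.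
Qed.

Theorem corollary1 (R : realType) :
  exists eps : R, 0 < eps /\
    (forall Y : R, 1 <= Y < 1 + eps ->
       exists X : set 'rV[R]_3, paper_torus 8 X /\ realizes X (0 +i* Y)) /\
    (forall H : R, Num.sqrt 3 / 2 <= H < Num.sqrt 3 / 2 + eps ->
       exists X : set 'rV[R]_3, paper_torus 8 X /\ realizes X (2^-1 +i* H)).
Proof.
(* Both certificates have the same scale, so [S^-1], one unit of height, serves as [eps] for both
   families. *)
pose S := z2r R (scale square_certificate).
have S0 : 0 < S by rewrite -z2r0; apply: ltr_z2r.
exists S^-1; split; first by rewrite invr_gt0.
split=> [Y hY|H hH].
  have /andP[Y1 _] := hY; have [lo hi] := scaled_bounds S0 hY; rewrite mulr1 in lo hi.
  apply: (realizes_domain square_newton square_geometry) => //.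
  - exact: rectangular_domain.
  - by rewrite mulr0; exact: z2r0.
  apply: (inside_unit (lo := S)) => //; last first.
    by apply: ltW; apply: lt_trans hi _; rewrite ltrDl ltr01.
  have -> : (height square_certificate).1 = (scale square_certificate + 1)%ZZ := erefl _.
  by rewrite z2rD z2r1.
have /andP[H1 _] := hH; have [lo hi] := scaled_bounds S0 hH.
pose B := ((height hexagonal_certificate).1 - 1)%ZZ.
have /andP[B1 B2] : z2r R B <= S * (Num.sqrt 3 / 2) <= z2r R B + 1 by exact: sqrt3_bounds.
apply: (realizes_domain hexagonal_newton hexagonal_geometry) => //.
- exact: rhombic_domain.
- by rewrite /= invr_ge0.
- have -> : scale hexagonal_certificate = (shear hexagonal_certificate * 2)%ZZ := erefl _.
  have two : z2r R 2%ZZ = 2 by [].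
  have half (t : R) : t = t * 2 * 2^-1 by rewrite mulfK // pnatr_eq0.
  by rewrite z2rM two; exact: half.
apply: (inside_unit (lo := z2r R B)) => //.
- have -> : (height hexagonal_certificate).1 = (B + 1)%ZZ := erefl _.
  by rewrite z2rD z2r1.
- exact: le_trans B1 lo.
apply: ltW; apply: lt_le_trans hi _.
by rewrite lerD2r.
Qed.
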